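(* Let $b\in H^\infty(\mathbb{D})$ with $\|b\|_\infty\le 1$. Then $\mathcal{A}(b)=\mathcal{A}(\bar b)$; that is, the two spaces coincide as vector spaces of functions and their norms $\|\cdot\|_{\mathcal{A}(b)}$ and $\|\cdot\|_{\mathcal{A}(\bar b)}$ are equivalent.
   Context: $\mathbb{D}$ is the open unit disk in $\mathbb{C}$, $dA$ is normalized Lebesgue area measure on $\mathbb{D}$, and $H^\infty=H^\infty(\mathbb{D})$ is the space of bounded analytic functions on $\mathbb{D}$ with the supremum norm $\|\cdot\|_\infty$. The Bergman space $A^2$ is the closed subspace of analytic functions in $L^2(\mathbb{D},dA)$, and $\widetilde P$ is the orthogonal projection of $L^2(\mathbb{D},dA)$ onto $A^2$. For $u\in L^\infty(\mathbb{D})$, the Bergman Toeplitz operator $\widetilde T_u$ on $A^2$ is $\widetilde T_u h=\widetilde P(uh)$. For a bounded operator $A$ on a Hilbert space $H$, the range space is $\mathcal{M}(A)=AH$ with inner product $\langle Af,Ag\rangle_{\mathcal{M}(A)}=\langle f,g\rangle_H$ for $f,g\in H\ominus\operatorname{Ker}A$. For $b\in H^\infty(\mathbb{D})$ with $\|b\|_\infty\le 1$, the sub-Bergman Hilbert spaces are the range spaces $\mathcal{A}(b)=\mathcal{M}\big((I-\widetilde T_b\widetilde T_{\bar b})^{1/2}\big)=(I-\widetilde T_b\widetilde T_{\bar b})^{1/2}A^2$ and $\mathcal{A}(\bar b)=\mathcal{M}\big((I-\widetilde T_{\bar b}\widetilde T_b)^{1/2}\big)=(I-\widetilde T_{\bar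 b}\widetilde T_b)^{1/2}A^2$, each with its range-space inner product and norm. *)

(* Defs.v *)
From HB Require Import structures.
From mathcomp Require Import all_boot all_order all_algebra complex.
From mathcomp Require Import all_classical all_reals all_analysis.

Set Implicit Arguments.
Unset Strict Implicit.
Unset Printing Implicit Defensive.

Import Order.TTheory GRing.Theory Num.Theory.
Import numFieldNormedType.Exports.

Local Open Scope classical_set_scope.
Local Open Scope ring_scope.

(* A function on the open unit disk is represented by a total function
   R[i] -> R[i].  Elements of the Bergman space are normalized to vanish outside
   the disk, so that Leibniz equality of such representatives is equality of
   functions on the disk. *)
Notation cfun R := (R[i] -> R[i]).

(* The complex plane as a measurable space, with the product of the Borel
   sigma-algebras on which [lebesgue_measure] is defined. *)
Notation plane R := (measurableTypeR R * measurableTypeR R)%type.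

Section disk.
Variable R : realType.
Implicit Types (f g h u b : cfun R) (z : R[i]).

Definition disk : set R[i] := [set z | `|z| < 1].

Definition analytic_on (U : set R[i]) f : Prop :=
  forall z0, U z0 -> exists r : R, 0 < r /\ exists a : nat -> R[i],
    forall z, `|z - z0| < r%:C%C ->
      (fun n : nat => (\sum_(0 <= k < n) a k * (z - z0) ^+ k) : R[i]^o) @ \oo
        --> (f z : R[i]^o).

Definition supnorm f : R := sup [set complex.Re `|f z| | z in disk].

Definition Hinfty : set (cfun R) :=
  [set f | analytic_on disk f /\
           exists M : R, forall z, disk z -> `|f z| <= M%:C%C].

Definition cplx (p : plane R) : R[i] := (p.1 +i* p.2)%C.

Lemma invpi_ge0 : (0 : R) <= pi^-1.
Proof. by rewrite invr_ge0 pi_ge0. Qed.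

(* Normalized so that the disk has measure 1; integrals against it are always
   taken over the disk. *)
Definition dA : {measure set (plane R) -> \bar R} :=
  mscale (NngNum invpi_ge0) (@lebesgue_measure R \x @lebesgue_measure R)%E.

Definition disk2 : set (plane R) := cplx @^-1` disk.

Definition cintegral f : R[i] :=
  ((\int[dA]_(p in disk2) complex.Re (f (cplx p)))%R +i*
   (\int[dA]_(p in disk2) complex.Im (f (cplx p)))%R)%C.

Definition square_integrable f : Prop :=
  [/\ measurable_fun disk2 (fun p => complex.Re (f (cplx p))),
      measurable_fun disk2 (fun p => complex.Im (f (cplx p))) &
      (\int[dA]_(p in disk2) ((complex.Re `|f (cplx p)|) ^+ 2)%:E < +oo)%E].

Definition inner f g : R[i] := cintegral (fun z => f z * (g z)^*%C).

Definition l2norm f : R := Num.sqrt (complex.Re (inner f f)).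

Definition bergman : set (cfun R) :=
  [set f | [/\ analytic_on disk f, square_integrable f &
               forall z, ~ disk z -> f z = 0]].

Definition bergman_proj h : cfun R :=
  xget (fun=> 0) [set g | bergman g /\
                   forall k, bergman k -> inner (h - g) k = 0].

Definition toeplitz u h : cfun R := bergman_proj (fun z => u z * h z).

Definition operator := cfun R -> cfun R.
Implicit Types A S T : operator.

Definition bounded_operator A : Prop :=
  [/\ forall f, bergman f -> bergman (A f),
      forall (c : R[i]) f g, bergman f -> bergman g ->
        A (fun z => c * f z + g z) = (fun z => c * A f z + A g z) &
      exists M : R, forall f, bergman f -> l2norm (A f) <= M * l2norm f].

Definition positive_operator A : Prop :=
  bounded_operator A /\ forall f, bergman f -> 0 <= inner (A f) f.

Definition sqrt_operator A : operator :=
  xget (fun=> fun=> 0) [set S | positive_operator S /\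
                         forall f, bergman f -> S (S f) = A f].

(* [H (-) Ker A] for [H] the Bergman space *)
Definition coker A : set (cfun R) :=
  [set f | bergman f /\
           forall k, bergman k -> A k = (fun=> 0) -> inner f k = 0].

Definition range_space A : set (cfun R) := A @` bergman.

(* For [x] in [range_space A], the unique preimage orthogonal to the kernel. *)
Definition range_lift A (x : cfun R) : cfun R :=
  xget (fun=> 0) [set f | coker A f /\ A f = x].

Definition range_inner A (x y : cfun R) : R[i] :=
  inner (range_lift A x) (range_lift A y).

Definition range_norm A (x : cfun R) : R :=
  Num.sqrt (complex.Re (range_inner A x x)).

Definition conjfun b : cfun R := fun z => (b z)^*%C.

(* (I - T_b T_{b^bar})^{1/2}; at [conjfun b] this is
   (I - T_{b^bar} T_b)^{1/2}. *)
Definition defect b : operator :=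
  sqrt_operator (fun f => f - toeplitz b (toeplitz (conjfun b) f)).

Definition sub_bergman b : set (cfun R) := range_space (defect b).

Definition sub_bergman_norm b : cfun R -> R := range_norm (defect b).

End disk.

(* Main.v *)
(** Let S1 and S2 be the square roots of I - T_b T_b^* and I - T_b^* T_b. By
    Douglas' lemma it suffices to show |S2 f| <= |S1 f| <= C |S2 f| on A^2. The
    first inequality says that T_b^* f = P(conj b f) is no longer than b f. The
    second reduces to the estimate
    |(I - P)(conj b f)|^2 <= 32 int (1 - |b|^2) |f|^2 of a Hankel operator.
    By density and dominated convergence f and b may be polynomials. Then
    conj b f = h + d(rho W) with h analytic, rho = 1 - |z|^2 and W a polynomial
    in z and its conjugate; Stokes' formula and the Hardy inequality
    |W| <= 2 |d(rho W)| bound the left side by 4 int rho^2 |b'|^2 |f|^2, and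
    rho^2 |b'|^2 <= 8 (1 - |b|^2) is a weak Schwarz-Pick inequality.

    Functions given by local power series are handled through uniform
    approximation by polynomials on disks, a notion stable under limits, products
    and change of center; continuing a Taylor series across the disk rests on
    Cauchy estimates obtained by averaging over roots of unity. *)

Require Import Defs.
From mathcomp Require Import all_boot all_order all_algebra all_solvable all_field complex.
From mathcomp Require Import all_classical all_reals all_analysis measurable_realfun.
From mathcomp Require Import ring lra zify.

Import Order.TTheory GRing.Theory Num.Theory.
Import numFieldNormedType.Exports.
Local Open Scope classical_set_scope.
Local Open Scope ring_scope.

Set Implicit Arguments.
Unset Strict Implicit.

(** The projection, the square root and the range lift are picked by choice, so each needs an
    existence proof before anything is known of it; conversely any choice serves. A positive root S
    of I - X satisfies |S f|^2 = <S^2 f, f>, which depends on X alone, and a lift orthogonal to the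
    kernel has least norm among all preimages. The two defect norms differ only through |b f|^2 =
    |P(conj b f)|^2 + |(I - P)(conj b f)|^2, so the comparison costs a factor 1 + 32 = 33 on
    squares, rounded up to 6^2. The constant 32 is 4 * 8, with 4 from Hardy's inequality and AM-GM,
    and 8 from Bessel's inequality on a disk of radius 1 - |z|. The estimate cannot be run on b and
    f themselves, since integration by parts asks for boundary values that a Bergman function may
    fail to have. For polynomials in z and its conjugate differentiation is symbolic, and Stokes'
    formula reduces to Fubini and the fundamental theorem of calculus on chords. *)

(** * The real-valued modulus and sequential convergence in the complex plane *)

Section modulus.
Variable R : realType.
Implicit Types (z w : R[i]) (r s : R).

Definition cabs z : R := complex.Re `|z|.

Lemma normE z : `|z| = (cabs z)%:C%C.
Proof. by rewrite /cabs normc_def. Qed.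

Lemma cabs_ge0 z : 0 <= cabs z.
Proof. by rewrite -(ler0c (cabs z)) -normE normr_ge0. Qed.

Lemma cabsE z : cabs z = Num.sqrt (complex.Re z ^+ 2 + complex.Im z ^+ 2).
Proof. by rewrite /cabs normc_def. Qed.

Lemma sqr_cabs z : cabs z ^+ 2 = complex.Re z ^+ 2 + complex.Im z ^+ 2.
Proof. by rewrite cabsE sqr_sqrtr// addr_ge0// sqr_ge0. Qed.

Lemma cabsM z w : cabs (z * w) = cabs z * cabs w.
Proof. by apply: complexI; rewrite rmorphM -!normE normrM. Qed.

Lemma cabsX z n : cabs (z ^+ n) = cabs z ^+ n.
Proof. by apply: complexI; rewrite rmorphXn -!normE normrX. Qed.

Lemma cabsD z w : cabs (z + w) <= cabs z + cabs w.
Proof. by rewrite -lecR rmorphD -!normE ler_normD. Qed.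

Lemma cabsN z : cabs (- z) = cabs z.
Proof. by rewrite /cabs normrN. Qed.

Lemma cabsB z w : cabs (z - w) <= cabs z + cabs w.
Proof. by rewrite -(cabsN w) cabsD. Qed.

Lemma cabsC z w : cabs (z - w) = cabs (w - z).
Proof. by rewrite -cabsN opprB. Qed.

Lemma cabs0 : cabs 0 = 0.
Proof. by rewrite /cabs normr0. Qed.

Lemma cabs1 : cabs 1 = 1.
Proof. by rewrite /cabs normr1. Qed.

Lemma cabs0_eq0 z : cabs z = 0 -> z = 0.
Proof. by move=> h; apply/eqP; rewrite -normr_eq0 normE h. Qed.

Lemma cabsR r : cabs r%:C%C = `|r|.
Proof. by rewrite cabsE/= expr0n addr0 sqrtr_sqr. Qed.

Lemma cabs_nat n : cabs n%:R = n%:R.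
Proof. by rewrite -(rmorph_nat (real_complex R)) cabsR ger0_norm// ler0n. Qed.

Lemma cabs_conj z : cabs z^*%C = cabs z.
Proof. by rewrite !cabsE; case: z => a b /=; rewrite sqrrN. Qed.

Lemma normRe_le_cabs z : `|complex.Re z| <= cabs z.
Proof. by rewrite -lecR -normE normc_ge_Re. Qed.

Lemma normIm_le_cabs z : `|complex.Im z| <= cabs z.
Proof.
rewrite -(ler_pXn2r (_ : 0 < 2)%N) ?nnegrE ?normr_ge0 ?cabs_ge0//.
by rewrite sqr_cabs real_normK ?num_real// lerDr sqr_ge0.
Qed.

Lemma cabs_le_ReIm z : cabs z <= `|complex.Re z| + `|complex.Im z|.
Proof.
rewrite -(ler_pXn2r (_ : 0 < 2)%N) ?nnegrE ?cabs_ge0 ?addr_ge0//.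
rewrite sqr_cabs sqrrD !real_normK ?num_real// lerD2r lerDl.
by rewrite mulrn_wge0 ?mulr_ge0.
Qed.

Lemma cabs_sum (I : Type) (t : seq I) (P : pred I) (F : I -> R[i]) :
  cabs (\sum_(i <- t | P i) F i) <= \sum_(i <- t | P i) cabs (F i).
Proof.
elim/big_rec2: _ => [|i x y _ h]; first by rewrite cabs0.
by apply: le_trans (cabsD _ _) _; rewrite lerD2l.
Qed.

Lemma conjM_cabs z : z * z^*%C = (cabs z ^+ 2)%:C%C.
Proof. by rewrite -sqr_normc normE rmorphXn. Qed.

Lemma Re_real r : complex.Re r%:C%C = r. Proof. by []. Qed.

Lemma diskE z : disk z <-> cabs z < 1.
Proof. by rewrite /disk/= normE -(rmorph1 (real_complex R)) ltcR. Qed.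

Definition ccvg (u : nat -> R[i]) (l : R[i]) :=
  forall e : R, 0 < e -> exists N, forall n, (N <= n)%N -> cabs (l - u n) < e.

(** A positive element of [R[i]] is real, so the complex epsilons of the filter topology can be
    traded for real ones. *)
Lemma ccvgP (u : nat -> R[i]) (l : R[i]) :
  ((u : nat -> R[i]^o) @ \oo --> (l : R[i]^o)) <-> ccvg u l.
Proof.
split=> [/cvgrPdist_lt h e e0|h].
  have := h e%:C%C; rewrite ltcR => /(_ e0) [N _ hN].
  by exists N => n Nn; have := hN n Nn; rewrite /= normE ltcR.
apply/cvgrPdist_lt => e e0.
have er : (complex.Re e)%:C%C = e by rewrite RRe_real// gtr0_real.
have : 0 < complex.Re e by rewrite -ltcR er.
move=> /h[N hN]; exists N => // n /= Nn.
by rewrite normE -er ltcR hN.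
Qed.

Lemma ccvg_unique u l1 l2 : ccvg u l1 -> ccvg u l2 -> l1 = l2.
Proof.
move=> h1 h2; apply/eqP; rewrite -subr_eq0; apply/eqP/cabs0_eq0/eqP.
rewrite eq_le cabs_ge0 andbT leNgt; apply/negP => d0.
have d2 : 0 < cabs (l1 - l2) / 2 by lra.
have [[N1 H1] [N2 H2]] := (h1 _ d2, h2 _ d2).
have := H1 (maxn N1 N2) (leq_maxl _ _); have := H2 (maxn N1 N2) (leq_maxr _ _).
rewrite (cabsC l2); set v := u _ => a1 a2.
have := cabsD (l1 - v) (v - l2).
have -> : l1 - v + (v - l2) = l1 - l2 by ring.
lra.
Qed.

Lemma cabs_limit_le u l B N :
  ccvg u l -> (forall n, (N <= n)%N -> cabs (u n) <= B) -> cabs l <= B.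
Proof.
move=> h hB; apply/ler_addgt0Pl => e /h[M hM].
have := hM (maxn N M) (leq_maxr _ _); have := hB (maxn N M) (leq_maxl _ _).
set v := u _ => a1 a2; have := cabsD (l - v) v; rewrite subrK; lra.
Qed.

(** Real and imaginary parts are 1-Lipschitz for the modulus, so completeness is inherited from
    [R]. *)
Lemma ccauchy_cvg (u : nat -> R[i]) :
  (forall e : R, 0 < e ->
     exists N, forall n m, (N <= n)%N -> (N <= m)%N -> cabs (u n - u m) <= e) ->
  exists l, ccvg u l.
Proof.
move=> h.
have aux (F : R[i] -> R) : (forall z w, `|F z - F w| <= cabs (z - w)) ->
    exists l : R, (fun n => F (u n)) @ \oo --> l.
  move=> hF; suff : cvg ((fun n => F (u n)) @ \oo).
    by move=> ?; exists (lim ((fun n => F (u n)) @ \oo)).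
  apply/cauchy_cvgP.
  apply/cauchy_ballP => e e0.
  have e2 : 0 < e / 2 by lra.
  have [N hN] := h _ e2.
  exists ((fun x => exists n, (N <= n)%N /\ x = F (u n)),
          (fun x => exists n, (N <= n)%N /\ x = F (u n))).
    by split; exists N => // n /= Nn; exists n.
  move=> [x y] /= [[n [Nn ->]] [m [Nm ->]]].
  rewrite /ball/=; apply: le_lt_trans (hF _ _) _.
  by apply: le_lt_trans (hN _ _ Nn Nm) _; lra.
have [a ha] := aux (@complex.Re R) ltac:(by move=> z w;
  rewrite -(raddfB (@complex.Re R : {additive Rcomplex R -> R})) normRe_le_cabs).
have [b hb] := aux (@complex.Im R) ltac:(by move=> z w;
  rewrite -(raddfB (@complex.Im R : {additive Rcomplex R -> R})) normIm_le_cabs).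
exists (a +i* b)%C => e e0.
have e2 : 0 < e / 2 by lra.
move/cvgrPdist_lt : ha => /(_ _ e2) [N1 _ H1].
move/cvgrPdist_lt : hb => /(_ _ e2) [N2 _ H2].
exists (maxn N1 N2) => n; rewrite geq_max => /andP[/H1 /= a1 /H2 /= a2].
apply: le_lt_trans (cabs_le_ReIm _) _.
by case: (u n) a1 a2 => c d /=; lra.
Qed.

End modulus.

(** * Cauchy's estimate for polynomials *)

Section cauchy_estimate.
Variable R : realType.
Local Notation C := R[i].

(** X^n - 1 splits and is separable, so it has n distinct roots; a set of n roots of unity of
    exponent n contains a primitive one. *)
Lemma prim_root_exists n : (0 < n)%N -> exists z : C, n.-primitive_root z.
Proof.
pose p : {poly C} := 'X^n - 1; have [r Dp] := closed_field_poly_normal p.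
move=> n_gt0; rewrite (monicP _) ?monicXnsubC // scale1r in Dp.
have rn1: all n.-unity_root r by apply/allP=> z; rewrite -root_prod_XsubC -Dp.
have sz_r: (n < (size r).+1)%N.
  by rewrite -(size_prod_XsubC r id) -Dp size_XnsubC.
have [|z] := hasP (cyclic.has_prim_root n_gt0 rn1 _ sz_r); last by exists z.
by rewrite -separable_prod_XsubC -Dp separable_Xn_sub_1 // pnatr_eq0 -lt0n.
Qed.

Lemma cabs_unity_root (z : C) n : (0 < n)%N -> z ^+ n = 1 -> cabs z = 1.
Proof.
move=> n0 zn; have := cabsX z n; rewrite zn cabs1 => /esym/eqP.
by rewrite pexpr_eq1// ?cabs_ge0// => /eqP.
Qed.

Lemma sum_unity_root (z : C) n : z ^+ n = 1 -> z != 1 ->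
  \sum_(j < n) z ^+ j = 0.
Proof.
move=> zn z1; apply/eqP; have := subrX1 z n.
by rewrite zn subrr => /esym/eqP; rewrite mulf_eq0 subr_eq0 (negPf z1).
Qed.

(** A discrete Cauchy formula: the weight is w^(-jn), written with a natural exponent, and the sum
    over [j] annihilates every monomial whose degree is not congruent to [n] modulo [N]. *)
Lemma circle_mean_coef (p : {poly C}) (w : C) N n :
  N.-primitive_root w -> (size p <= N)%N -> (n < N)%N -> forall c : C,
  \sum_(j < N) (w ^+ j) ^+ (N - n) * p.[c * w ^+ j] = N%:R * p`_n * c ^+ n.
Proof.
move=> wN pN nN c.
transitivity (\sum_(k < N) p`_k * c ^+ k * \sum_(j < N) (w ^+ (k + (N - n))) ^+ j).
  under eq_bigr => j _.
    rewrite (horner_coef_wide _ pN) mulr_sumr.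
    under eq_bigr => k _.
      have -> : (w ^+ j) ^+ (N - n) * (p`_k * (c * w ^+ j) ^+ k) =
          p`_k * c ^+ k * (w ^+ (k + (N - n))) ^+ j.
        rewrite -[in RHS]exprM mulnDl exprD exprMn mulnC exprM (mulnC _ j) (exprM w j).
        ring.
      over.
    over.
  by rewrite exchange_big/=; apply: eq_bigr => k _; rewrite mulr_sumr.
rewrite (bigD1 (Ordinal nN))//= [X in _ + X]big1 ?addr0.
  rewrite subnKC ?(ltnW nN)// (prim_expr_order wN).
  rewrite (eq_bigr (fun=> 1)) => [|j _]; last by rewrite expr1n.
  by rewrite sumr_const card_ord; ring.
move=> k kn; rewrite sum_unity_root ?mulr0//.
  by rewrite -exprM mulnC exprM (prim_expr_order wN) expr1n.
rewrite -(prim_order_dvd wN); apply: contra kn => /dvdnP[q qE].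
apply/eqP/val_inj => /=; have kN := ltn_ord k.
(* The exponent k + (N - n) lies strictly between 0 and 2N, so it can only be the multiple N
   itself. *)
have : q = 1%N by nia.
by move=> q1; move: qE; rewrite q1; lia.
Qed.

(** Carries bounds obtained at every smaller radius to the limiting radius. *)
Lemma continuous_le_left (F : R -> R) (r M : R) :
  {for r, continuous F} -> 0 < r ->
  (forall s, 0 <= s -> s < r -> F s <= M) -> F r <= M.
Proof.
move=> cF r0 FM.
have cF' : F x @[x --> r^'-] --> F r by apply: cvg_at_left_filter.
rewrite -(cvg_lim _ cF')//; apply: limr_le; first by apply/cvg_ex; exists (F r).
near=> s; apply: FM; last by near: s; exact: nbhs_left_lt.
by near: s; apply: nbhs_left_ge.
Unshelve. all: by end_near. Qed.

(* Averaging over the N-th roots of unity extracts a coefficient exactly. *)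
Lemma cauchy_bound (p : {poly C}) (r M : R) :
  0 < r -> (forall z, cabs z < r -> cabs p.[z] <= M) ->
  forall n, cabs p`_n * r ^+ n <= M.
Proof.
move=> r0 pM n; apply: (@continuous_le_left (fun s => cabs p`_n * s ^+ n)) => //.
  apply: continuousM; first exact: cst_continuous.
  exact: exprn_continuous.
(* Enough nodes to separate all degrees occurring in [p] as well as [n]. *)
move=> s s0 sr; set N := maxn (size p) n.+1.
have [//|w wN] := @prim_root_exists N; first by rewrite /N; lia.
have N0 := prim_order_gt0 wN.
have pN : (size p <= N)%N by rewrite /N; lia.
have nN : (n < N)%N by rewrite /N; lia.
have aw j : cabs (w ^+ j) = 1.
  by rewrite cabsX (@cabs_unity_root _ N)// ?expr1n// (prim_expr_order wN).
have := circle_mean_coef wN pN nN s%:C%C.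
move=> /(congr1 (@cabs R)); rewrite !cabsM cabs_nat cabsX cabsR ger0_norm// => eq.
have NR : 0 < N%:R :> R by rewrite ltr0n.
rewrite -(ler_pM2l NR) mulrA -eq; apply: le_trans (cabs_sum _ _ _) _.
apply: (@le_trans _ _ (\sum_(j < N) M)); last by rewrite sumr_const card_ord mulr_natl.
apply: ler_sum => j _; rewrite cabsM (cabsX (w ^+ j)) aw expr1n mul1r.
by apply: pM; rewrite cabsM aw mulr1 cabsR ger0_norm.
Qed.

End cauchy_estimate.

(** * Uniform limits of polynomials on disks and their Taylor coefficients *)

Section polynomial_approximation.
Variable R : realType.
Local Notation C := R[i].
Implicit Types (f g : C -> C) (z w : C) (r s t e M : R) (p q : {poly C}).

Definition papprox f z0 s := forall e, 0 < e ->
  exists p, forall z, cabs (z - z0) < s -> cabs (f z - p.[z]) <= e.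

Lemma papprox_sub f z0 s z1 s1 :
  cabs (z1 - z0) + s1 <= s -> papprox f z0 s -> papprox f z1 s1.
Proof.
move=> le fa e /fa[p hp]; exists p => z zs; apply: hp.
have := cabsD (z - z1) (z1 - z0); have -> : z - z1 + (z1 - z0) = z - z0 by ring.
lra.
Qed.

Lemma papprox_lim f z0 s :
  (forall e, 0 < e -> exists2 g, papprox g z0 s &
     forall z, cabs (z - z0) < s -> cabs (f z - g z) <= e) -> papprox f z0 s.
Proof.
move=> h e e0; have e2 : 0 < e / 2 by lra.
have [g ga fg] := h _ e2; have [p gp] := ga _ e2.
exists p => z zs; have := fg z zs; have := gp z zs.
have := cabsD (f z - g z) (g z - p.[z]).
have -> : f z - g z + (g z - p.[z]) = f z - p.[z] by ring.
lra.
Qed.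

Lemma papprox_ext f g z0 s : (forall z, cabs (z - z0) < s -> f z = g z) ->
  papprox f z0 s -> papprox g z0 s.
Proof.
by move=> fg fa e /fa[p hp]; exists p => z zs; rewrite -fg// hp.
Qed.

Lemma papprox_poly p z0 s : papprox (horner p) z0 s.
Proof. by move=> e e0; exists p => z _; rewrite subrr cabs0 ltW. Qed.

Lemma horner_bounded p s : exists2 M, 0 < M & forall z, cabs z <= s -> cabs p.[z] <= M.
Proof.
(* The indicator keeps the bound positive for negative [s], where the disk is empty but odd powers
   of [s] are negative. *)
exists (1 + \sum_(i < size p) cabs p`_i * s ^+ i * (0 <= s)%R%:R).
  by rewrite ltr_pwDl// sumr_ge0// => i _; case: (leP 0 s) => s0;
    rewrite ?mulr0 ?mulr1// mulr_ge0 ?cabs_ge0 ?exprn_ge0.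
move=> z zs; have s0 : 0 <= s by apply: le_trans zs; exact: cabs_ge0.
rewrite horner_coef; apply: le_trans (cabs_sum _ _ _) _.
rewrite ler_wpDl//; apply: ler_sum => i _.
rewrite s0 mulr1 cabsM cabsX ler_wpM2l ?cabs_ge0// lerXn2r// nnegrE ?cabs_ge0//.
Qed.

Lemma horner_bounded_ball p z0 s :
  exists2 M, 0 < M & forall z, cabs (z - z0) < s -> cabs p.[z] <= M.
Proof.
have [M M0 hM] := horner_bounded p (s + cabs z0).
exists M => // z zs; apply: hM.
by have := cabsD (z - z0) z0; rewrite subrK; lra.
Qed.

Lemma papprox_bounded f z0 s : papprox f z0 s ->
  exists2 M, 0 < M & forall z, cabs (z - z0) < s -> cabs (f z) <= M.
Proof.
move=> /(_ 1 ltr01)[p hp]; have [M M0 hM] := horner_bounded_ball p z0 s.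
exists (1 + M) => [|z zs]; first lra.
have := cabsD (f z - p.[z]) p.[z]; rewrite subrK.
by have := hp z zs; have := hM z zs; lra.
Qed.

Lemma papproxD f g z0 s : papprox f z0 s -> papprox g z0 s ->
  papprox (fun z => f z + g z) z0 s.
Proof.
move=> fa ga e e0; have e2 : 0 < e / 2 by lra.
have [p hp] := fa _ e2; have [q hq] := ga _ e2; exists (p + q) => z zs.
rewrite hornerD; have := cabsD (f z - p.[z]) (g z - q.[z]).
have -> : f z - p.[z] + (g z - q.[z]) = f z + g z - (p.[z] + q.[z]) by ring.
by have := hp z zs; have := hq z zs; lra.
Qed.

(** Two replacements, each paid for by a bound on the other factor: [g] by a polynomial [q], using
    that [f] is bounded, then [f], using that [q] is bounded. *)
Lemma papproxM f g z0 s : papprox f z0 s -> papprox g z0 s ->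
  papprox (fun z => f z * g z) z0 s.
Proof.
move=> fa ga; have [M M0 hM] := papprox_bounded fa.
apply: papprox_lim => e e0.
have eM : 0 < e / M by rewrite divr_gt0.
have [q hq] := ga _ eM; exists (fun z => f z * q.[z]); last first.
  move=> z zs; rewrite -mulrBr cabsM.
  apply: le_trans (ler_pM (cabs_ge0 _) (cabs_ge0 _) (hM z zs) (hq z zs)) _.
  by rewrite mulrCA divff ?mulr1// gt_eqF.
move=> d d0; have [N N0 hN] := horner_bounded_ball q z0 s.
have dN : 0 < d / N by rewrite divr_gt0.
have [p hp] := fa _ dN; exists (p * q) => z zs.
rewrite hornerM -mulrBl cabsM.
apply: le_trans (ler_pM (cabs_ge0 _) (cabs_ge0 _) (hp z zs) (hN z zs)) _.
by rewrite divfK// gt_eqF.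
Qed.

Lemma papproxZ c f z0 s : papprox f z0 s -> papprox (fun z => c * f z) z0 s.
Proof.
move=> fa; apply: (@papproxM (fun=> c)) => //.
by apply: (@papprox_ext (horner c%:P)) (papprox_poly _ _ _) => z _; rewrite hornerC.
Qed.

Lemma papproxB f g z0 s : papprox f z0 s -> papprox g z0 s ->
  papprox (fun z => f z - g z) z0 s.
Proof.
move=> fa ga; have := papproxD fa (papproxZ (-1) ga).
by apply: papprox_ext => z _; rewrite mulN1r.
Qed.

Lemma papprox_affine f c d s t z0 : (forall z, cabs (z - z0) < s -> cabs (c * z + d) < t) ->
  papprox f 0 t -> papprox (fun z => f (c * z + d)) z0 s.
Proof.
move=> h fa e /fa[p hp]; exists (p \Po (c *: 'X + d%:P)) => z /h zs.
by rewrite horner_comp !hornerE; apply: hp; rewrite subr0.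
Qed.

Lemma papprox_shift f z0 s : papprox f z0 s -> papprox (fun w => f (z0 + w)) 0 s.
Proof.
move=> fa e /fa[p hp]; exists (p \Po ('X + z0%:P)) => z; rewrite subr0 => zs.
by rewrite horner_comp !hornerE (addrC z); apply: hp; rewrite addrC addKr.
Qed.

(* [a] lists the Taylor coefficients of [f] at 0: by Cauchy's estimate they are
   close to those of any polynomial close to [f]. *)
Definition taylor f s (a : nat -> C) := forall p e, 0 <= e ->
  (forall z, cabs z < s -> cabs (f z - p.[z]) <= e) ->
  forall n, cabs (a n - p`_n) * s ^+ n <= e.

Lemma coef_close p q s e : 0 < s ->
  (forall z, cabs z < s -> cabs (p.[z] - q.[z]) <= e) ->
  forall n, cabs (p`_n - q`_n) * s ^+ n <= e.
Proof.
move=> s0 h n; rewrite -coefB; apply: cauchy_bound => // z zs.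
by rewrite hornerD hornerN h.
Qed.

Lemma null_sequence : exists2 v : nat -> R, forall j, 0 < v j &
  forall e, 0 < e -> exists N, forall j, (N <= j)%N -> v j <= e.
Proof.
exists (fun j => j.+1%:R^-1) => [j|e e0]; first by rewrite invr_gt0.
have [N _ hN] := near_infty_natSinv_lt (PosNum e0).
by exists N => j /hN /ltW.
Qed.

(** Cauchy's estimate for differences makes each coefficient of a uniformly convergent sequence of
    polynomials a Cauchy sequence; the limits are the required coefficients. *)
Lemma taylor_exists f s : 0 < s -> papprox f 0 s -> exists a, taylor f s a.
Proof.
move=> s0 fa.
have [v v0 inv_small] := null_sequence.
have /choice[P hP] : forall j : nat, exists p : {poly C},
    forall z, cabs z < s -> cabs (f z - p.[z]) <= v j.
  move=> j; have [p hp] := fa _ (v0 j).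
  by exists p => z zs; apply: hp; rewrite subr0.
have PP j p e : (forall z, cabs z < s -> cabs (f z - p.[z]) <= e) ->
    forall n, cabs ((P j)`_n - p`_n) * s ^+ n <= e + v j.
  move=> hp; apply: coef_close => // z zs.
  have := cabsD ((P j).[z] - f z) (f z - p.[z]); rewrite (cabsC (P j).[z] (f z)).
  have -> : (P j).[z] - f z + (f z - p.[z]) = (P j).[z] - p.[z] by ring.
  by have := hP j z zs; have := hp z zs; lra.
have /choice[a ha] : forall n, exists l, ccvg (fun j => (P j)`_n) l.
  move=> n; apply: ccauchy_cvg => e e0.
  have sn : 0 < s ^+ n by rewrite exprn_gt0.
  have [|N hN] := inv_small (e * s ^+ n / 2); first by rewrite divr_gt0// mulr_gt0.
  exists N => i j Ni Nj; rewrite -(ler_pM2r sn).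
  apply: le_trans (PP i _ _ (hP j) n) _.
  by have := hN _ Ni; have := hN _ Nj; lra.
exists a => p e e0 hp n; have sn : 0 < s ^+ n by rewrite exprn_gt0.
rewrite -ler_pdivlMr//; apply/ler_addgt0Pl => d d0.
have [N1 h1] := ha n (d / 2) ltac:(lra).
have [|N2 h2] := inv_small (d / 2 * s ^+ n); first by rewrite mulr_gt0//; lra.
pose j := maxn N1 N2.
have := PP j p e hp n; rewrite -ler_pdivlMr// mulrDl.
have := h1 j (leq_maxl _ _); have := h2 j (leq_maxr _ _).
rewrite -ler_pdivrMr//.
have := cabsD (a n - (P j)`_n) ((P j)`_n - p`_n).
have -> : a n - (P j)`_n + ((P j)`_n - p`_n) = a n - p`_n by ring.
lra.
Qed.

(** On the smaller disk more polynomials count as close to [f]. Such a [p] is compared with a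
    polynomial [q] that is close on the whole large disk, to which the hypothesis on [a] applies. *)
Lemma taylor_sub f s t a : 0 < t -> t <= s -> papprox f 0 s -> taylor f s a ->
  taylor f t a.
Proof.
move=> t0 ts fa ta p e e0 hp n; apply/ler_addgt0Pl => d d0.
have s0 : 0 < s by lra.
have [q hq] := fa (d / 2) ltac:(lra).
have hq' z : cabs z < s -> cabs (f z - q.[z]) <= d / 2.
  by move=> zs; apply: hq; rewrite subr0.
have tn : 0 <= t ^+ n by rewrite exprn_ge0// ltW.
have d2 : 0 <= d / 2 by lra.
have h1 := ta q _ d2 hq' n.
have h1' : cabs (a n - q`_n) * t ^+ n <= d / 2.
  by apply: le_trans h1; rewrite ler_wpM2l ?cabs_ge0// lerXn2r// nnegrE ltW.
have : cabs (q`_n - p`_n) * t ^+ n <= e + d / 2.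
  apply: coef_close => // z zt.
  have := cabsD (q.[z] - f z) (f z - p.[z]); rewrite (cabsC q.[z] (f z)).
  have -> : q.[z] - f z + (f z - p.[z]) = q.[z] - p.[z] by ring.
  by have := hp z zt; have := hq' z (lt_le_trans zt ts); lra.
have := ler_wpM2r tn (cabsD (a n - q`_n) (q`_n - p`_n)); rewrite mulrDl.
have -> : a n - q`_n + (q`_n - p`_n) = a n - p`_n by ring.
lra.
Qed.

Lemma taylor_bound f s a M : 0 <= M -> taylor f s a ->
  (forall z, cabs z < s -> cabs (f z) <= M) -> forall n, cabs (a n) * s ^+ n <= M.
Proof.
move=> M0 ta fM n; have := ta 0 M M0 _ n; rewrite coef0 subr0; apply => z zs.
by rewrite horner0 subr0 fM.
Qed.

Lemma geom_sum_le (q : R) n : 0 <= q -> q < 1 ->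
  \sum_(i < n) q ^+ i <= (1 - q)^-1.
Proof.
move=> q0 q1; have q1' : 0 < 1 - q by lra.
rewrite -(ler_pM2l q1') divff ?gt_eqF//.
by have := subrX1 q n; have := exprn_ge0 n q0; lra.
Qed.

(** One good polynomial [p] controls all partial sums of length at least its size: the coefficient
    errors are at most a constant over s^k, and are summed geometrically for |z| <= t < s. *)
Lemma taylor_cvg f s t a : 0 < s -> 0 <= t -> t < s -> papprox f 0 s ->
  taylor f s a -> forall e, 0 < e -> exists N, forall n, (N <= n)%N ->
  forall z, cabs z <= t -> cabs (f z - (\poly_(k < n) a k).[z]) <= e.
Proof.
move=> s0 t0 ts fa ta e e0.
(* The summand 1 accounts for f - p, the other for the geometric series of coefficient errors. *)
pose K := 1 + (1 - t / s)^-1.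
have q0 : 0 <= t / s by rewrite divr_ge0// ltW.
have q1 : t / s < 1 by rewrite ltr_pdivrMr// mul1r.
have K0 : 0 < K by rewrite /K addr_gt0// invr_gt0; lra.
have eK : 0 < e / K by rewrite divr_gt0.
have [p hp] := fa _ eK.
have hp' z : cabs z < s -> cabs (f z - p.[z]) <= e / K.
  by move=> zs; apply: hp; rewrite subr0.
exists (size p) => n pn z zt.
have tap := ta p _ (ltW eK) hp'.
rewrite -[leRHS](divfK (lt0r_neq0 K0)) {2}/K mulrDr mulr1.
have -> : f z - (\poly_(k < n) a k).[z] =
    (f z - p.[z]) + \sum_(k < n) (p`_k - a k) * z ^+ k.
  rewrite horner_poly (horner_coef_wide _ pn).
  have -> : \sum_(k < n) (p`_k - a k) * z ^+ k =
      \sum_(k < n) p`_k * z ^+ k - \sum_(k < n) a k * z ^+ k.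
    by rewrite -sumrB; apply: eq_bigr => k _; rewrite mulrBl.
  by rewrite addrA subrK.
apply: le_trans (cabsD _ _) _; apply: lerD; first by apply: hp'; lra.
apply: le_trans (cabs_sum _ _ _) _.
apply: le_trans (ler_wpM2l (ltW eK) (geom_sum_le n q0 q1)).
rewrite mulr_sumr; apply: ler_sum => k _.
rewrite cabsM cabsX cabsC expr_div_n mulrA ler_pdivlMr ?exprn_gt0//.
rewrite mulrAC; apply: ler_pM; rewrite ?mulr_ge0 ?exprn_ge0 ?cabs_ge0 ?(ltW s0)//.
by rewrite lerXn2r// nnegrE ?cabs_ge0.
Qed.

End polynomial_approximation.

(** * Local power series versus polynomial approximation, and the identity theorem *)

Section analytic_continuation.
Variable R : realType.
Local Notation C := R[i].
Implicit Types (f g : C -> C) (z w : C) (r s t e M d : R) (p q : {poly C})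
  (a : nat -> C).

Definition psum a n : {poly C} := \poly_(k < n) a k.

Lemma psumE a n z : (psum a n).[z] = \sum_(k < n) a k * z ^+ k.
Proof. by rewrite /psum horner_poly. Qed.

Definition series_sum a z : C := xget 0 [set l | ccvg (fun n => (psum a n).[z]) l].

Lemma psum_tail a r t M : 0 < r -> 0 <= t -> t < r ->
  (forall k, cabs (a k) * r ^+ k <= M) ->
  forall n m z, (n <= m)%N -> cabs z <= t ->
  cabs ((psum a m).[z] - (psum a n).[z]) <= M * (t / r) ^+ n * (1 - t / r)^-1.
Proof.
move=> r0 t0 tr aM n m z nm zt.
have q0 : 0 <= t / r by rewrite divr_ge0// ltW.
have q1 : t / r < 1 by rewrite ltr_pdivrMr// mul1r.
have M0 : 0 <= M by apply: le_trans (aM 0%N); rewrite expr0 mulr1 cabs_ge0.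
rewrite !psumE -(subnKC nm) big_split_ord/=.
rewrite (addrC (\sum_(i < n) _)) addrK.
apply: le_trans (cabs_sum _ _ _) _.
have := geom_sum_le (m - n) q0 q1.
move=> /(ler_wpM2l (mulr_ge0 M0 (exprn_ge0 n q0))); apply: le_trans.
rewrite mulr_sumr; apply: ler_sum => k _.
rewrite cabsM cabsX -mulrA -exprD expr_div_n mulrA ler_pdivlMr ?exprn_gt0//.
rewrite mulrAC; apply: ler_pM; rewrite ?mulr_ge0 ?exprn_ge0 ?cabs_ge0 ?(ltW r0)//.
by rewrite lerXn2r// nnegrE ?cabs_ge0.
Qed.

Lemma expr_small (q : R) : 0 <= q -> q < 1 -> forall e, 0 < e ->
  exists N, forall n, (N <= n)%N -> q ^+ n <= e.
Proof.
move=> q0 q1 e e0; have /cvgrPdist_le : (fun n => q ^+ n) @ \oo --> (0 : R).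
  by apply: cvg_expr; rewrite ger0_norm.
move=> /(_ _ e0)[N _ hN]; exists N => n /hN /=.
by rewrite sub0r normrN ger0_norm// exprn_ge0.
Qed.

Lemma series_unif a r t M : 0 < r -> 0 <= t -> t < r ->
  (forall k, cabs (a k) * r ^+ k <= M) ->
  forall e, 0 < e -> exists N, forall n, (N <= n)%N -> forall z, cabs z <= t ->
  cabs (series_sum a z - (psum a n).[z]) <= e.
Proof.
move=> r0 t0 tr aM.
have q0 : 0 <= t / r by rewrite divr_ge0// ltW.
have q1 : t / r < 1 by rewrite ltr_pdivrMr// mul1r.
have M0 : 0 <= M by apply: le_trans (aM 0%N); rewrite expr0 mulr1 cabs_ge0.
have K0 : 0 < (M + 1) * (1 - t / r)^-1 by rewrite mulr_gt0// ?invr_gt0; lra.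
have cau e : 0 < e -> exists N, forall n m, (N <= n)%N -> (n <= m)%N ->
    forall z, cabs z <= t -> cabs ((psum a m).[z] - (psum a n).[z]) <= e.
  move=> e0; have [N hN] := expr_small q0 q1 (divr_gt0 e0 K0).
  exists N => n m Nn nm z zt; apply: le_trans (psum_tail r0 t0 tr aM nm zt) _.
  have := hN n Nn; rewrite ler_pdivlMr//; apply: le_trans.
  rewrite mulrA (mulrC M); apply: ler_wpM2r; first by rewrite invr_ge0; lra.
  by rewrite ler_wpM2l ?exprn_ge0//; lra.
have cvg z : cabs z <= t -> ccvg (fun n => (psum a n).[z]) (series_sum a z).
  move=> zt; rewrite /series_sum; case: xgetP => [_ -> //|] none.
  have [e e0|l hl] := @ccauchy_cvg R (fun n => (psum a n).[z]); last by case: (none l).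
  have [N hN] := cau e e0; exists N => n m Nn Nm.
  by have [nm|/ltnW nm] := leqP n m; [rewrite cabsC|]; exact: hN.
move=> e e0; have [N hN] := cau e e0; exists N => n Nn z zt.
apply: (@cabs_limit_le _ (fun m => (psum a m).[z] - (psum a n).[z]) _ _ n).
  move=> d /(cvg z zt)[N' hN']; exists N' => m /hN'.
  by congr (cabs _ < _); ring.
by move=> m nm; exact: hN.
Qed.

Lemma series_papprox a r t M : 0 < r -> 0 <= t -> t < r ->
  (forall k, cabs (a k) * r ^+ k <= M) -> papprox (series_sum a) 0 t.
Proof.
move=> r0 t0 tr aM e e0; have [N hN] := series_unif r0 t0 tr aM e0.
by exists (psum a N) => z; rewrite subr0 => /ltW; exact: hN.
Qed.

Lemma series_sum_eq a z l : ccvg (fun n => (psum a n).[z]) l -> series_sum a z = l.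
Proof.
by move=> h; rewrite /series_sum; case: xgetP => [x _ hx|/(_ l)//]; exact: ccvg_unique hx h.
Qed.

Lemma ccvg_bounded (u : nat -> C) l : ccvg u l -> exists M, forall n, cabs (u n) <= M.
Proof.
move=> /(_ 1 ltr01)[N hN].
exists (cabs l + 1 + \sum_(i < N) cabs (u i)) => n.
have [Nn|nN] := leqP N n.
  have := hN n Nn; have := cabsD l (u n - l); rewrite (cabsC (u n) l) addrC subrK.
  have : 0 <= \sum_(i < N) cabs (u i) by apply: sumr_ge0 => i _; exact: cabs_ge0.
  lra.
rewrite (bigD1 (Ordinal nN))//=.
have : 0 <= \sum_(i < N | i != Ordinal nN) cabs (u i).
  by apply: sumr_ge0 => i _; exact: cabs_ge0.
by have := cabs_ge0 l; lra.
Qed.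

(** The radius shrinks twice. Convergence at a point of distance r/2 bounds the terms there, and
    bounded terms at r/2 give uniform convergence at r/4. *)
Lemma analytic_papprox (U : set C) f z0 : analytic_on U f -> U z0 ->
  exists2 s, 0 < s & papprox f z0 s.
Proof.
move=> fa /fa [r [r0 [a ha]]]; exists (r / 4); first lra.
have ca z : cabs (z - z0) < r -> ccvg (fun n => (psum a n).[z - z0]) (f z).
  move=> zr; have := ha z; rewrite normE ltcR => /(_ zr)/ccvgP.
  by congr (ccvg _ _); apply/funext => n; rewrite psumE big_mkord.
have r2 : 0 < r / 2 by lra.
have [M aM] : exists M, forall k, cabs (a k) * (r / 2) ^+ k <= M.
  have /ccvg_bounded[M hM] := ca (z0 + (r / 2)%:C%C) ltac:(rewrite (addrC z0) addrK cabsR ger0_norm; lra).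
  (* A term is the difference of two consecutive partial sums, each bounded by [M]. *)
  exists (M + M) => k; have := hM k.+1; have := hM k.
  rewrite (addrC z0) addrK !psumE big_ord_recr/=; set S := \sum_(_ < _) _ => h1 h2.
  have := cabsB (S + a k * (r / 2)%:C%C ^+ k) S.
  rewrite addrAC subrr add0r cabsM cabsX cabsR ger0_norm; last lra.
  lra.
have := @series_papprox a (r / 2) (r / 4) M r2 ltac:(lra) ltac:(lra) aM.
move=> h; have : papprox (fun z => series_sum a (1 * z + (- z0))) z0 (r / 4).
  by apply: papprox_affine h => z; rewrite mul1r.
apply: papprox_ext => z zr; rewrite mul1r; apply: series_sum_eq; apply: ca; lra.
Qed.

Lemma papprox_expansion f z0 s : 0 < s -> papprox f z0 s ->
  exists a, forall z, cabs (z - z0) < s -> ccvg (fun n => (psum a n).[z - z0]) (f z).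
Proof.
move=> s0 /papprox_shift fa; have [a ta] := taylor_exists s0 fa.
exists a => z zs e e0.
have [|N hN] := taylor_cvg s0 (cabs_ge0 _) zs fa ta (e := e / 2); first lra.
exists N => n /hN /(_ (z - z0) (lexx _)) /=; rewrite subrKC.
by move=> /le_lt_trans; apply; lra.
Qed.

Lemma papprox_analytic (U : set C) f :
  (forall z0, U z0 -> exists2 s, 0 < s & papprox f z0 s) -> analytic_on U f.
Proof.
move=> h z0 /h[s s0 fa]; exists s; split=> //.
have [a ha] := papprox_expansion s0 fa; exists a => z; rewrite normE ltcR => zs.
apply/ccvgP; have := ha z zs; congr (ccvg _ _).
by apply/funext => n; rewrite psumE big_mkord.
Qed.

(** The Taylor coefficients valid on the large disk are also valid on the small one, where Cauchy's
    estimate with bound 0 kills them. *)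
Lemma papprox_identity f s d : 0 < d -> papprox f 0 s ->
  (forall z, cabs z < d -> f z = 0) -> forall z, cabs z < s -> f z = 0.
Proof.
move=> d0 fa f0 z zs; have s0 : 0 < s by apply: le_lt_trans zs; exact: cabs_ge0.
have [a ta] := taylor_exists s0 fa.
have m0 : 0 < Num.min d s by rewrite lt_min d0.
have ms : Num.min d s <= s by rewrite ge_min lexx orbT.
have ta' := taylor_sub m0 ms fa ta.
have a0 n : a n = 0.
  apply/cabs0_eq0/eqP; rewrite eq_le cabs_ge0 andbT.
  rewrite -(ler_pM2r (exprn_gt0 n m0)) mul0r.
  apply: taylor_bound ta' _ n => // w; rewrite lt_min => /andP[wd _].
  by rewrite f0// cabs0.
apply/cabs0_eq0/eqP; rewrite eq_le cabs_ge0 andbT; apply/ler_addgt0Pl => e e0.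
have [N hN] := taylor_cvg s0 (cabs_ge0 _) zs fa ta e0.
have := hN N (leqnn _) z (lexx _); rewrite horner_poly big1 ?subr0 ?addr0//.
by move=> i _; rewrite a0 mul0r.
Qed.

End analytic_continuation.

(** * One step of analytic continuation beyond a disk centred at 0 *)

Section global_expansion.
Variable R : realType.
Local Notation C := R[i].
Implicit Types (f g : C -> C) (z w : C) (r s t e M d : R) (p q : {poly C})
  (a : nat -> C).

Lemma nderivn_bound f z d M p h e : 0 < d -> 0 <= M -> 0 < h -> h <= d -> 0 <= e ->
  papprox f z d -> (forall w, cabs (w - z) < d -> cabs (f w) <= M) ->
  (forall w, cabs (w - z) < h -> cabs (f w - p.[w]) <= e) ->
  forall n, cabs (p^`N(n)).[z] <= M / d ^+ n + e / h ^+ n.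
Proof.
move=> d0 M0 h0 hd e0 /papprox_shift fa fM fp n.
have dn : 0 < d ^+ n by rewrite exprn_gt0.
have hn : 0 < h ^+ n by rewrite exprn_gt0.
have [c tc] := taylor_exists d0 fa.
have c1 : cabs (c n) <= M / d ^+ n.
  rewrite ler_pdivlMr//; apply: (taylor_bound M0 tc) => w wd.
  by apply: fM; rewrite (addrC z) addrK.
have c2 : cabs (c n - p^`N(n).[z]) <= e / h ^+ n.
  rewrite ler_pdivlMr//.
  have := taylor_sub h0 hd fa tc (p := \poly_(i < size p) p^`N(i).[z]) e0 _ n.
  rewrite coef_poly; case: ltnP => [_|pn]; last first.
    have -> : p^`N(n) = 0.
      apply/polyP => i; rewrite coef_nderivn coef0 nth_default ?mul0rn//.
      exact: leq_trans pn (leq_addr _ _).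
    rewrite horner0; apply=> w wh; rewrite horner_poly -nderiv_taylor; last exact: mulrC.
    by apply: fp; rewrite (addrC z) addrK.
  apply=> w wh; rewrite horner_poly -nderiv_taylor; last exact: mulrC.
  by apply: fp; rewrite (addrC z) addrK.
have := cabsB (c n) (c n - p^`N(n).[z]); rewrite opprB addrC subrK; lra.
Qed.

(* The coefficient of [w^n] at [z] is itself analytic in [z] with coefficients
   ['C(n + j, n) a_(n + j)] at 0: two Cauchy estimates combine. *)
Lemma double_cauchy f t d M a : 0 < t -> 0 < d -> 0 <= M ->
  papprox f 0 t -> taylor f t a ->
  (forall z, cabs z < t -> papprox f z d /\
     forall w, cabs (w - z) < d -> cabs (f w) <= M) ->
  forall n j, cabs (a (n + j)%N) * 'C(n + j, n)%:R * d ^+ n * t ^+ j <= M.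
Proof.
move=> t0 d0 M0 fa ta loc n j.
apply: (@continuous_le_left R (fun s =>
  cabs (a (n + j)%N) * 'C(n + j, n)%:R * d ^+ n * s ^+ j)) => //.
  apply: continuousM; first exact: cst_continuous.
  exact: exprn_continuous.
move=> s s0 st.
(* The intermediate radius leaves room t - t2 around each of its points for disks on which [p] is
   close to [f]. *)
have t20 : 0 < (s + t) / 2 by lra.
set t2 := (s + t) / 2 in t20.
have h0 : 0 < Num.min d (t - t2) by rewrite lt_min d0/= /t2; lra.
set h := Num.min _ _ in h0.
have dn : 0 < d ^+ n by rewrite exprn_gt0.
have hn : 0 < h ^+ n by rewrite exprn_gt0.
have tnj : 0 < t ^+ (n + j) by rewrite exprn_gt0.
have t2j : 0 < t2 ^+ j by rewrite exprn_gt0.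
(* The total amplification of the approximation error: the first term comes from the derivative
   estimate at radius [h], the second from passing from the coefficients of [p] to [a]. *)
pose K := d ^+ n / h ^+ n + 'C(n + j, n)%:R * d ^+ n * t2 ^+ j / t ^+ (n + j).
have K0 : 0 < K.
  rewrite /K ltr_pwDl ?divr_gt0//.
  by rewrite divr_ge0 ?(ltW tnj)// !mulr_ge0// ?ltW.
apply/ler_addgt0Pl => e e0.
have eK : 0 < e / K by rewrite divr_gt0.
have [p hp] := fa _ eK.
have hp' z : cabs z < t -> cabs (f z - p.[z]) <= e / K.
  by move=> zs; apply: hp; rewrite subr0.
have bnd z : cabs z < t2 -> cabs (p^`N(n)).[z] <= M / d ^+ n + e / K / h ^+ n.
  move=> zt2; have zt : cabs z < t by move: zt2; rewrite /t2; lra.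
  have [fz fM] := loc z zt.
  apply: (nderivn_bound d0 M0 h0 _ (ltW eK) fz fM) => [|w].
    by rewrite /h ge_min lexx.
  rewrite /h lt_min => /andP[_ wz]; apply: hp'.
  by have := cabsD (w - z) z; rewrite subrK; lra.
have := cauchy_bound t20 bnd j; rewrite coef_nderivn.
rewrite -[p`_(n + j) *+ _]mulr_natl cabsM cabs_nat => c1.
have := ta p _ (ltW eK) hp' (n + j)%N; rewrite -ler_pdivlMr// => c2.
have Ap : cabs (a (n + j)%N) <= cabs p`_(n + j) + e / K / t ^+ (n + j).
  by have := cabsD (a (n + j)%N - p`_(n + j)) p`_(n + j); rewrite subrK; lra.
have C0 : 0 <= 'C(n + j, n)%:R * d ^+ n * t2 ^+ j :> R.
  by rewrite !mulr_ge0// ltW.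
apply: (@le_trans _ _ (cabs (a (n + j)%N) * ('C(n + j, n)%:R * d ^+ n * t2 ^+ j))).
  rewrite !mulrA ler_wpM2l ?mulr_ge0 ?cabs_ge0 ?(ltW dn)//.
  by rewrite lerXn2r ?nnegrE ?(ltW t20)// /t2; lra.
apply: le_trans (ler_wpM2r C0 Ap) _.
have := ler_wpM2r (ltW dn) c1; rewrite mulrDl divfK ?gt_eqF//.
rewrite mulrDl.
have -> : e / K / t ^+ (n + j) * ('C(n + j, n)%:R * d ^+ n * t2 ^+ j) =
  e / K * (K - d ^+ n / h ^+ n) by rewrite /K; ring.
have -> : e / K * (K - d ^+ n / h ^+ n) = e - e / K / h ^+ n * d ^+ n.
  by field; rewrite !gt_eqF.
have -> : 'C(n + j, n)%:R * cabs p`_(n + j) * t2 ^+ j * d ^+ n =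
  cabs p`_(n + j) * ('C(n + j, n)%:R * d ^+ n * t2 ^+ j) by ring.
lra.
Qed.

(** Expanding (t + d/2)^k binomially, [double_cauchy] bounds the i-th term of |a_k| (t + d/2)^k by M
    / 2^i, so the Taylor series at 0 converges beyond [t]. Its sum agrees with [f] there by the
    identity theorem on disks centred inside the old one. *)
Lemma continuation_step f t d M : 0 < t -> 0 < d -> 0 <= M -> papprox f 0 t ->
  (forall z, cabs z < t -> papprox f z d /\
     forall w, cabs (w - z) < d -> cabs (f w) <= M) ->
  papprox f 0 (t + d / 4).
Proof.
move=> t0 d0 M0 fa loc; have [a ta] := taylor_exists t0 fa.
have aM k : cabs (a k) * (t + d / 2) ^+ k <= 2 * M.
  rewrite exprDn mulr_sumr.
  apply: (@le_trans _ _ (\sum_(i < k.+1) M * (1 / 2) ^+ i)).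
    apply: ler_sum => -[i /=]; rewrite ltnS => ik _.
    have := double_cauchy t0 d0 M0 fa ta loc i (k - i)%N; rewrite subnKC// => h.
    have i2 : 0 <= (1 / 2 : R) ^+ i by rewrite exprn_ge0; lra.
    apply: le_trans (ler_wpM2r i2 h).
    by rewrite -[_ *+ 'C(_, _)]mulr_natl !expr_div_n expr1n le_eqVlt; apply/orP; left; apply/eqP; ring.
  rewrite -mulr_sumr mulrC; apply: ler_wpM2r => //.
  rewrite [leRHS](_ : _ = (1 - 1 / 2)^-1); last by field.
  by apply: geom_sum_le; lra.
have r0 : 0 < t + d / 2 by lra.
have ga : papprox (series_sum a) 0 (t + d / 4).
  by apply: (series_papprox r0 _ _ aM); lra.
apply: (papprox_ext _ ga) => z; rewrite subr0 => zt.
have eqt w : cabs w < t -> series_sum a w = f w.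
  move=> wt; apply: series_sum_eq => e e0.
  have [|N hN] := taylor_cvg t0 (cabs_ge0 _) wt fa ta (e := e / 2); first lra.
  by exists N => n /hN /(_ w (lexx _)) /le_lt_trans; apply; lra.
have [/eqt//|tz] := ltP (cabs z) t.
(* The centre [c] lies on the ray to [z] at distance [u] from 0. As u < t, both functions agree on a
   disk about [c]; as u >= t - d/2, the disk of radius t + d/4 - u about [c], which contains [z],
   has radius at most d. *)
pose u := Num.max 0 (t - d / 2).
have u0 : 0 <= u by rewrite /u le_max lexx.
have ut : u < t by rewrite /u gt_max t0/=; lra.
have du : t - d / 2 <= u by rewrite /u le_max lexx orbT.
have z0 : 0 < cabs z by lra.
pose c : C := (u / cabs z)%:C%C * z.
have cu : cabs c = u by rewrite cabsM cabsR ger0_norm ?divr_ge0 ?(ltW z0)// divfK// gt_eqF.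
have zc : cabs (z - c) = cabs z - u.
  have -> : z - c = (1 - u / cabs z)%:C%C * z by rewrite /c rmorphB rmorph1; ring.
  rewrite cabsM cabsR ger0_norm; last by rewrite subr_ge0 ler_pdivrMr// mul1r; lra.
  by rewrite mulrBl mul1r divfK// gt_eqF.
have [fc _] := loc c ltac:(rewrite cu//).
have g' : papprox (fun w => series_sum a (c + w)) 0 (t + d / 4 - u).
  by apply/papprox_shift/(papprox_sub _ ga); rewrite subr0 cu; lra.
have f' : papprox (fun w => f (c + w)) 0 (t + d / 4 - u).
  by apply/papprox_shift/(papprox_sub _ fc); rewrite subrr cabs0; lra.
have tu : 0 < t - u by lra.
have := papprox_identity tu (papproxB g' f') _ (z := z - c).
rewrite zc subrKC => h; apply/eqP; rewrite -subr_eq0; apply/eqP/h; last lra.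
move=> w wt; rewrite eqt ?subrr//.
by have := cabsD c w; rewrite cu; lra.
Qed.

End global_expansion.

(** * Polynomial approximation of analytic functions on every smaller concentric disk *)

Section disk_expansion.
Variable R : realType.
Local Notation C := R[i].
Implicit Types (f g : C -> C) (z w : C) (r s t e M d : R) (p q : {poly C})
  (a : nat -> C).

Lemma cplx_dist (x y : R * R) (e : R) : `|x.1 - y.1| < e -> `|x.2 - y.2| < e ->
  cabs ((x.1 +i* x.2)%C - (y.1 +i* y.2)%C) < e + e.
Proof. by move=> h1 h2; apply: le_lt_trans (cabs_le_ReIm _) _ => /=; lra. Qed.

(** By compactness. A single index [n] encodes both the radius [v n], which decreases to 0, and the
    bound [n], so that local data at a point hold for all large [n] at once. *)
Lemma disk_uniform f s : s < 1 ->
  (forall z, disk z -> exists2 r, 0 < r & papprox f z r) ->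
  exists d M, [/\ 0 < d, 0 <= M & forall z, cabs z < s -> papprox f z d /\
    forall w, cabs (w - z) < d -> cabs (f w) <= M].
Proof.
move=> s1 loc; have [v v0 vs] := null_sequence R.
pose P (n : nat) (x : R * R) := cabs (x.1 +i* x.2)%C < s ->
  papprox f (x.1 +i* x.2)%C (v n) /\
  forall w, cabs (w - (x.1 +i* x.2)%C) < v n -> cabs (f w) <= n%:R.
have K : compact (`[(-1 : R), 1]%classic `*` `[(-1 : R), 1]%classic).
  by apply: compact_setX; exact: segment_compact.
have : forall x : R * R, (`[(-1 : R), 1]%classic `*` `[(-1 : R), 1]%classic) x ->
    \forall y \near x & n \near \oo, P n y.
  move=> x _; set z := (x.1 +i* x.2)%C.
  have near_x e : 0 < e -> \forall y \near x, cabs ((y.1 +i* y.2)%C - z) < e.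
    move=> e0; have e2 : 0 < e / 2 by lra.
    exists (ball x.1 (e / 2), ball x.2 (e / 2)).
      by split; exact: nbhsx_ballx.
    move=> y [/= y1 y2]; rewrite [e]splitr; apply: cplx_dist; rewrite distrC//.
  (* The compact set is a square. Near its points outside the open disk the moduli exceed [s], and
     [P] holds vacuously. *)
  have [z1|z1] := ltP (cabs z) 1; last first.
    have d0 : 0 < 1 - s by lra.
    exists ([set y | cabs ((y.1 +i* y.2)%C - z) < 1 - s], setT).
      by split => /=; [exact: near_x|exact: filterT].
    move=> [y n] [/= yz _] ys; exfalso.
    by have := cabsB (y.1 +i* y.2)%C ((y.1 +i* y.2)%C - z); rewrite subKr; lra.
  have [r r0 fr] := loc z (proj2 (diskE z) z1).
  have [M M0 fM] := papprox_bounded fr.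
  have r2 : 0 < r / 2 by lra.
  have [N hN] := vs _ r2.
  exists ([set y | cabs ((y.1 +i* y.2)%C - z) < r / 2], [set n | (N <= n)%N /\ M <= n%:R]).
    split => /=; first exact: near_x.
    near=> n; split; near: n; first exact: nbhs_infty_ge.
    exact: nbhs_infty_ger.
  move=> [y n] [/= yz [Nn Mn]] ys; have vn := hN n Nn.
  split=> [|w wy]; first by apply: (papprox_sub _ fr); lra.
  apply: le_trans Mn; apply: fM.
  have := cabsD (w - (y.1 +i* y.2)%C) ((y.1 +i* y.2)%C - z).
  by rewrite addrA subrK; lra.
move=> /(proj1 (compact_near_coveringP _) K nat \oo P _)[n _ hn].
exists (v n), n%:R; split => // z zs; have := hn n (leqnn n) (complex.Re z, complex.Im z).
case: z zs => x y /= zs; apply => //.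
have := normRe_le_cabs (x +i* y)%C; have := normIm_le_cabs (x +i* y)%C.
rewrite /= !ler_norml => /andP[y1 y2] /andP[x1 x2].
by split => /=; rewrite in_itv/=; lra.
Unshelve. all: by end_near. Qed.

(** The data [d] and [M] are uniform on the disk of radius [s], so every continuation step gains the
    same d/4 and finitely many steps reach [s]. *)
Theorem analytic_disk_papprox f s : analytic_on (@disk R) f -> s < 1 -> papprox f 0 s.
Proof.
move=> fa s1.
have [s0|s0] := leP s 0.
  move=> e e0; exists 0 => z; rewrite subr0 => zs.
  by have := cabs_ge0 z; lra.
have loc z : disk z -> exists2 r, 0 < r & papprox f z r.
  by move=> zd; exact: analytic_papprox fa zd.
have [d [M [d0 M0 h]]] := disk_uniform s1 loc.
have d4 : 0 < d / 4 by lra.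
have main m : papprox f 0 (Num.min (d + m%:R * (d / 4)) s).
  elim: m => [|m IHm].
    have [f0 _] := h 0 ltac:(rewrite cabs0//).
    by apply: (papprox_sub _ f0); rewrite subrr cabs0 add0r mul0r addr0 ge_min lexx.
  have md : 0 <= m%:R * (d / 4) by rewrite mulr_ge0 ?ler0n// ltW.
  have t0 : 0 < Num.min (d + m%:R * (d / 4)) s by rewrite lt_min s0 andbT; lra.
  have : papprox f 0 (Num.min (d + m%:R * (d / 4)) s + d / 4).
    apply: (continuation_step t0 d0 M0 IHm) => z.
    by rewrite lt_min => /andP[_ /h].
  set T := d + m%:R * (d / 4); apply: papprox_sub; rewrite subrr cabs0 add0r.
  have -> : d + m.+1%:R * (d / 4) = T + d / 4 by rewrite -natr1 /T; ring.
  by rewrite ge_min; case: (leP T s) => Ts; rewrite ?lexx//; apply/orP; right; lra.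
have [m hm] : exists m : nat, s <= d + m%:R * (d / 4).
  have := archi_boundP (ltW (divr_gt0 s0 d4)); set m := Num.bound _ => hm.
  by exists m; move: hm; rewrite ltr_pdivrMr//; lra.
by have := main m; rewrite min_r.
Qed.

Lemma analytic_diskP f : analytic_on (@disk R) f <-> forall s, s < 1 -> papprox f 0 s.
Proof.
split=> [fa s|fa]; first exact: analytic_disk_papprox.
apply: papprox_analytic => z /diskE z1; exists ((1 - cabs z) / 2); first lra.
have : (1 + cabs z) / 2 < 1 by lra.
by move=> /fa; apply: papprox_sub; rewrite subr0; lra.
Qed.

(** Coefficients computed at radius 1/2 serve at all radii: restricted to a common radius, two lists
    of coefficients are both close to those of one good polynomial, hence equal. *)
Lemma disk_taylor f : analytic_on (@disk R) f ->
  exists a, forall s, 0 < s -> s < 1 -> taylor f s a.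
Proof.
move=> fa; have h2 : (0 : R) < 2^-1 by rewrite invr_gt0.
have h1 : (2^-1 : R) < 1 by lra.
have [a ta] := taylor_exists h2 (analytic_disk_papprox fa h1).
exists a => s s0 s1; have fs := analytic_disk_papprox fa s1.
have [sh|/ltW sh] := leP s 2^-1; first exact: taylor_sub s0 sh (analytic_disk_papprox fa h1) ta.
have [c tc] := taylor_exists s0 fs.
suff -> : a = c by [].
have tc' := taylor_sub h2 sh fs tc.
apply/funext => n; apply/eqP; rewrite -subr_eq0; apply/eqP/cabs0_eq0/eqP.
rewrite eq_le cabs_ge0 andbT; apply/ler_addgt0Pl => e e0.
have hn : 0 < (2^-1 : R) ^+ n by rewrite exprn_gt0.
rewrite addr0 -(ler_pM2r hn).
have en : 0 < e * 2^-1 ^+ n / 2 by rewrite divr_gt0// mulr_gt0.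
have [p hp] := analytic_disk_papprox fa h1 en.
have hp' z : cabs z < 2^-1 -> cabs (f z - p.[z]) <= e * 2^-1 ^+ n / 2.
  by move=> zs; apply: hp; rewrite subr0.
have := ta p _ (ltW en) hp' n; have := tc' p _ (ltW en) hp' n.
have := ler_wpM2r (ltW hn) (cabsB (a n - p`_n) (c n - p`_n)); rewrite mulrDl.
have -> : a n - p`_n - (c n - p`_n) = a n - c n by ring.
set E := e * _; lra.
Qed.

End disk_expansion.

(** * Stokes' formula on disks, one real variable at a time *)

Section stokes.
Variable R : realType.
Local Notation C := R[i].
Local Notation mu := (@lebesgue_measure R).
Implicit Types (s : R).

Definition ball2 s : set (plane R) := [set p | cabs (cplx p) < s].

Lemma disk2E : @disk2 R = ball2 1.
Proof. by apply/seteqP; split=> p /diskE. Qed.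

Lemma cabs_lt (x y s : R) : 0 < s -> (cabs (x +i* y)%C < s) = (x ^+ 2 + y ^+ 2 < s ^+ 2).
Proof.
move=> s0; rewrite -(ltr_pXn2r (_ : 0 < 2)%N) ?nnegrE ?cabs_ge0 ?ltW//.
by rewrite sqr_cabs.
Qed.

Lemma measurable_cabs_cplx : measurable_fun setT (fun p : plane R => cabs (cplx p)).
Proof.
have -> : (fun p : plane R => cabs (cplx p)) =
    (fun p : plane R => Num.sqrt (p.1 ^+ 2 + p.2 ^+ 2)).
  by apply/funext => p; rewrite cabsE.
apply: (measurableT_comp (f := @Num.sqrt R)).
  by apply: continuous_measurable_fun; exact: sqrt_continuous.
by apply: measurable_funD; apply: measurable_funX; [exact: measurable_fst|exact: measurable_snd].
Qed.

Lemma measurable_ball2 s : measurable (ball2 s).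
Proof.
have := measurable_cabs_cplx measurableT (measurable_itv `]-oo, s[).
rewrite setTI; congr measurable; apply/seteqP; split=> p /=; by rewrite in_itv/=.
Qed.

Lemma ftc_chord (F G : R -> R) (a : R) : 0 < a ->
  (forall x : R, is_derive x 1 F (G x)) -> continuous G -> F a = 0 -> F (- a) = 0 ->
  (\int[mu]_(x in `](- a)%R, a[) (G x)%:E = 0)%E.
Proof.
move=> a0 dF cG Fa Fa'; have aa : - a < a by lra.
have cF : continuous F.
  by move=> x; apply/differentiable_continuous/derivable1_diffP; have [] := dF x.
rewrite -(@integral_itv_bndoo _ _ _ _ true false); last first.
  apply/measurable_EFinP.
  exact: measurable_funS measurableT (@subsetT _ _) (continuous_measurable_fun cG).
rewrite (@continuous_FTC2 _ G F)//.
- by rewrite Fa Fa' subee.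
- exact: continuous_subspaceT.
- split; first by move=> x _; have [] := dF x.
  + by apply: cvg_at_right_filter; exact: cF.
  + by apply: cvg_at_left_filter; exact: cF.
- by move=> x _; rewrite derive1E; have [_ ->] := dF x.
Qed.

Lemma section_disk s (y : R) : 0 < s ->
  [set x : R | x ^+ 2 + y ^+ 2 < s ^+ 2] = set0 \/
  exists a, [/\ 0 < a, a ^+ 2 + y ^+ 2 = s ^+ 2 &
    [set x : R | x ^+ 2 + y ^+ 2 < s ^+ 2] = `]- a, a[%classic].
Proof.
move=> s0; have [ys|sy] := ltP (y ^+ 2) (s ^+ 2); [right|left]; last first.
  by apply/seteqP; split=> x //=; have := sqr_ge0 x; lra.
have d0 : 0 < s ^+ 2 - y ^+ 2 by lra.
exists (Num.sqrt (s ^+ 2 - y ^+ 2)); rewrite sqrtr_gt0 d0 sqr_sqrtr ?subrK; last exact: ltW.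
split=> //; apply/seteqP; split=> x /=; rewrite in_itv/= -ltr_norml -sqrtr_sqr ltr_sqrt//; lra.
Qed.

Lemma integral_section (F G : R -> R) s (y : R) : 0 < s ->
  (forall x : R, is_derive x 1 F (G x)) -> continuous G ->
  (forall x, x ^+ 2 + y ^+ 2 = s ^+ 2 -> F x = 0) ->
  (\int[mu]_(x in [set x : R | (x ^+ 2 + y ^+ 2 < s ^+ 2)%R]) (G x)%:E = 0)%E.
Proof.
move=> s0 dF cG F0; have [->|[a [a0 ea ->]]] := section_disk y s0.
  exact: integral_set0.
by apply: (ftc_chord a0 dF cG); apply: F0; rewrite ?sqrrN.
Qed.

(** Fubini slices the disk into horizontal chords, and on each chord the integral is a difference of
    values of [F] at endpoints on the circle. *)
Lemma stokes_x (F G : R -> R -> R) s : 0 < s ->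
  (forall x y : R, is_derive x 1 (F ^~ y) (G x y)) ->
  (forall y, continuous (G ^~ y)) ->
  (forall x y, x ^+ 2 + y ^+ 2 = s ^+ 2 -> F x y = 0) ->
  (mu \x mu)%E.-integrable (ball2 s) (fun p => (G p.1 p.2)%:E) ->
  (\int[(mu \x mu)%E]_(p in ball2 s) (G p.1 p.2)%:E = 0)%E.
Proof.
move=> s0 dF cG F0 iG.
rewrite integral_mkcond -integral21_prod_meas1; last first.
  by apply/integrable_restrict => //; [exact: measurable_ball2|rewrite setTI].
rewrite -[RHS](integral0 mu setT); apply: eq_integral => y _.
rewrite /fubini_G -[RHS](@integral_section (F ^~ y) (G ^~ y) s y)//; last first.
  by move=> x; exact: F0.
rewrite [RHS]integral_mkcond; apply: eq_integral => x _ /=.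
rewrite !patchE; congr (if _ then _ else _).
by apply/idP/idP; rewrite !inE /ball2 /cplx/= cabs_lt.
Qed.

Lemma stokes_y (F G : R -> R -> R) s : 0 < s ->
  (forall x y : R, is_derive y 1 (F x) (G x y)) ->
  (forall x, continuous (G x)) ->
  (forall x y, x ^+ 2 + y ^+ 2 = s ^+ 2 -> F x y = 0) ->
  (mu \x mu)%E.-integrable (ball2 s) (fun p => (G p.1 p.2)%:E) ->
  (\int[(mu \x mu)%E]_(p in ball2 s) (G p.1 p.2)%:E = 0)%E.
Proof.
move=> s0 dF cG F0 iG.
rewrite integral_mkcond -integral12_prod_meas1; last first.
  by apply/integrable_restrict => //; [exact: measurable_ball2|rewrite setTI].
rewrite -[RHS](integral0 mu setT); apply: eq_integral => x _.
rewrite /fubini_F -[RHS](@integral_section (F x) (G x) s x)//; last first.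
  by move=> y; rewrite addrC; exact: F0.
rewrite [RHS]integral_mkcond; apply: eq_integral => y _ /=.
rewrite !patchE; congr (if _ then _ else _).
by apply/idP/idP; rewrite !inE /ball2 /cplx/= cabs_lt// addrC.
Qed.

End stokes.

(** * Complex-valued integrals over disks *)

Section disk_integral.
Variable R : realType.
Local Notation C := R[i].
Local Notation mu := (@lebesgue_measure R).
Implicit Types (s t : R) (f g : C -> C) (c : C).

Lemma dAE (A : set (plane R)) : dA R A = ((pi^-1)%:E * (mu \x mu)%E A)%E.
Proof. by []. Qed.

Lemma dA_ball2_fin s : (dA R (ball2 s) < +oo)%E.
Proof.
rewrite dAE; set Q : set (plane R) := `[(- s)%R, s]%classic `*` `[(- s)%R, s]%classic.
apply: (@le_lt_trans _ _ ((pi^-1)%:E * (mu \x mu)%E Q)%E).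
  apply: lee_wpmul2l; first by rewrite lee_fin invr_ge0 pi_ge0.
  apply: le_measure; rewrite ?inE; first exact: measurable_ball2.
    by apply: measurableX; exact: measurable_itv.
  move=> [x y] /= h; have := normRe_le_cabs (x +i* y)%C.
  have := normIm_le_cabs (x +i* y)%C; rewrite /ball2/= /cplx/= in h.
  rewrite /= !ler_norml => /andP[? ?] /andP[? ?].
  by split; rewrite /= in_itv/=; lra.
rewrite product_measure1E//=.
have -> : mu `[(- s)%R, s]%classic = (Num.max 0 (s + s))%:E.
  rewrite lebesgue_measure_itv/= lte_fin; case: ltP => ss.
    by rewrite -EFinB opprK max_r//; lra.
  by rewrite max_l//; lra.
by rewrite -!EFinM ltry.
Qed.

Definition cmeasurable s f :=
  measurable_fun (ball2 s) (fun p => complex.Re (f (cplx p))) /\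
  measurable_fun (ball2 s) (fun p => complex.Im (f (cplx p))).

Definition cintegrable s f :=
  (dA R).-integrable (ball2 s) (EFin \o (fun p => complex.Re (f (cplx p)))) /\
  (dA R).-integrable (ball2 s) (EFin \o (fun p => complex.Im (f (cplx p)))).

Definition cint s f : C :=
  ((\int[dA R]_(p in ball2 s) complex.Re (f (cplx p)))%R +i*
   (\int[dA R]_(p in ball2 s) complex.Im (f (cplx p)))%R)%C.

Lemma cintegralE f : cintegral f = cint 1 f.
Proof. by rewrite /cintegral disk2E. Qed.

Lemma cReD (z w : C) : complex.Re (z + w) = complex.Re z + complex.Re w.
Proof. by case: z; case: w. Qed.

Lemma cImD (z w : C) : complex.Im (z + w) = complex.Im z + complex.Im w.
Proof. by case: z; case: w. Qed.

Lemma cReM (z w : C) : complex.Re (z * w) =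
  complex.Re z * complex.Re w - complex.Im z * complex.Im w.
Proof. by case: z; case: w. Qed.

Lemma cImM (z w : C) : complex.Im (z * w) =
  complex.Re z * complex.Im w + complex.Im z * complex.Re w.
Proof. by case: z; case: w. Qed.

Lemma cReC (z : C) : complex.Re z^*%C = complex.Re z.
Proof. by case: z. Qed.

Lemma cImC (z : C) : complex.Im z^*%C = - complex.Im z.
Proof. by case: z. Qed.

Lemma complex_ext (z w : C) : complex.Re z = complex.Re w ->
  complex.Im z = complex.Im w -> z = w.
Proof. by case: z w => a b [c d] /= -> ->. Qed.

Lemma cmeasurableD s f g : cmeasurable s f -> cmeasurable s g ->
  cmeasurable s (fun z => f z + g z).
Proof.
move=> [f1 f2] [g1 g2]; split.
- by under eq_fun do rewrite cReD; exact: measurable_funD.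
- by under eq_fun do rewrite cImD; exact: measurable_funD.
Qed.

Lemma cmeasurableM s f g : cmeasurable s f -> cmeasurable s g ->
  cmeasurable s (fun z => f z * g z).
Proof.
move=> [f1 f2] [g1 g2]; split.
- by under eq_fun do rewrite cReM; apply: measurable_funB; apply: measurable_funM.
- by under eq_fun do rewrite cImM; apply: measurable_funD; apply: measurable_funM.
Qed.

Lemma cmeasurable_conj s f : cmeasurable s f -> cmeasurable s (fun z => (f z)^*%C).
Proof.
move=> [f1 f2]; split; first by under eq_fun do rewrite cReC.
under eq_fun do rewrite cImC.
by apply: measurableT_comp => //; exact: oppr_measurable.
Qed.

Lemma cmeasurable_cst s c : cmeasurable s (fun=> c).
Proof. by split; exact: measurable_cst. Qed.

Lemma cmeasurable_id s : cmeasurable s id.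
Proof.
by split => /=; apply: measurable_funTS; [exact: measurable_fst|exact: measurable_snd].
Qed.

Lemma cmeasurable_horner s (p : {poly C}) : cmeasurable s (horner p).
Proof.
elim/poly_ind: p => [|p c IHp].
  have -> : horner 0 = (fun=> 0 : C) by apply/funext => z; rewrite horner0.
  exact: cmeasurable_cst.
have -> : horner (p * 'X + c%:P) = (fun z => p.[z] * z + c).
  by apply/funext => z; rewrite !hornerE.
apply: cmeasurableD (cmeasurable_cst _ _).
by apply: cmeasurableM => //; exact: cmeasurable_id.
Qed.

Lemma cmeasurable_lim s (u : nat -> C -> C) f : (forall n, cmeasurable s (u n)) ->
  (forall z, cabs z < s -> ccvg (u ^~ z) (f z)) -> cmeasurable s f.
Proof.
move=> mu_ cv; split.
- apply: (@measurable_fun_cvg _ _ _ _ (fun n p => complex.Re (u n (cplx p)))).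
    by move=> n; have [] := mu_ n.
  move=> p /cv h; apply/cvgrPdist_lt => e /h[N hN]; exists N => // n /= /hN.
  by apply: le_lt_trans; have := normRe_le_cabs (f (cplx p) - u n (cplx p));
    case: (f _) (u _ _) => a b [].
- apply: (@measurable_fun_cvg _ _ _ _ (fun n p => complex.Im (u n (cplx p)))).
    by move=> n; have [] := mu_ n.
  move=> p /cv h; apply/cvgrPdist_lt => e /h[N hN]; exists N => // n /= /hN.
  by apply: le_lt_trans; have := normIm_le_cabs (f (cplx p) - u n (cplx p));
    case: (f _) (u _ _) => a b [].
Qed.

Lemma measurable_cabs s f : cmeasurable s f ->
  measurable_fun (ball2 s) (fun p => cabs (f (cplx p))).
Proof.
move=> [f1 f2]; under eq_fun do rewrite cabsE.
apply: (measurableT_comp (f := @Num.sqrt R)).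
  by apply: continuous_measurable_fun; exact: sqrt_continuous.
by apply: measurable_funD; apply: measurable_funX.
Qed.

Lemma bounded_integrable s (F : plane R -> R) (M : R) :
  measurable_fun (ball2 s) F -> (forall p, ball2 s p -> `|F p| <= M) ->
  (dA R).-integrable (ball2 s) (EFin \o F).
Proof.
move=> mF FM; apply: measurable_bounded_integrable => //.
- exact: measurable_ball2.
- exact: dA_ball2_fin.
- exists M; split; first exact: num_real.
  by move=> x Mx p /FM /le_trans; apply; exact: ltW.
Qed.

Lemma bounded_cintegrable s f (M : R) : cmeasurable s f ->
  (forall z, cabs z < s -> cabs (f z) <= M) -> cintegrable s f.
Proof.
move=> [f1 f2] fM; split; apply: (@bounded_integrable _ _ M) => // p ps.
- exact: le_trans (normRe_le_cabs _) (fM _ ps).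
- exact: le_trans (normIm_le_cabs _) (fM _ ps).
Qed.

Lemma cintegrableD s f g : cintegrable s f -> cintegrable s g ->
  cintegrable s (fun z => f z + g z).
Proof.
move=> [f1 f2] [g1 g2]; split.
- have := integrableD (measurable_ball2 s) f1 g1; apply: eq_integrable => //.
    exact: measurable_ball2.
  by move=> p _ /=; rewrite cReD EFinD.
- have := integrableD (measurable_ball2 s) f2 g2; apply: eq_integrable => //.
    exact: measurable_ball2.
  by move=> p _ /=; rewrite cImD EFinD.
Qed.

Lemma cintegrableZ s c f : cintegrable s f -> cintegrable s (fun z => c * f z).
Proof.
move=> [f1 f2]; have mb := measurable_ball2 s.
have h (a b : R) := integrableD mb (integrableZl mb a f1) (integrableZl mb b f2).
split.
- have := h (complex.Re c) (- complex.Im c); apply: eq_integrable => // p _ /=.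
  by rewrite cReM -!EFinM -EFinD mulNr.
- have := h (complex.Im c) (complex.Re c); apply: eq_integrable => // p _ /=.
  by rewrite cImM -!EFinM -EFinD addrC.
Qed.

Lemma cintD s f g : cintegrable s f -> cintegrable s g ->
  cint s (fun z => f z + g z) = cint s f + cint s g.
Proof.
move=> [f1 f2] [g1 g2]; have mb := measurable_ball2 s.
apply: complex_ext; rewrite ?cReD ?cImD /=.
- by under eq_Rintegral do rewrite cReD; rewrite RintegralD.
- by under eq_Rintegral do rewrite cImD; rewrite RintegralD.
Qed.

Lemma cintZ s c f : cintegrable s f -> cint s (fun z => c * f z) = c * cint s f.
Proof.
move=> [f1 f2]; have mb := measurable_ball2 s.
have i (a : R) (F : plane R -> R) : (dA R).-integrable (ball2 s) (EFin \o F) ->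
    (dA R).-integrable (ball2 s) (EFin \o (fun p => a * F p)).
  move=> iF; have := integrableZl mb a iF; exact: eq_integrable.
apply: complex_ext; rewrite ?cReM ?cImM /=.
- under eq_Rintegral do rewrite cReM.
  by rewrite RintegralB ?RintegralZl//; exact: i.
- under eq_Rintegral do rewrite cImM.
  by rewrite RintegralD ?RintegralZl//; exact: i.
Qed.

Lemma eq_cint s f g : (forall z, cabs z < s -> f z = g z) -> cint s f = cint s g.
Proof.
by move=> fg; apply: complex_ext => /=; apply: eq_Rintegral => p; rewrite inE => /fg ->.
Qed.

Lemma cint_conj s f : cintegrable s f -> cint s (fun z => (f z)^*%C) = (cint s f)^*%C.
Proof.
move=> [f1 f2]; have mb := measurable_ball2 s; apply: complex_ext => /=.
  by apply: eq_Rintegral => p _; rewrite cReC.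
under eq_Rintegral do rewrite cImC -mulN1r.
by rewrite RintegralZl// mulN1r.
Qed.

(** Moves from Lebesgue measure to its multiple [dA], scaling positive and negative parts
    separately. Integrability for Lebesgue measure is handed to the premise, where Fubini asks for
    it. *)
Lemma Rintegral_dA0 s (F : plane R -> R) :
  (dA R).-integrable (ball2 s) (EFin \o F) ->
  ((mu \x mu)%E.-integrable (ball2 s) (EFin \o F) ->
   (\int[(mu \x mu)%E]_(p in ball2 s) (F p)%:E = 0)%E) ->
  \int[dA R]_(p in ball2 s) F p = 0.
Proof.
move=> iF h; have mb := measurable_ball2 s.
have pi0 : (0 < pi^-1 :> R) by rewrite invr_gt0 pi_gt0.
have mF := measurable_int _ iF.
have scale (G : plane R -> \bar R) : measurable_fun (ball2 s) G ->
    (forall x, (0 <= G x)%E) ->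
    (\int[dA R]_(p in ball2 s) G p = (pi^-1)%:E * \int[(mu \x mu)%E]_(p in ball2 s) G p)%E.
  by move=> mG G0; rewrite /dA ge0_integral_mscale.
have iF' : (mu \x mu)%E.-integrable (ball2 s) (EFin \o F).
  apply/integrableP; split => //.
  move/integrableP : iF => [_]; rewrite scale//; last exact: measurableT_comp.
  case: (\int[_]_(_ in _) _)%E => [r _||]; rewrite ?ltry ?ltNyr//.
  by rewrite gt0_muley ?lte_fin.
have fin1 := integrable_pos_fin_num mb iF'.
have fin2 := integrable_neg_fin_num mb iF'.
have h0 := h iF'; rewrite integralE in h0.
rewrite /Rintegral integralE scale//; last exact: measurable_funepos.
rewrite scale//; last exact: measurable_funeneg.
rewrite -muleBr//; first by rewrite h0 mule0.
exact: fin_num_adde_defr.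
Qed.

End disk_integral.

(** * Symbolic Wirtinger calculus and its integration by parts *)

Section polynomial_calculus.
Variable R : realType.
Local Notation C := R[i].
Local Notation mu := (@lebesgue_measure R).
Implicit Types (s t : R) (f g : C -> C) (c z w : C) (p q : {poly C}).

(* Polynomials in z and its conjugate, with their Wirtinger derivatives. *)
Inductive dexpr :=
  | Dz | Dzb | Dc of C | Dadd of dexpr & dexpr | Dmul of dexpr & dexpr.

Fixpoint ev (e : dexpr) (z : C) : C := match e with
  | Dz => z | Dzb => z^*%C | Dc c => c
  | Dadd a b => ev a z + ev b z | Dmul a b => ev a z * ev b z end.

Fixpoint d1 (e : dexpr) : dexpr := match e with
  | Dz => Dc 1 | Dzb => Dc 0 | Dc _ => Dc 0
  | Dadd a b => Dadd (d1 a) (d1 b)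
  | Dmul a b => Dadd (Dmul (d1 a) b) (Dmul a (d1 b)) end.

Fixpoint d2 (e : dexpr) : dexpr := match e with
  | Dz => Dc 0 | Dzb => Dc 1 | Dc _ => Dc 0
  | Dadd a b => Dadd (d2 a) (d2 b)
  | Dmul a b => Dadd (Dmul (d2 a) b) (Dmul a (d2 b)) end.

Lemma conjcD z w : (z + w)^*%C = z^*%C + w^*%C.
Proof. exact: (rmorphD (@conjc R)). Qed.

Lemma conjcM z w : (z * w)^*%C = z^*%C * w^*%C.
Proof. exact: (rmorphM (@conjc R)). Qed.

Fixpoint cj (e : dexpr) : dexpr := match e with
  | Dz => Dzb | Dzb => Dz | Dc c => Dc c^*%C
  | Dadd a b => Dadd (cj a) (cj b) | Dmul a b => Dmul (cj a) (cj b) end.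

Lemma ev_z z : ev Dz z = z. Proof. by []. Qed.
Lemma ev_zb z : ev Dzb z = z^*%C. Proof. by []. Qed.
Lemma ev_c c z : ev (Dc c) z = c. Proof. by []. Qed.
Lemma ev_D a b z : ev (Dadd a b) z = ev a z + ev b z. Proof. by []. Qed.
Lemma ev_M a b z : ev (Dmul a b) z = ev a z * ev b z. Proof. by []. Qed.
Lemma d1_z : d1 Dz = Dc 1. Proof. by []. Qed.
Lemma d1_zb : d1 Dzb = Dc 0. Proof. by []. Qed.
Lemma d1_c c : d1 (Dc c) = Dc 0. Proof. by []. Qed.
Lemma d1_D a b : d1 (Dadd a b) = Dadd (d1 a) (d1 b). Proof. by []. Qed.
Lemma d1_M a b : d1 (Dmul a b) = Dadd (Dmul (d1 a) b) (Dmul a (d1 b)). Proof. by []. Qed.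
Lemma d2_z : d2 Dz = Dc 0. Proof. by []. Qed.
Lemma d2_zb : d2 Dzb = Dc 1. Proof. by []. Qed.
Lemma d2_c c : d2 (Dc c) = Dc 0. Proof. by []. Qed.
Lemma d2_D a b : d2 (Dadd a b) = Dadd (d2 a) (d2 b). Proof. by []. Qed.
Lemma d2_M a b : d2 (Dmul a b) = Dadd (Dmul (d2 a) b) (Dmul a (d2 b)). Proof. by []. Qed.
Lemma cj_z : cj Dz = Dzb. Proof. by []. Qed.
Lemma cj_zb : cj Dzb = Dz. Proof. by []. Qed.
Lemma cj_c c : cj (Dc c) = Dc c^*%C. Proof. by []. Qed.
Lemma cj_D a b : cj (Dadd a b) = Dadd (cj a) (cj b). Proof. by []. Qed.
Lemma cj_M a b : cj (Dmul a b) = Dmul (cj a) (cj b). Proof. by []. Qed.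
Definition evE := (ev_z, ev_zb, ev_c, ev_D, ev_M, d1_z, d1_zb, d1_c, d1_D, d1_M,
  d2_z, d2_zb, d2_c, d2_D, d2_M, cj_z, cj_zb, cj_c, cj_D, cj_M).

Lemma ev_cj e z : ev (cj e) z = (ev e z)^*%C.
Proof.
elim: e => [||c|a IHa b IHb|a IHa b IHb]; rewrite !evE ?conjcK//.
  by rewrite IHa IHb conjcD.
by rewrite IHa IHb conjcM.
Qed.

Lemma ev_d1_cj e z : ev (d1 (cj e)) z = (ev (d2 e) z)^*%C.
Proof.
elim: e => [||c|a IHa b IHb|a IHa b IHb]; rewrite !evE ?conjc0 ?conjc1//.
  by rewrite IHa IHb conjcD.
by rewrite IHa IHb !ev_cj conjcD !conjcM.
Qed.

Lemma ev_d2_cj e z : ev (d2 (cj e)) z = (ev (d1 e) z)^*%C.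
Proof.
elim: e => [||c|a IHa b IHb|a IHa b IHb]; rewrite !evE ?conjc0 ?conjc1//.
  by rewrite IHa IHb conjcD.
by rewrite IHa IHb !ev_cj conjcD !conjcM.
Qed.

Lemma ev_d1d2 e z : ev (d1 (d2 e)) z = ev (d2 (d1 e)) z.
Proof.
elim: e => [||c|a IHa b IHb|a IHa b IHb]; rewrite !evE//.
  by rewrite IHa IHb.
by rewrite IHa IHb; ring.
Qed.

(** Ties the symbolic derivatives to real calculus through d/dx = d + dbar; the companion identity
    is d/dy = i (d - dbar). *)
Lemma ev_derive_x e (x y : R) :
  is_derive x 1 (fun x : R => complex.Re (ev e (x +i* y)%C))
    (complex.Re (ev (d1 e) (x +i* y)%C + ev (d2 e) (x +i* y)%C)) /\
  is_derive x 1 (fun x : R => complex.Im (ev e (x +i* y)%C))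
    (complex.Im (ev (d1 e) (x +i* y)%C + ev (d2 e) (x +i* y)%C)).
Proof.
elim: e => [||c|a [a1 a2] b [b1 b2]|a [a1 a2] b [b1 b2]].
- by rewrite !evE addr0; split; [exact: is_derive_id|exact: is_derive_cst].
- rewrite !evE add0r; split; last exact: is_derive_cst.
  exact: is_derive_id.
- by rewrite !evE addr0; split; exact: is_derive_cst.
- split.
    under eq_fun do rewrite evE cReD.
    by apply: is_derive_eq (is_deriveD a1 b1) _; rewrite !evE !cReD; ring.
  under eq_fun do rewrite evE cImD.
  by apply: is_derive_eq (is_deriveD a2 b2) _; rewrite !evE !cImD; ring.
- split.
    under eq_fun do rewrite evE cReM.
    apply: is_derive_eq (is_deriveB (is_deriveM a1 b1) (is_deriveM a2 b2)) _.
    by rewrite !evE !(cReD, cImD, cReM, cImM) /GRing.scale/=; ring.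
  under eq_fun do rewrite evE cImM.
  apply: is_derive_eq (is_deriveD (is_deriveM a1 b2) (is_deriveM a2 b1)) _.
  by rewrite !evE !(cReD, cImD, cReM, cImM) /GRing.scale/=; ring.
Qed.

Lemma ev_derive_y e (x y : R) :
  is_derive y 1 (fun y : R => complex.Re (ev e (x +i* y)%C))
    (complex.Re ('i%C * (ev (d1 e) (x +i* y)%C - ev (d2 e) (x +i* y)%C))) /\
  is_derive y 1 (fun y : R => complex.Im (ev e (x +i* y)%C))
    (complex.Im ('i%C * (ev (d1 e) (x +i* y)%C - ev (d2 e) (x +i* y)%C))).
Proof.
elim: e => [||c|a [a1 a2] b [b1 b2]|a [a1 a2] b [b1 b2]].
- rewrite !evE subr0 mulr1; split => /=; [exact: is_derive_cst|exact: is_derive_id].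
- rewrite !evE sub0r mulrN1 /=; split; first by rewrite oppr0; exact: is_derive_cst.
  by apply: is_derive_eq (is_deriveN (is_derive_id _ _)) _.
- by rewrite !evE subr0 mulr0; split; exact: is_derive_cst.
- split.
    under eq_fun do rewrite evE cReD.
    apply: is_derive_eq (is_deriveD a1 b1) _.
    by rewrite !evE -cReD; congr complex.Re; ring.
  under eq_fun do rewrite evE cImD.
  apply: is_derive_eq (is_deriveD a2 b2) _.
  by rewrite !evE -cImD; congr complex.Im; ring.
- split.
    under eq_fun do rewrite evE cReM.
    apply: is_derive_eq (is_deriveB (is_deriveM a1 b1) (is_deriveM a2 b2)) _.
    rewrite !evE; set A1 := ev (d1 a) _; set A2 := ev (d2 a) _.
    set B1 := ev (d1 b) _; set B2 := ev (d2 b) _.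
    have -> : 'i%C * (A1 * ev b (x +i* y)%C + ev a (x +i* y)%C * B1 -
      (A2 * ev b (x +i* y)%C + ev a (x +i* y)%C * B2)) =
      'i%C * (A1 - A2) * ev b (x +i* y)%C + ev a (x +i* y)%C * ('i%C * (B1 - B2)) by ring.
    by move: ('i%C * _) ('i%C * _) => u v; rewrite !(cReD, cImD, cReM, cImM) /GRing.scale/=; ring.
  under eq_fun do rewrite evE cImM.
  apply: is_derive_eq (is_deriveD (is_deriveM a1 b2) (is_deriveM a2 b1)) _.
  rewrite !evE; set A1 := ev (d1 a) _; set A2 := ev (d2 a) _.
  set B1 := ev (d1 b) _; set B2 := ev (d2 b) _.
  have -> : 'i%C * (A1 * ev b (x +i* y)%C + ev a (x +i* y)%C * B1 -
    (A2 * ev b (x +i* y)%C + ev a (x +i* y)%C * B2)) =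
    'i%C * (A1 - A2) * ev b (x +i* y)%C + ev a (x +i* y)%C * ('i%C * (B1 - B2)) by ring.
  by move: ('i%C * _) ('i%C * _) => u v; rewrite !(cReD, cImD, cReM, cImM) /GRing.scale/=; ring.
Qed.

Lemma ev_measurable e s : cmeasurable s (ev e).
Proof.
elim: e => /= [||c|a IHa b IHb|a IHa b IHb].
- exact: cmeasurable_id.
- exact: (cmeasurable_conj (cmeasurable_id s)).
- exact: cmeasurable_cst.
- exact: cmeasurableD.
- exact: cmeasurableM.
Qed.

Lemma ev_bounded e s : exists M, forall z, cabs z < s -> cabs (ev e z) <= M.
Proof.
elim: e => /= [||c|a [M hM] b [N hN]|a [M hM] b [N hN]].
- by exists s => z /ltW.
- by exists s => z /ltW; rewrite cabs_conj.
- by exists (cabs c).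
- exists (M + N) => z zs; apply: le_trans (cabsD _ _) _.
  by have := hM z zs; have := hN z zs; lra.
- exists (M * N) => z zs; rewrite cabsM; apply: ler_pM; rewrite ?cabs_ge0 ?hM ?hN//.
Qed.

Lemma ev_integrable e s : cintegrable s (ev e).
Proof. by have [M hM] := ev_bounded e s; exact: bounded_cintegrable (ev_measurable e s) hM. Qed.

Definition Drho s := Dadd (Dc (s ^+ 2)%:C%C) (Dmul (Dc (-1)) (Dmul Dz Dzb)).

Lemma ev_rho s z : ev (Drho s) z = (s ^+ 2 - cabs z ^+ 2)%:C%C.
Proof. by rewrite /= mulN1r conjM_cabs rmorphB. Qed.

Lemma ev_rho_circle s (x y : R) : x ^+ 2 + y ^+ 2 = s ^+ 2 -> ev (Drho s) (x +i* y)%C = 0.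
Proof. by move=> h; rewrite ev_rho sqr_cabs/= h subrr. Qed.

Lemma Re_ev_continuous_x e y : continuous (fun x : R => complex.Re (ev e (x +i* y)%C)).
Proof.
move=> x; apply/differentiable_continuous/derivable1_diffP.
by have [[]] := ev_derive_x e x y.
Qed.

Lemma Im_ev_continuous_x e y : continuous (fun x : R => complex.Im (ev e (x +i* y)%C)).
Proof.
move=> x; apply/differentiable_continuous/derivable1_diffP.
by have [_ []] := ev_derive_x e x y.
Qed.

Lemma Re_ev_continuous_y e x : continuous (fun y : R => complex.Re (ev e (x +i* y)%C)).
Proof.
move=> y; apply/differentiable_continuous/derivable1_diffP.
by have [[]] := ev_derive_y e x y.
Qed.

Lemma Im_ev_continuous_y e x : continuous (fun y : R => complex.Im (ev e (x +i* y)%C)).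
Proof.
move=> y; apply/differentiable_continuous/derivable1_diffP.
by have [_ []] := ev_derive_y e x y.
Qed.

Lemma stokes_dx s e : 0 < s -> let V := Dmul (Drho s) e in
  cint s (ev (Dadd (d1 V) (d2 V))) = 0.
Proof.
move=> s0 V; set G := Dadd _ _; have [i1 i2] := ev_integrable G s.
apply: complex_ext; apply: Rintegral_dA0 => // iG.
- apply: (@stokes_x R (fun x y => complex.Re (ev V (x +i* y)%C))
    (fun x y => complex.Re (ev G (x +i* y)%C))) => //.
  + by move=> x y; have [] := ev_derive_x V x y.
  + by move=> y; exact: Re_ev_continuous_x.
  + by move=> x y /ev_rho_circle h; rewrite [ev V _]/= -[_ + _ * _]/(ev (Drho s) _) h mul0r.
- apply: (@stokes_x R (fun x y => complex.Im (ev V (x +i* y)%C))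
    (fun x y => complex.Im (ev G (x +i* y)%C))) => //.
  + by move=> x y; have [] := ev_derive_x V x y.
  + by move=> y; exact: Im_ev_continuous_x.
  + by move=> x y /ev_rho_circle h; rewrite [ev V _]/= -[_ + _ * _]/(ev (Drho s) _) h mul0r.
Qed.

Lemma stokes_dy s e : 0 < s -> let V := Dmul (Drho s) e in
  cint s (ev (Dmul (Dc 'i%C) (Dadd (d1 V) (Dmul (Dc (-1)) (d2 V))))) = 0.
Proof.
move=> s0 V; set G := Dmul _ _; have [i1 i2] := ev_integrable G s.
have GE z : ev G z = 'i%C * (ev (d1 V) z - ev (d2 V) z).
  by rewrite -[ev G z]/('i%C * (ev (d1 V) z + (-1) * ev (d2 V) z)) mulN1r.
apply: complex_ext; apply: Rintegral_dA0 => // iG.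
- apply: (@stokes_y R (fun x y => complex.Re (ev V (x +i* y)%C))
    (fun x y => complex.Re (ev G (x +i* y)%C))) => //.
  + by move=> x y; rewrite GE; have [] := ev_derive_y V x y.
  + by move=> y; exact: Re_ev_continuous_y.
  + by move=> x y /ev_rho_circle h; rewrite [ev V _]/= -[_ + _ * _]/(ev (Drho s) _) h mul0r.
- apply: (@stokes_y R (fun x y => complex.Im (ev V (x +i* y)%C))
    (fun x y => complex.Im (ev G (x +i* y)%C))) => //.
  + by move=> x y; rewrite GE; have [] := ev_derive_y V x y.
  + by move=> y; exact: Im_ev_continuous_y.
  + by move=> x y /ev_rho_circle h; rewrite [ev V _]/= -[_ + _ * _]/(ev (Drho s) _) h mul0r.
Qed.

(** The factor [Drho s] vanishes on the circle, so Stokes in x and in y annihilates the integrals of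
    d1 + d2 and of d1 - d2, hence each of the two. *)
Lemma cint_ev_d1 s e : 0 < s -> cint s (ev (d1 (Dmul (Drho s) e))) = 0.
Proof.
move=> s0; set V := Dmul _ _.
have h1 := stokes_dx e s0; have h2 := stokes_dy e s0; rewrite /= -/V in h1 h2.
have i1 := ev_integrable (d1 V) s; have i2 := ev_integrable (d2 V) s.
have j2 := cintegrableZ (-1) i2.
rewrite (cintD i1 i2) in h1.
rewrite (@cintZ _ s 'i%C (fun z => ev (d1 V) z + (-1) * ev (d2 V) z) (cintegrableD i1 j2)) in h2.
move/eqP: h2; rewrite mulf_eq0 (negPf (_ : 'i%C != 0)) /=; last first.
  by rewrite eq_complex/= oner_eq0 andbF.
rewrite (cintD i1 j2) (cintZ _ i2) mulN1r subr_eq0 => /eqP h2.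
move: h1; rewrite -h2 => /eqP; rewrite -mulr2n mulrn_eq0/= => /eqP //.
Qed.

Lemma cint_ev_d2 s e : 0 < s -> cint s (ev (d2 (Dmul (Drho s) e))) = 0.
Proof.
move=> s0; have h1 := stokes_dx e s0; have h2 := cint_ev_d1 e s0.
move: h1; set V := Dmul _ _ => h1; rewrite -/V in h2.
have i1 := ev_integrable (d1 V) s; have i2 := ev_integrable (d2 V) s.
by move: h1; rewrite /= (cintD i1 i2) h2 add0r.
Qed.

End polynomial_calculus.

(** * Moments of monomials and Parseval's formula on disks *)

Section moments.
Variable R : realType.
Local Notation C := R[i].
Local Notation mu := (@lebesgue_measure R).
Implicit Types (s t : R) (f g : C -> C) (c z w : C) (p q : {poly C}).

Fixpoint Dpow (e : dexpr R) n : dexpr R :=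
  if n is n'.+1 then Dmul e (Dpow e n') else Dc 1.

Lemma ev_pow e n z : ev (Dpow e n) z = ev e z ^+ n.
Proof. by elim: n => [//|n IH]; rewrite exprS -IH. Qed.

Lemma d1_pow n z : ev (d1 (Dpow (Dz R) n)) z = n%:R * z ^+ n.-1.
Proof.
elim: n => [|n IH]; first by rewrite mul0r.
rewrite [Dpow _ _]/= !evE IH ev_pow evE /= -natr1.
by case: n {IH} => [|n]; rewrite ?mul0r ?expr0 ?mulr0 ?addr0 ?add0r ?mul1r//= exprS; ring.
Qed.

Lemma d1_powb n z : ev (d1 (Dpow (Dzb R) n)) z = 0.
Proof.
by elim: n => [//|n IH]; rewrite [Dpow _ _]/= !evE IH mul0r mulr0 addr0.
Qed.

Definition mon a b := Dmul (Dpow (Dz R) a) (Dpow (Dzb R) b).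

Lemma ev_mon a b z : ev (mon a b) z = z ^+ a * z^*%C ^+ b.
Proof. by rewrite /mon !evE !ev_pow !evE. Qed.

Definition moment s a b := cint s (fun z => z ^+ a * z^*%C ^+ b).

Lemma mon_integrable s a b : cintegrable s (fun z => z ^+ a * z^*%C ^+ b).
Proof.
have -> : (fun z => z ^+ a * z^*%C ^+ b) = ev (mon a b).
  by apply/funext => z; rewrite ev_mon.
exact: ev_integrable.
Qed.

Lemma d1_rho_mon s a b z : ev (d1 (Dmul (Drho s) (mon a b))) z =
  (s ^+ 2)%:C%C * a%:R * (z ^+ a.-1 * z^*%C ^+ b) - a.+1%:R * (z ^+ a * z^*%C ^+ b.+1).
Proof.
rewrite /Drho !evE !ev_pow d1_pow d1_powb !evE -natr1 exprS.
case: a => [|a]; rewrite ?expr0 /= ?exprS; ring.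
Qed.

(** Stokes' formula for rho z^a zbar^b, in place of polar coordinates. For a = 0 the truncated
    [a.-1] is harmless, being multiplied by 0. *)
Lemma moment_rec s a b : 0 < s ->
  a.+1%:R * moment s a b.+1 = (s ^+ 2)%:C%C * a%:R * moment s a.-1 b.
Proof.
move=> s0; have := cint_ev_d1 (mon a b) s0.
rewrite (@eq_cint _ s _ (fun z => (s ^+ 2)%:C%C * a%:R * (z ^+ a.-1 * z^*%C ^+ b) +
   (- a.+1%:R) * (z ^+ a * z^*%C ^+ b.+1))); last first.
  by move=> z _; rewrite d1_rho_mon mulNr.
have i := mon_integrable s.
rewrite cintD; [|exact/cintegrableZ/i|exact/cintegrableZ/i].
rewrite !cintZ; [|exact: i|exact: i] => /eqP.
by rewrite mulNr subr_eq0 => /eqP <-.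
Qed.

Lemma moment_conj s a b : moment s b a = (moment s a b)^*%C.
Proof.
rewrite /moment -cint_conj; last exact: mon_integrable.
by apply: eq_cint => z _; rewrite conjcM !(rmorphXn (@conjc R)) /= conjcK mulrC.
Qed.

(** The recursion lowers both exponents together, so unequal exponents end in a moment with one
    exponent 0 and the other positive, which vanishes by the case a = 0 of the recursion and
    conjugation. *)
Lemma moment_eval s a b : 0 < s ->
  moment s a b = (a == b)%:R * (s ^+ a.*2)%:C%C / a.+1%:R * moment s 0 0.
Proof.
move=> s0; have nz n : (n.+1%:R : C) != 0 by rewrite pnatr_eq0.
elim: b a => [|b IHb] [|a].
- by rewrite eqxx double0 expr0 rmorph1 mulr1 divff ?mul1r// oner_eq0.
- rewrite mul0r !mul0r moment_conj; have := moment_rec 0 a s0.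
  by rewrite mulr0 mul0r mul1r => ->; rewrite conjc0.
- by rewrite !mul0r; have := moment_rec 0 b s0; rewrite mulr0 mul0r mul1r.
- apply: (mulfI (nz a.+1)); rewrite (moment_rec _ _ s0) /= IHb eqSS.
  case: eqP => [->|_]; last by rewrite !mul0r !mulr0.
  rewrite doubleS !exprS !rmorphM; set S := (s ^+ _)%:C%C.
  by field; rewrite -(natrD _ 2 b) -(natrD _ 1 b) !pnatr_eq0.
Qed.

(** The normalized area of the disk, kept as a symbol; the estimates rest on its positivity and
    monotonicity. *)
Definition m0 s : R := \int[dA R]_(p in ball2 s) 1.

Lemma moment00 s : moment s 0 0 = (m0 s)%:C%C.
Proof.
rewrite /moment (@eq_cint _ s _ (fun=> 1)); last by move=> z _; rewrite !expr0 mulr1.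
by apply: complex_ext => //=; rewrite /Rintegral integral0.
Qed.

Lemma m0E s : (m0 s)%:E = dA R (ball2 s).
Proof.
rewrite /m0 Rintegral_cst ?mul1r; last exact: measurable_ball2.
by rewrite fineK// ge0_fin_numE//; exact: dA_ball2_fin.
Qed.

Lemma m0_le s t : s <= t -> m0 s <= m0 t.
Proof.
move=> st; rewrite -lee_fin !m0E; apply: le_measure; rewrite ?inE;
  [exact: measurable_ball2|exact: measurable_ball2|].
by move=> p /= /lt_le_trans; apply.
Qed.

Lemma m0_gt0 s : 0 < s -> 0 < m0 s.
Proof.
move=> s0; rewrite -lte_fin m0E dAE.
set Q : set (plane R) := `[0%R, (s / 4)%R]%classic `*` `[0%R, (s / 4)%R]%classic.
have mQ : measurable Q by apply: measurableX; exact: measurable_itv.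
apply: (@lt_le_trans _ _ ((pi^-1)%:E * (mu \x mu)%E Q)%E); last first.
  apply: lee_wpmul2l; first by rewrite lee_fin invr_ge0 pi_ge0.
  apply: le_measure; rewrite ?inE//; first exact: measurable_ball2.
  move=> [x y] /= []; rewrite /= !in_itv/= => /andP[x0 xs] /andP[y0 ys].
  apply: le_lt_trans (cabs_le_ReIm _) _ => /=.
  by rewrite !ger0_norm//; lra.
rewrite product_measure1E//=.
have -> : mu `[0%R, (s / 4)%R]%classic = (s / 4)%:E.
  by rewrite lebesgue_measure_itv/= lte_fin ifT ?oppr0 ?adde0// divr_gt0.
by rewrite -!EFinM lte_fin !mulr_gt0 ?invr_gt0 ?pi_gt0// divr_gt0.
Qed.

Lemma cint_sum s (I : Type) (l : seq I) (F : I -> C -> C) :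
  (forall i, cintegrable s (F i)) ->
  cintegrable s (fun z => \sum_(i <- l) F i z) /\
  cint s (fun z => \sum_(i <- l) F i z) = \sum_(i <- l) cint s (F i).
Proof.
move=> iF; elim: l => [|i l [IH1 IH2]].
  have e : (fun z => \sum_(i <- [::]) F i z) = ev (Dc (0 : C)).
    by apply/funext => z; rewrite big_nil.
  rewrite big_nil e; split; first exact: ev_integrable.
  have e0 : ev (Dc (0 : C)) = (fun z : C => 0 * ev (Dc (0 : C)) z).
    by apply/funext => z; rewrite mul0r.
  by rewrite e0 cintZ ?mul0r//; exact: ev_integrable.
have -> : (fun z => \sum_(j <- i :: l) F j z) = (fun z => F i z + \sum_(j <- l) F j z).
  by apply/funext => z; rewrite big_cons.
by rewrite big_cons; split; [exact: cintegrableD|rewrite cintD// IH2].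
Qed.

(** The squared norm of z^n over the disk of radius [s]. *)
Definition weight s n : R := s ^+ n.*2 * m0 s / n.+1%:R.

Lemma parseval_poly s p : 0 < s ->
  cint s (fun z => p.[z] * (p.[z])^*%C) =
  (\sum_(i < size p) cabs p`_i ^+ 2 * weight s i)%:C%C.
Proof.
move=> s0; pose I := index_enum 'I_(size p).
pose F (i : 'I_(size p)) z := \sum_(j <- I) p`_i * (p`_j)^*%C * (z ^+ i * z^*%C ^+ j).
have iT (i j : 'I_(size p)) : cintegrable s (fun z => p`_i * (p`_j)^*%C * (z ^+ i * z^*%C ^+ j)).
  exact/cintegrableZ/mon_integrable.
have FE i := cint_sum I (iT i).
rewrite (@eq_cint _ s _ (fun z => \sum_(i <- I) F i z)); last first.
  move=> z _; rewrite horner_coef [X in _ * X](rmorph_sum (@conjc R)) mulr_suml.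
  apply: eq_bigr => i _; rewrite mulr_sumr; apply: eq_bigr => j _.
  by rewrite rmorphM rmorphXn /=; ring.
have [_ ->] := cint_sum I (fun i => proj1 (FE i)).
rewrite rmorph_sum; apply: eq_bigr => i _.
rewrite (proj2 (FE i)) /I (bigD1 i)//= big1 ?addr0; last first.
  move=> j ji; rewrite cintZ; last exact: mon_integrable.
  by rewrite -/(moment s i j) moment_eval// eq_sym (_ : (j : nat) == i = false)
    ?mul0r ?mulr0//; exact: negbTE.
rewrite cintZ; last exact: mon_integrable.
rewrite -/(moment s i i) moment_eval// eqxx mul1r moment00 conjM_cabs /weight.
by rewrite !rmorphM fmorphV rmorph_nat; ring.
Qed.

End moments.

(** * Equality of the Wirtinger energies and Hardy's inequality *)

Section hankel_estimate.
Variable R : realType.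
Local Notation C := R[i].
Implicit Types (s t : R) (f g : C -> C) (c z w : C) (p q : {poly C}) (W V : dexpr R).

Lemma Re_cint_le s f g : cintegrable s f -> cintegrable s g ->
  (forall z, cabs z < s -> complex.Re (f z) <= complex.Re (g z)) ->
  complex.Re (cint s f) <= complex.Re (cint s g).
Proof.
move=> [f1 _] [g1 _] h /=; apply: le_Rintegral => //; first exact: measurable_ball2.
by move=> p /h.
Qed.

Definition nrm2 s f : R := complex.Re (cint s (fun z => f z * (f z)^*%C)).

Lemma conjcN1 : (-1 : C)^*%C = -1.
Proof. exact: (rmorphN1 (@conjc R)). Qed.

Lemma ev_sq_integrable W s : cintegrable s (fun z => ev W z * (ev W z)^*%C).
Proof.
have -> : (fun z => ev W z * (ev W z)^*%C) = ev (Dmul W (cj W)).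
  by apply/funext => z; rewrite evE ev_cj.
exact: ev_integrable.
Qed.

Lemma cabs_conjM z w : complex.Re (z * w^*%C) <= cabs z * cabs w.
Proof.
by rewrite -(cabs_conj w) -cabsM; apply: le_trans (ler_norm _) (normRe_le_cabs _).
Qed.

(* Both equal minus the integral of V times a mixed second derivative, as the
   boundary values of V vanish. *)
Lemma nrm2_d1_d2 W : let V := Dmul (Drho 1) W in
  nrm2 1 (ev (d1 V)) = nrm2 1 (ev (d2 V)).
Proof.
move=> V; have one0 : (0 : R) < 1 by [].
have hA := cint_ev_d1 (Dmul W (d2 (cj V))) one0.
have hB := cint_ev_d2 (Dmul W (d1 (cj V))) one0.
pose M := Dmul V (d1 (d2 (cj V))).
have iM := ev_integrable M 1.
have i1 := ev_sq_integrable (d1 V) 1; have i2 := ev_sq_integrable (d2 V) 1.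
have e1 : cint 1 (fun z => ev (d1 V) z * (ev (d1 V) z)^*%C) + cint 1 (ev M) = 0.
  rewrite -hA -cintD//; apply: eq_cint => z _.
  by rewrite -ev_d2_cj /M /V !evE; ring.
have e2 : cint 1 (fun z => ev (d2 V) z * (ev (d2 V) z)^*%C) + cint 1 (ev M) = 0.
  rewrite -hB -cintD//; apply: eq_cint => z _.
  have -> : ev M z = ev V z * ev (d2 (d1 (cj V))) z by rewrite /M ev_M ev_d1d2.
  by rewrite -ev_d1_cj /V !evE; ring.
by rewrite /nrm2; congr complex.Re; apply: (addIr (cint 1 (ev M))); rewrite e1 e2.
Qed.

(* Stokes' formula for [rho z |W|^2] and its conjugate gives
   |W|^2 = - Re <z dV + zbar dbar V, W> with [V = rho W]. *)
Lemma hardy W : nrm2 1 (ev W) <= 4 * nrm2 1 (ev (d1 (Dmul (Drho 1) W))).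
Proof.
set V := Dmul _ _; have one0 : (0 : R) < 1 by [].
have hA := cint_ev_d1 (Dmul (Dz R) (Dmul W (cj W))) one0.
have hB := cint_ev_d2 (Dmul (Dzb R) (Dmul W (cj W))) one0.
have iW := ev_sq_integrable W 1.
have i1 := ev_sq_integrable (d1 V) 1; have i2 := ev_sq_integrable (d2 V) 1.
pose A := Dmul (Dc (-1)) (Dmul (cj W) (Dadd (Dmul (Dz R) (d1 V)) (Dmul (Dzb R) (d2 V)))).
have iA := ev_integrable A 1; have iA' := ev_integrable (cj A) 1.
have i2W := cintegrableZ 2 iW.
have eA : cint 1 (fun z => 2 * (ev W z * (ev W z)^*%C)) =
    cint 1 (fun z => ev A z + ev (cj A) z).
  apply/eqP; rewrite -subr_eq0 -mulN1r -cintZ; last exact: cintegrableD.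
  rewrite -cintD//; last exact/cintegrableZ/cintegrableD.
  rewrite -(addr0 (0 : C)) -{1}hA -hB -cintD; [|exact: ev_integrable|exact: ev_integrable].
  apply/eqP/eq_cint => z _; rewrite ev_cj /A /V /Drho !evE !ev_cj !ev_d1_cj !ev_d2_cj.
  rewrite !(conjcM, conjcD, conjcK, conjc1, conjc0, conjc_real, conjcN1) expr1n rmorph1.
  ring.
(* With |z| < 1, each of the two products in [A] is at most |e|^2 + |W|^2 / 4, where e is dV or dbar
   V. Doubling leaves a single |W|^2 to absorb into the left side 2 |W|^2, and the equality of the
   energies of dV and dbar V turns 2 + 2 into 4. *)
have Alt z : cabs z < 1 -> complex.Re (ev A z + ev (cj A) z) <=
    complex.Re (ev W z * (ev W z)^*%C +
      (2%:C%C * (ev (d1 V) z * (ev (d1 V) z)^*%C) + 2%:C%C * (ev (d2 V) z * (ev (d2 V) z)^*%C))).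
  move=> z1; rewrite !cReD ev_cj cReC !conjM_cabs -!rmorphM !Re_real.
  have -> : complex.Re (ev A z) = - complex.Re (z * ev (d1 V) z * (ev W z)^*%C)
      - complex.Re (z^*%C * ev (d2 V) z * (ev W z)^*%C).
    rewrite -opprD -cReD /A !evE ev_cj mulN1r -mulrDl mulrC.
    by case: (_ * _)%R.
  have h u (e : C) : cabs u < 1 -> - complex.Re (u * e * (ev W z)^*%C) <=
      cabs e ^+ 2 + cabs (ev W z) ^+ 2 / 4.
    move=> u1; have := cabs_conjM (- (u * e)) (ev W z).
    rewrite cabsN cabsM.
    have -> : complex.Re (- (u * e) * (ev W z)^*%C) = - complex.Re (u * e * (ev W z)^*%C).
      by rewrite mulNr; case: (_ * _)%R.
    move=> /le_trans; apply.
    have := cabs_ge0 e; have := cabs_ge0 (ev W z); have := cabs_ge0 u.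
    move: (cabs e) (cabs (ev W z)) (cabs u) u1 => x y v v1 v0 y0 x0.
    have := sqr_ge0 (x - y / 2); have := mulr_ge0 x0 y0.
    have : v * x * y <= x * y by rewrite ler_wpM2r// ler_piMl// ltW.
    nra.
  have := h z (ev (d1 V) z) z1; have := h z^*%C (ev (d2 V) z).
  by rewrite cabs_conj => /(_ z1); lra.
have j1 := cintegrableZ 2%:C%C i1; have j2 := cintegrableZ 2%:C%C i2.
have := Re_cint_le (cintegrableD iA iA') (cintegrableD iW (cintegrableD j1 j2)) Alt.
rewrite -eA cintZ// (cintD iW (cintegrableD j1 j2)) (cintD j1 j2) !cintZ//.
have := nrm2_d1_d2 W; rewrite -/V /nrm2.
move: (cint 1 _) (cint 1 _) (cint 1 _) => a b c.
have -> : (2 : C) = 2%:C%C by rewrite rmorph_nat.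
rewrite !cReD !cReM !Re_real /=; lra.
Qed.

End hankel_estimate.

(** * The Hankel estimate for polynomial symbols *)

Section poly_hankel.
Variable R : realType.
Local Notation C := R[i].
Implicit Types (s t : R) (F G : C -> C) (c z w : C) (p q f h : {poly C}) (W V : dexpr R).

Lemma poly_dexpr p : exists e, forall z,
  [/\ ev e z = p.[z], ev (d1 e) z = p^`().[z] & ev (d2 e) z = 0].
Proof.
elim/poly_ind: p => [|p c [e he]].
  by exists (Dc 0) => z; rewrite deriv0 horner0.
exists (Dadd (Dmul e (Dz R)) (Dc c)) => z; have [e0 e1 e2] := he z.
by rewrite !evE e0 e1 e2 derivMXaddC !hornerE; split; ring.
Qed.

(* The functions [rho W] vanish on the circle, so the second summand is orthogonal
   to the analytic functions. *)
Definition exact_mod F := exists W h, forall z,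
  F z = h.[z] + ev (d1 (Dmul (Drho 1) W)) z.

Lemma exact_modD F G : exact_mod F -> exact_mod G -> exact_mod (fun z => F z + G z).
Proof.
move=> [W [h FE]] [V [k GE]]; exists (Dadd W V), (h + k) => z.
by rewrite FE GE hornerD !evE; ring.
Qed.

Lemma exact_modZ c F : exact_mod F -> exact_mod (fun z => c * F z).
Proof.
move=> [W [h FE]]; exists (Dmul (Dc c) W), (c *: h) => z.
by rewrite FE hornerZ !evE; ring.
Qed.

Lemma exact_mod_sum (I : Type) (l : seq I) (F : I -> C -> C) :
  (forall i, exact_mod (F i)) -> exact_mod (fun z => \sum_(i <- l) F i z).
Proof.
move=> hF; elim: l => [|i l IH].
  exists (Dc 0), 0 => z; rewrite big_nil horner0 !evE; ring.
have -> : (fun z => \sum_(j <- i :: l) F j z) = (fun z => F i z + \sum_(j <- l) F j z).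
  by apply/funext => z; rewrite big_cons.
exact: exact_modD.
Qed.

(** Since d(rho z^a zbar^b) = a z^(a-1) zbar^b - (a+1) z^a zbar^(b+1), an exact term trades z^a
    zbar^(b+1) for a / (a+1) times z^(a-1) zbar^b, until no conjugate is left. *)
Lemma exact_mod_mon a b : exact_mod (fun z => z ^+ a * z^*%C ^+ b).
Proof.
have nz n : (n.+1%:R : C) != 0 by rewrite pnatr_eq0.
elim: b a => [|b IHb] a.
  exists (Dc 0), 'X^a => z; rewrite hornerXn expr0 !evE; ring.
have [W [h hE]] := exact_modZ (a%:R / a.+1%:R) (IHb a.-1).
exists (Dadd W (Dmul (Dc (- a.+1%:R^-1)) (mon R a b))), h => z.
have e2 := hE z; have e1 := d1_rho_mon 1 a b z; rewrite expr1n rmorph1 mul1r in e1.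
apply/eqP; rewrite -subr_eq0; apply/eqP.
have -> : z ^+ a * z^*%C ^+ b.+1 = a.+1%:R^-1 * (a%:R * (z ^+ a.-1 * z^*%C ^+ b))
   - a.+1%:R^-1 * (a%:R * (z ^+ a.-1 * z^*%C ^+ b) - a.+1%:R * (z ^+ a * z^*%C ^+ b.+1)).
  by rewrite -mulrBr subKr mulKf.
rewrite -e1.
have -> : a.+1%:R^-1 * (a%:R * (z ^+ a.-1 * z^*%C ^+ b)) =
  h.[z] + ev (d1 (Dmul (Drho 1) W)) z by rewrite -e2; ring.
rewrite !evE; ring.
Qed.

Lemma exact_mod_poly p f : exact_mod (fun z => (p.[z])^*%C * f.[z]).
Proof.
have -> : (fun z => (p.[z])^*%C * f.[z]) = (fun z =>
    \sum_(i <- index_enum 'I_(size p)) \sum_(j <- index_enum 'I_(size f))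
      (p`_i)^*%C * f`_j * (z ^+ j * z^*%C ^+ i)).
  apply/funext => z; rewrite !horner_coef (rmorph_sum (@conjc R)) mulr_suml.
  apply: eq_bigr => i _; rewrite mulr_sumr; apply: eq_bigr => j _.
  by rewrite rmorphM rmorphXn /=; ring.
by do 2!apply: exact_mod_sum => ?; exact/exact_modZ/exact_mod_mon.
Qed.

Lemma conjcN z : (- z)^*%C = - z^*%C.
Proof. exact: (rmorphN (@conjc R)). Qed.

(* With v = conj p * f - h = d(rho W), v is orthogonal to h, and integrating by
   parts gives |v|^2 = - int rho W p' conj f, to which Hardy's inequality and
   AM-GM apply. *)
Lemma hankel_poly p f : exists h,
  nrm2 1 (fun z => (p.[z])^*%C * f.[z] - h.[z]) <=
  4 * nrm2 1 (fun z => ev (Drho 1) z * p^`().[z] * f.[z]).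
Proof.
have [W [h hE]] := exact_mod_poly p f; exists h.
set V := Dmul _ W in hE.
have one0 : (0 : R) < 1 by [].
have [P hP] := poly_dexpr p; have [E hF] := poly_dexpr f; have [H hH] := poly_dexpr h.
have vE z : (p.[z])^*%C * f.[z] - h.[z] = ev (d1 V) z by rewrite hE addrC addKr.
have -> : (fun z => (p.[z])^*%C * f.[z] - h.[z]) = ev (d1 V).
  by apply/funext => z; rewrite vE.
pose Q := Dmul (Dmul (Drho 1) (d1 P)) E.
have -> : (fun z => ev (Drho 1) z * p^`().[z] * f.[z]) = ev Q.
  apply/funext => z; have [_ p1 _] := hP z; have [f0 _ _] := hF z.
  by rewrite /Q !ev_M p1 f0.
have iV := ev_sq_integrable (d1 V) 1; have iW := ev_sq_integrable W 1.
have iQ := ev_sq_integrable Q 1.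
(* [U] is W times the conjugate of v, so d(rho U) = dV conj v + V d(conj v), where dV = v and d(conj
   v) = p' conj f. *)
pose U := Dmul W (Dadd (Dmul P (cj E)) (Dmul (Dc (-1)) (cj H))).
have hU := cint_ev_d1 U one0.
pose B := Dmul (Dc (-1)) (Dmul (Drho 1) (Dmul W (Dmul (d1 P) (cj E)))).
have iB := ev_integrable B 1.
have eV : cint 1 (fun z => ev (d1 V) z * (ev (d1 V) z)^*%C) = cint 1 (ev B).
  apply/eqP; rewrite -subr_eq0 -mulN1r -cintZ// -cintD//; last exact: cintegrableZ.
  rewrite -hU; apply/eqP/eq_cint => z _; rewrite -{2}vE.
  have [p0 p1 p2] := hP z; have [f0 f1 f2] := hF z; have [h0 h1 h2] := hH z.
  rewrite conjcD conjcN conjcM conjcK.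
  rewrite /U /B /V !evE !(ev_cj, ev_d1_cj) p0 p1 f0 f2 h0 h2 conjc0; ring.
(* The weights 1/8 and 2 are chosen so that Hardy's inequality |W|^2 <= 4 |v|^2 leaves |v|^2 / 2 to
   absorb, giving |v|^2 <= 4 |Q|^2. *)
have le z : cabs z < 1 -> complex.Re (ev B z) <=
    complex.Re ((8^-1)%:C%C * (ev W z * (ev W z)^*%C) + 2%:C%C * (ev Q z * (ev Q z)^*%C)).
  move=> z1; rewrite cReD !conjM_cabs -!rmorphM !Re_real.
  have := le_trans (ler_norm _) (normRe_le_cabs (ev B z)) => /le_trans; apply.
  have -> : cabs (ev B z) = cabs (ev W z) * cabs (ev Q z).
    rewrite /B /Q !evE !ev_cj !cabsM cabs_conj cabsN cabs1; ring.
  have := sqr_ge0 (cabs (ev W z) / 2 - cabs (ev Q z) * 2); nra.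
have j1 := cintegrableZ (8^-1)%:C%C iW; have j2 := cintegrableZ 2%:C%C iQ.
have := Re_cint_le iB (cintegrableD j1 j2) le.
rewrite -eV (cintD j1 j2) !cintZ//.
have := hardy W; rewrite -/V /nrm2.
move: (cint 1 _) (cint 1 _) (cint 1 _) => a b c.
rewrite !cReD !cReM !Re_real /=; lra.
Qed.

Lemma horner_integrable s p f : cintegrable s (fun z => p.[z] * (f.[z])^*%C).
Proof.
have [P hP] := poly_dexpr p; have [E hE] := poly_dexpr f.
have -> : (fun z => p.[z] * (f.[z])^*%C) = ev (Dmul P (cj E)).
  apply/funext => z; have [p0 _ _] := hP z; have [f0 _ _] := hE z.
  by rewrite evE ev_cj p0 f0.
exact: ev_integrable.
Qed.

Lemma const_integrable s c : cintegrable s (fun=> c).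
Proof. exact: (ev_integrable (Dc c) s). Qed.

Lemma sum_le_support (g : nat -> R) m n : (forall i, 0 <= g i) ->
  (forall i, (n <= i)%N -> g i = 0) -> \sum_(i < m) g i <= \sum_(i < n) g i.
Proof.
move=> g0 gn; have [mn|/ltnW nm] := leqP m n.
  by rewrite -(subnKC mn) big_split_ord/= lerDl sumr_ge0.
rewrite -(subnKC nm) big_split_ord/= [X in _ + X]big1 ?addr0//.
by move=> i _; rewrite gn// leq_addr.
Qed.

(** Parseval's formula compared with the area of the disk, keeping the terms of degree 0 and 1; the
    2 is the ratio of their weights. *)
Lemma coef01_bound q : (forall z, cabs z < 1 -> cabs q.[z] <= 1) ->
  cabs q`_0 ^+ 2 + cabs q`_1 ^+ 2 / 2 <= 1.
Proof.
move=> q1; have one0 : (0 : R) < 1 by [].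
have := @Re_cint_le _ 1 (fun z => q.[z] * (q.[z])^*%C) (fun=> 1)
  (horner_integrable 1 q q) (const_integrable 1 1).
have -> : complex.Re (cint 1 (fun=> 1)) = m0 (1 : R) by [].
rewrite parseval_poly// Re_real => h.
have {}h : \sum_(i < size q) cabs q`_i ^+ 2 * weight (1 : R) i <= m0 (1 : R).
  apply: h => z z1; rewrite conjM_cabs Re_real /=.
  by rewrite expr_le1 ?cabs_ge0 ?q1.
have m0p := m0_gt0 one0.
have wE i : weight (1 : R) i = m0 (1 : R) / i.+1%:R by rewrite /weight expr1n mul1r.
rewrite -(ler_pM2r m0p) mul1r; apply: le_trans h.
have w0 i : 0 <= cabs q`_i ^+ 2 * weight (1 : R) i.
  by rewrite wE mulr_ge0 ?sqr_ge0 ?divr_ge0// ltW.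
have -> : (cabs q`_0 ^+ 2 + cabs q`_1 ^+ 2 / 2) * m0 (1 : R) =
  \sum_(i < 2) cabs q`_i ^+ 2 * weight (1 : R) i.
  by rewrite !big_ord_recr big_ord0 /= !wE; field.
have g0 i : (size q <= i)%N -> cabs q`_i ^+ 2 * weight (1 : R) i = 0.
  by move=> qi; rewrite nth_default// cabs0 expr0n mul0r.
exact: (@sum_le_support (fun i => cabs q`_i ^+ 2 * weight (1 : R) i)).
Qed.

(* Bessel's inequality on the disk of radius [1 - |z|] about [z] gives
   Schwarz-Pick up to a constant. *)
Lemma schwarz_pick p z : (forall w, cabs w < 1 -> cabs p.[w] <= 1) -> cabs z < 1 ->
  cabs (ev (Drho 1) z * p^`().[z]) ^+ 2 <= 8 * (1 - cabs p.[z] ^+ 2).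
Proof.
move=> p1 z1; pose r := 1 - cabs z; have r0 : 0 < r by rewrite /r; lra.
pose q := p \Po (r%:C%C *: 'X + z%:P).
have q1 w : cabs w < 1 -> cabs q.[w] <= 1.
  move=> w1; rewrite horner_comp !hornerE; apply: p1.
  apply: le_lt_trans (cabsD _ _) _; rewrite cabsM cabsR ger0_norm ?ltW//.
  have : r * cabs w < r by rewrite gtr_pMr.
  by rewrite {2}/r; lra.
have := coef01_bound q1.
have -> : q`_0 = p.[z] by rewrite -horner_coef0 horner_comp !hornerE.
have -> : q`_1 = p^`().[z] * r%:C%C.
  have : q^`()`_0 = q`_1 by rewrite coef_deriv.
  by move=> <-; rewrite -horner_coef0 deriv_comp derivD derivZ derivX derivC !hornerE horner_comp !hornerE.
rewrite ev_rho !cabsM !cabsR expr1n !exprMn !real_normK ?num_real//.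
(* The factor 4 is a bound for (1 + |z|)^2. With r^2 |p'|^2 <= 2 (1 - |p|^2) from the coefficients
   of [q], it yields the constant 8. *)
have : (1 - cabs z ^+ 2) ^+ 2 <= 4 * r ^+ 2.
  have -> : (1 - cabs z ^+ 2) ^+ 2 = (1 + cabs z) ^+ 2 * r ^+ 2 by rewrite /r; ring.
  by apply: ler_wpM2r; [exact: sqr_ge0|have := cabs_ge0 z; nra].
by have := sqr_ge0 (cabs p^`().[z]); nra.
Qed.

Lemma hankel_poly_contraction p f : (forall w, cabs w < 1 -> cabs p.[w] <= 1) ->
  exists h, nrm2 1 (fun z => (p.[z])^*%C * f.[z] - h.[z]) <=
  32 * complex.Re (cint 1 (fun z => (1 - cabs p.[z] ^+ 2)%:C%C * (f.[z] * (f.[z])^*%C))).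
Proof.
move=> p1; have [h hh] := hankel_poly p f; exists h; apply: le_trans hh _.
have [P hP] := poly_dexpr p; have [E hE] := poly_dexpr f.
pose G := Dmul (Dmul (Drho 1) (d1 P)) E.
pose K := Dmul (Dadd (Dc 1) (Dmul (Dc (-1)) (Dmul P (cj P)))) (Dmul E (cj E)).
have GE : (fun z => ev (Drho 1) z * p^`().[z] * f.[z]) = ev G.
  apply/funext => z; have [_ e1 _] := hP z; have [f0 _ _] := hE z.
  by rewrite /G !ev_M e1 f0.
have KE : (fun z => (1 - cabs p.[z] ^+ 2)%:C%C * (f.[z] * (f.[z])^*%C)) = ev K.
  apply/funext => z; have [e0 _ _] := hP z; have [f0 _ _] := hE z.
  by rewrite /K !evE !ev_cj e0 f0 [p.[z] * _]conjM_cabs mulN1r rmorphB rmorph1.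
rewrite GE KE /nrm2.
have iG := ev_sq_integrable G 1; have iK := ev_integrable K 1.
have := Re_cint_le iG (cintegrableZ 8%:C%C iK).
rewrite cintZ// cReM Re_real mul0r subr0 => le.
have -> : 32 = 4 * 8 :> R by ring.
rewrite -mulrA ler_pM2l//.
apply: le => z z1; rewrite -GE -KE !conjM_cabs -!rmorphM !Re_real.
rewrite cabsM exprMn mulrA ler_wpM2r ?sqr_ge0//; exact: schwarz_pick.
Qed.

End poly_hankel.

(** * Abstract Hilbert space theory: Riesz, square roots, projections, Douglas' lemma *)

Section hilbert.
Variables (R : realType) (V : lmodType R[i]).
Local Notation C := R[i].
Implicit Types (L H D : set V) (f g h k x y : V) (c : C) (e K t : R) (u : nat -> V).

Definition hnorm (ip : V -> V -> C) f : R := Num.sqrt (complex.Re (ip f f)).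

Definition hcvg (ip : V -> V -> C) u l :=
  forall e, 0 < e -> exists N, forall n, (N <= n)%N -> hnorm ip (u n - l) <= e.

(* A subspace [H], complete for the semi-inner product [ip] of [L]. *)
Record hspace L H (ip : V -> V -> C) : Prop := Hspace {
  hs_L : forall c f g, L f -> L g -> L (c *: f + g);
  hs_H : forall c f g, H f -> H g -> H (c *: f + g);
  hs_0 : H 0;
  hs_HL : H `<=` L;
  hs_lin : forall c f g h, L f -> L g -> L h ->
    ip (c *: f + g) h = c * ip f h + ip g h;
  hs_conj : forall f g, L f -> L g -> ip f g = (ip g f)^*%C;
  hs_ge0 : forall f, L f -> 0 <= complex.Re (ip f f);
  hs_def : forall f, H f -> complex.Re (ip f f) = 0 -> f = 0;
  hs_complete : forall u, (forall n, H (u n)) ->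
    (forall e, 0 < e -> exists N, forall n m, (N <= n)%N -> (N <= m)%N ->
       hnorm ip (u n - u m) <= e) ->
    exists2 l, H l & hcvg ip u l }.

Variables (L H : set V) (ip : V -> V -> C).
Variable (hs : hspace L H ip).
Local Notation nm := (hnorm ip).
Local Notation nto := (hcvg ip).
Let HL := hs_HL hs.
Let L0 : L 0 := HL (hs_0 hs).

Lemma LZ c f : L f -> L (c *: f).
Proof. by move=> Lf; rewrite -[c *: f]addr0; exact: (hs_L hs). Qed.
Lemma LD f g : L f -> L g -> L (f + g).
Proof. by move=> Lf Lg; rewrite -[f]scale1r; exact: (hs_L hs). Qed.
Lemma LB f g : L f -> L g -> L (f - g).
Proof. by move=> Lf Lg; rewrite -scaleN1r; apply: LD => //; exact: LZ. Qed.
Lemma HZ c f : H f -> H (c *: f).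
Proof. by move=> Lf; rewrite -[c *: f]addr0; apply: (hs_H hs) => //; exact: hs_0 hs. Qed.
Lemma HD f g : H f -> H g -> H (f + g).
Proof. by move=> Lf Lg; rewrite -[f]scale1r; exact: (hs_H hs). Qed.
Lemma HB f g : H f -> H g -> H (f - g).
Proof. by move=> Lf Lg; rewrite -scaleN1r; apply: HD => //; exact: HZ. Qed.

Lemma ip0l h : L h -> ip 0 h = 0.
Proof.
move=> Lh; have := hs_lin hs 1 L0 L0 Lh; rewrite scale1r addr0 mul1r.
by move/eqP; rewrite -subr_eq0 opprD addNKr oppr_eq0 => /eqP.
Qed.
Lemma ipZl c f h : L f -> L h -> ip (c *: f) h = c * ip f h.
Proof. by move=> Lf Lh; rewrite -[c *: f]addr0 (hs_lin hs)// ip0l// addr0. Qed.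
Lemma ipDl f g h : L f -> L g -> L h -> ip (f + g) h = ip f h + ip g h.
Proof. by move=> Lf Lg Lh; rewrite -{1}[f]scale1r (hs_lin hs)// mul1r. Qed.
Lemma ipBl f g h : L f -> L g -> L h -> ip (f - g) h = ip f h - ip g h.
Proof. by move=> Lf Lg Lh; rewrite -scaleN1r ipDl ?ipZl ?mulN1r//; exact: LZ. Qed.
Lemma ipZr c f h : L f -> L h -> ip f (c *: h) = c^*%C * ip f h.
Proof.
move=> Lf Lh; rewrite (hs_conj hs Lf); last exact: LZ.
by rewrite ipZl// conjcM -(hs_conj hs Lf Lh).
Qed.
Lemma ipDr f g h : L f -> L g -> L h -> ip f (g + h) = ip f g + ip f h.
Proof.
move=> Lf Lg Lh; rewrite (hs_conj hs Lf); last exact: LD.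
by rewrite ipDl// conjcD -(hs_conj hs Lf Lh) -(hs_conj hs Lf Lg).
Qed.
Lemma ipBr f g h : L f -> L g -> L h -> ip f (g - h) = ip f g - ip f h.
Proof.
move=> Lf Lg Lh; rewrite -scaleN1r ipDr ?ipZr//; last exact: LZ.
by rewrite conjcN1 mulN1r.
Qed.

Lemma ip_real f : L f -> ip f f = (complex.Re (ip f f))%:C%C.
Proof.
move=> Lf; have := congr1 (@complex.Im R) (hs_conj hs Lf Lf); rewrite cImC.
by case: (ip f f) => a b /= h; congr (_ +i* _)%C; lra.
Qed.

Lemma nm_ge0 f : 0 <= nm f. Proof. exact: sqrtr_ge0. Qed.
Lemma nm_sqr f : L f -> nm f ^+ 2 = complex.Re (ip f f).
Proof. by move=> Lf; rewrite sqr_sqrtr// (hs_ge0 hs). Qed.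

Lemma nm_sqrD c f g : L f -> L g -> nm (c *: f + g) ^+ 2 =
  cabs c ^+ 2 * nm f ^+ 2 + 2 * complex.Re (c * ip f g) + nm g ^+ 2.
Proof.
move=> Lf Lg; have Lcf := LZ c Lf.
rewrite nm_sqr; last exact: (hs_L hs).
rewrite ipDl//; last exact: LD.
rewrite !ipDr// !ipZl// !ipZr// (hs_conj hs Lg Lf) (ip_real Lf) (ip_real Lg).
rewrite -!nm_sqr// mulrA conjM_cabs -conjcM !cReD cReC -rmorphM !Re_real; ring.
Qed.

Lemma cauchy_schwarz f g : L f -> L g -> cabs (ip f g) <= nm f * nm g.
Proof.
move=> Lf Lg; set a := ip f g.
rewrite -(ler_pXn2r (_ : 0 < 2)%N) ?nnegrE ?cabs_ge0 ?mulr_ge0 ?nm_ge0// exprMn.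
(* Expansion of the squared norm of g - t conj(a) f. *)
have q t : 0 <= t ^+ 2 * (cabs a ^+ 2 * nm f ^+ 2) - 2 * t * cabs a ^+ 2 + nm g ^+ 2.
  have := sqr_ge0 (nm ((- t)%:C%C * a^*%C *: f + g)); rewrite nm_sqrD//.
  rewrite cabsM cabsR cabs_conj exprMn real_normK ?num_real// sqrrN -mulrA.
  by rewrite -/a (mulrC a^*%C) conjM_cabs -rmorphM Re_real => h; nra.
(* The form is only semidefinite on [L]. If [f] has norm 0 the quadratic is affine in t, and a large
   t contradicts its positivity unless a = 0. *)
have [f0|f0] := eqVneq (nm f) 0.
  rewrite f0 expr0n mul0r; have [a0|a0] := ltP 0 (cabs a ^+ 2); last by [].
  have := q ((nm g ^+ 2 + 1) / (2 * cabs a ^+ 2)); rewrite f0 expr0n /= !mulr0 add0r.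
  set t := _ / _; have -> : 2 * t * cabs a ^+ 2 = nm g ^+ 2 + 1.
    have -> : 2 * t * cabs a ^+ 2 = t * (2 * cabs a ^+ 2) by ring.
    by rewrite divfK// gt_eqF// mulr_gt0.
  lra.
have f1 : 0 < nm f ^+ 2 by rewrite exprn_gt0// lt0r f0 nm_ge0.
have := q ((nm f ^+ 2)^-1).
have -> : (nm f ^+ 2)^-1 ^+ 2 * (cabs a ^+ 2 * nm f ^+ 2) - 2 * (nm f ^+ 2)^-1 * cabs a ^+ 2
   + nm g ^+ 2 = nm g ^+ 2 - cabs a ^+ 2 / nm f ^+ 2 by field.
by rewrite subr_ge0 ler_pdivrMr// mulrC.
Qed.

Lemma nm_triangle f g : L f -> L g -> nm (f + g) <= nm f + nm g.
Proof.
move=> Lf Lg; rewrite -(ler_pXn2r (_ : 0 < 2)%N) ?nnegrE ?addr_ge0 ?nm_ge0//.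
have := nm_sqrD 1 Lf Lg; rewrite scale1r cabs1 expr1n !mul1r => ->.
have := le_trans (ler_norm _) (normRe_le_cabs (ip f g)).
move=> /le_trans /(_ (cauchy_schwarz Lf Lg)); nra.
Qed.

Lemma nmZ c f : L f -> nm (c *: f) = cabs c * nm f.
Proof.
move=> Lf; apply/eqP; rewrite -(eqrXn2 (_ : 0 < 2)%N) ?mulr_ge0 ?cabs_ge0 ?nm_ge0//.
have := nm_sqrD c Lf L0; rewrite addr0 (hs_conj hs Lf L0) ip0l// conjc0 mulr0 => ->.
by rewrite [nm 0 ^+ 2]nm_sqr// ip0l// !mulr0 !addr0 exprMn.
Qed.

Lemma nmN f : L f -> nm (- f) = nm f.
Proof. by move=> Lf; rewrite -scaleN1r nmZ// cabsN cabs1 mul1r. Qed.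

Lemma nmC f g : L f -> L g -> nm (f - g) = nm (g - f).
Proof. by move=> Lf Lg; rewrite -nmN ?opprB//; exact: LB. Qed.

Lemma nm_eq0_0 : nm 0 = 0.
Proof. by rewrite /hnorm ip0l// sqrtr0. Qed.

Lemma nm_eq0 f : H f -> nm f = 0 -> f = 0.
Proof. by move=> Hf h; apply: (hs_def hs Hf); rewrite -nm_sqr ?h ?expr0n//; exact: HL. Qed.

Lemma ip_eq f g : H f -> H g -> (forall k, H k -> ip k f = ip k g) -> f = g.
Proof.
move=> Hf Hg h; apply/eqP; rewrite -subr_eq0; apply/eqP/(hs_def hs); first exact: HB.
have Hfg := HB Hf Hg.
by rewrite ipBr ?h ?subrr//; exact: HL.
Qed.

Definition linear_on D (T : V -> V) :=
  forall c f g, D f -> D g -> T (c *: f + g) = c *: T f + T g.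

(** The functional |T f|^2 - 2 Re phi(f) is minimized over [D]; its minimizing sequences have Cauchy
    images under [T], whose limit represents [phi]. Taking T = id gives projections, and T = S2
    gives Douglas' lemma. The approximating sequence is part of the conclusion so that for T = id
    the limit can be kept in a closed [D]. *)
Lemma riesz D (T : V -> V) (phi : V -> C) K : 0 <= K ->
  D 0 -> (forall c f g, D f -> D g -> D (c *: f + g)) ->
  (forall f, D f -> H (T f)) -> linear_on D T ->
  (forall c f g, D f -> D g -> phi (c *: f + g) = c * phi f + phi g) ->
  (forall f, D f -> cabs (phi f) <= K * nm (T f)) ->
  exists h, [/\ H h, nm h <= K,
    exists2 u, forall n, D (u n) & nto (fun n => T (u n)) h &
    forall f, D f -> ip (T f) h = phi f].
Proof.
move=> K0 D0 Dl TH Tl pl pK; have TL f : D f -> L (T f) by move=> /TH /HL.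
have four0 : (0 : R) < 4 by [].
have two0 : (0 : R) < 2 by [].
have T0 : T 0 = 0.
  have := Tl 1 0 0 D0 D0; rewrite scaler0 addr0 scale1r => /eqP.
  by rewrite -subr_eq0 opprD addNKr oppr_eq0 => /eqP.
have p0 : phi 0 = 0.
  have := pl 1 0 0 D0 D0; rewrite scaler0 addr0 mul1r => /eqP.
  by rewrite -subr_eq0 opprD addNKr oppr_eq0 => /eqP.
have DZ c f : D f -> [/\ D (c *: f), T (c *: f) = c *: T f & phi (c *: f) = c * phi f].
  move=> Df; rewrite -[c *: f]addr0; split; first exact: Dl.
    by rewrite Tl// T0 addr0.
  by rewrite pl// p0 addr0.
pose J f := nm (T f) ^+ 2 - 2 * complex.Re (phi f).
have JK f : D f -> - K ^+ 2 <= J f.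
  move=> Df; have := le_trans (ler_norm _) (normRe_le_cabs (phi f)).
  move=> /le_trans /(_ (pK f Df)); have := sqr_ge0 (nm (T f) - K).
  by rewrite /J; nra.
pose S : set R := [set J f | f in D]; pose m := inf S.
have Sinf : has_inf S.
  by split; [exists (J 0), 0|exists (- K ^+ 2) => _ [f Df <-]; exact: JK].
have mJ f : D f -> m <= J f by move=> Df; apply: ge_inf; [exact: Sinf.2|exists f].
have [v v0 vs] := null_sequence R.
have /choice[u hu] : forall n, exists f, D f /\ J f <= m + v n.
  move=> n; have [_ [f Df <-] Jf] := inf_adherent (v0 n) Sinf.
  by exists f; split=> //; exact: ltW.
have Du n : D (u n) := proj1 (hu n).
(* Parallelogram law, with the minimum [m] compared to [J] at the midpoint of [f] and [g]. *)
have para f g : D f -> D g -> nm (T f - T g) ^+ 2 <= 2 * (J f - m) + 2 * (J g - m).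
  move=> Df Dg; have [Df2 Tf2 pf2] := DZ (2^-1)%:C%C f Df.
  have [Dg2 Tg2 pg2] := DZ (2^-1)%:C%C g Dg.
  have := mJ ((2^-1)%:C%C *: f + (2^-1)%:C%C *: g) (Dl _ _ _ Df Dg2).
  rewrite {1}/J Tl// pl// Tg2 pg2.
  rewrite nm_sqrD; [|exact: TL|exact/LZ/TL].
  rewrite nmZ ?ipZr; [|exact: TL|exact: TL|exact: TL].
  have := nm_sqrD (-1) (TL _ Dg) (TL _ Df); rewrite scaleN1r (addrC (- _)) => ->.
  rewrite cabsN cabs1 expr1n mul1r mulN1r conjc_real (hs_conj hs (TL _ Df) (TL _ Dg)).
  rewrite cabsR ger0_norm ?invr_ge0// exprMn /J.
  move: (ip (T g) (T f)) (phi f) (phi g) (nm _) (nm _) => [a a'] [b b'] [c c'] x y /=; nra.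
have cau e : 0 < e -> exists N, forall n j, (N <= n)%N -> (N <= j)%N ->
    nm (T (u n) - T (u j)) <= e.
  move=> e0; have [N hN] := vs (e ^+ 2 / 4) (divr_gt0 (exprn_gt0 2 e0) four0).
  exists N => n j Nn Nj.
  rewrite -(ler_pXn2r (_ : 0 < 2)%N) ?nnegrE ?nm_ge0 ?(ltW e0)//.
  apply: le_trans (para _ _ (Du n) (Du j)) _.
  have := proj2 (hu n); have := proj2 (hu j); have := hN n Nn; have := hN j Nj; lra.
have [h Hh uh] := hs_complete hs (fun n => TH _ (Du n)) cau.
have hphi f : D f -> ip (T f) h = phi f.
  move=> Df; pose t := (1 + nm (T f) ^+ 2)^-1.
  have t0 : 0 < t by rewrite invr_gt0 ltr_pwDl ?sqr_ge0.
  (* First variation: moving u n by -t conj(d) f, with d the error of representation, lowers [J] by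
     at least t |d|^2, while at most v n is available. *)
  have dn n : cabs (ip (T f) (T (u n)) - phi f) ^+ 2 <= v n * (1 + nm (T f) ^+ 2).
    set d := _ - _.
    have := mJ ((- t)%:C%C * d^*%C *: f + u n) (Dl _ _ _ Df (Du n)).
    rewrite /J Tl// pl// nm_sqrD; [|exact: TL|exact: TL].
    have -> : ip (T f) (T (u n)) = d + phi f by rewrite subrK.
    have := proj2 (hu n); rewrite /J cabsM cabsR cabs_conj exprMn real_normK ?num_real//.
    rewrite mulrDr !cReD.
    have -> : complex.Re ((- t)%:C%C * d^*%C * d) = - (t * cabs d ^+ 2).
      by rewrite -mulrA (mulrC d^*%C) conjM_cabs -rmorphM Re_real mulNr.
    rewrite sqrrN; set A := cabs d ^+ 2; set B := nm (T f) ^+ 2 => h1 h2.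
    have tB : t * (1 + B) = 1 by rewrite mulVf// gt_eqF// ltr_pwDl ?sqr_ge0.
    have A0 : 0 <= A by exact: sqr_ge0.
    have B0 : 0 <= B by exact: sqr_ge0.
    have h3 : 2 * t * A - t ^+ 2 * A * B <= v n by lra.
    have h4 : 2 * t * A - t ^+ 2 * A * B = t * A + t ^+ 2 * A.
      by rewrite -[t * A in RHS]mulr1 -tB; ring.
    have h5 : t * A <= v n.
      by have := mulr_ge0 (sqr_ge0 t) A0; lra.
    have := ler_wpM2r (ltW (ltr_pwDl ltr01 B0)) h5.
    by rewrite mulrAC tB mul1r.
  apply/eqP; rewrite -subr_eq0; apply/eqP/cabs0_eq0/eqP.
  rewrite eq_le cabs_ge0 andbT; apply/ler_addgt0Pl => e e0; rewrite addr0.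
  have N1 : 0 < 1 + nm (T f) ^+ 2 by rewrite ltr_pwDl ?sqr_ge0.
  have M1 : 0 < nm (T f) + 1 by rewrite ltr_wpDl ?nm_ge0.
  have [N hN] := vs (e ^+ 2 / 4 / (1 + nm (T f) ^+ 2))
    (divr_gt0 (divr_gt0 (exprn_gt0 2 e0) four0) N1).
  have [N' hN'] := uh (e / 2 / (nm (T f) + 1)) (divr_gt0 (divr_gt0 e0 two0) M1).
  pose n := maxn N N'.
  have Lu := TL _ (Du n); have Lh := HL Hh; have Lf := TL _ Df.
  have a1 : cabs (ip (T f) (T (u n)) - phi f) <= e / 2.
    rewrite -(ler_pXn2r (_ : 0 < 2)%N) ?nnegrE ?cabs_ge0 ?divr_ge0 ?(ltW e0)//.
    apply: le_trans (dn n) _; have := hN n (leq_maxl _ _).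
    by rewrite ler_pdivlMr// => /le_trans; apply; lra.
  have a2 : cabs (ip (T f) (T (u n)) - ip (T f) h) <= e / 2.
    rewrite -ipBr//; apply: le_trans (cauchy_schwarz Lf (LB Lu Lh)) _.
    have := hN' n (leq_maxr _ _); rewrite ler_pdivlMr//; apply: le_trans.
    by rewrite mulrC ler_wpM2l ?nm_ge0// lerDl.
  have := cabsB (ip (T f) (T (u n)) - phi f) (ip (T f) (T (u n)) - ip (T f) h).
  have -> : ip (T f) (T (u n)) - phi f - (ip (T f) (T (u n)) - ip (T f) h) =
    ip (T f) h - phi f by ring.
  lra.
exists h; split=> //; last by exists u.
(* For the norm bound, |h|^2 is close to Re phi(u n) <= K |T (u n)|, which is close to K |h|;
   dividing by |h| requires it to be nonzero. *)
have [->//|h0] := eqVneq (nm h) 0.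
have hp : 0 < nm h by rewrite lt0r h0 nm_ge0.
rewrite -(ler_pM2r hp); apply/ler_addgt0Pl => e e0.
have M1 : 0 < nm h + K by lra.
have [N hN] := uh (e / (nm h + K)) (divr_gt0 e0 M1).
have := hN N (leqnn N); set x := T (u N); have Lx : L x := TL _ (Du N).
have Lh := HL Hh; rewrite ler_pdivlMr// => hx.
have e1 : nm h ^+ 2 = complex.Re (phi (u N)) - complex.Re (ip (x - h) h).
  by rewrite nm_sqr// -(hphi _ (Du N)) ipBl// -/x; case: (ip x h) (ip h h) => ? ? [? ?] /=; lra.
have := pK _ (Du N); rewrite -/x => e2.
have := le_trans (ler_norm _) (normRe_le_cabs (phi (u N))).
have := le_trans (ler_norm _) (normRe_le_cabs (- ip (x - h) h)).
rewrite cabsN => e3 e4; have e5 := cauchy_schwarz (LB Lx Lh) Lh.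
have e6 : complex.Re (- ip (x - h) h) = - complex.Re (ip (x - h) h) by case: (ip _ _).
have e7 : nm x <= nm h + nm (x - h).
  by have := nm_triangle (LB Lx Lh) Lh; rewrite subrK; lra.
have e8 := ler_wpM2l K0 e7.
rewrite -expr2; nra.
Qed.

Lemma hcvg_lin u w l k c : (forall n, L (u n)) -> (forall n, L (w n)) -> L l -> L k ->
  nto u l -> nto w k -> nto (fun n => c *: u n + w n) (c *: l + k).
Proof.
move=> Lu Lw Ll Lk ul wk e e0.
have c1 : 0 < cabs c + 1 by rewrite ltr_wpDl ?cabs_ge0.
have [N1 h1] := ul (e / 2 / (cabs c + 1)) (divr_gt0 (divr_gt0 e0 (ltr0Sn R 1)) c1).
have [N2 h2] := wk (e / 2) (divr_gt0 e0 (ltr0Sn R 1)).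
exists (maxn N1 N2) => n; rewrite geq_max => /andP[/h1 + /h2].
rewrite ler_pdivlMr// => a1 a2.
have -> : c *: u n + w n - (c *: l + k) = c *: (u n - l) + (w n - k).
  by rewrite scalerBr opprD addrACA.
apply: le_trans (nm_triangle _ _) _; [exact/LZ/LB|exact: LB|].
rewrite nmZ; last exact: LB.
have := nm_ge0 (u n - l); have := cabs_ge0 c; nra.
Qed.

Lemma hcvg_le u l (B : R) : (forall n, L (u n)) -> L l -> nto u l ->
  (forall n, nm (u n) <= B) -> nm l <= B.
Proof.
move=> Lu Ll ul uB; apply/ler_addgt0Pl => e e0.
have [N hN] := ul e e0; have := hN N (leqnn N); have := uB N.
have := nm_triangle (LB Ll (Lu N)) (Lu N); rewrite subrK nmC//; lra.
Qed.

Lemma hcvg_unique u l k : (forall n, L (u n)) -> H l -> H k -> nto u l -> nto u k -> l = k.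
Proof.
move=> Lu Hl Hk ul uk; have Ll := HL Hl; have Lk := HL Hk.
apply/eqP; rewrite -subr_eq0; apply/eqP/nm_eq0; first exact: HB.
apply/eqP; rewrite eq_le nm_ge0 andbT; apply/ler_addgt0Pl => e e0; rewrite addr0.
have [N1 h1] := ul (e / 2) (divr_gt0 e0 (ltr0Sn R 1)).
have [N2 h2] := uk (e / 2) (divr_gt0 e0 (ltr0Sn R 1)).
have := h1 _ (leq_maxl N1 N2); have := h2 _ (leq_maxr N1 N2); set x := u _.
have Lx : L x := Lu _.
have := nm_triangle (LB Ll Lx) (LB Lx Lk); rewrite addrA subrK (nmC Ll Lx); lra.
Qed.

Lemma hcvg_ip_real u l f : (forall n, L (u n)) -> L l -> L f -> nto u l ->
  (forall n, complex.Im (ip (u n) f) = 0) -> complex.Im (ip l f) = 0.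
Proof.
move=> Lu Ll Lf ul h; apply/eqP; rewrite -normr_le0; apply/ler_addgt0Pl => e e0.
have f1 : 0 < nm f + 1 by rewrite ltr_wpDl ?nm_ge0.
have [N hN] := ul (e / (nm f + 1)) (divr_gt0 e0 f1).
have := hN N (leqnn N); rewrite ler_pdivlMr// => h1.
have := le_trans (normIm_le_cabs _) (cauchy_schwarz (LB (Lu N) Ll) Lf).
rewrite ipBl//; have := h N; case: (ip (u N) f) (ip l f) => a b [a' b'] /= ->.
rewrite sub0r normrN addr0 => h2; apply: le_trans h2 _; apply: le_trans h1.
by rewrite ler_wpM2l ?nm_ge0// lerDl.
Qed.

(** * The positive square root of I - X for a self-adjoint contraction X *)

Section square_root.
Variable X : V -> V.
Hypothesis XH : forall f, H f -> H (X f).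
Hypothesis Xl : linear_on H X.
Hypothesis Xs : forall f g, H f -> H g -> ip (X f) g = ip f (X g).
Hypothesis X1 : forall f, H f -> nm (X f) <= nm f.

(* The cone of polynomials in [X] with nonnegative coefficients; the index is the
   value at 1, which dominates the norm. *)
Inductive cone : R -> (V -> V) -> Prop :=
| cone0 : cone 0 (fun=> 0)
| coneX : cone 1 X
| coneD a b A B : cone a A -> cone b B -> cone (a + b) (fun f => A f + B f)
| coneM a b A B : cone a A -> cone b B -> cone (a * b) (fun f => A (B f))
| coneZ t a A : 0 <= t -> cone a A -> cone (t * a) (fun f => t%:C%C *: A f).

Lemma cone_ge0 a A : cone a A -> 0 <= a.
Proof. by elim=> *; rewrite ?addr_ge0 ?mulr_ge0. Qed.

Lemma cone_H a A : cone a A -> forall f, H f -> H (A f).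
Proof.
elim=> [f _|//|? ? ? ? _ IH1 _ IH2 f Hf|? ? ? ? _ IH1 _ IH2 f Hf|? ? ? ? _ IH f Hf].
- exact: hs_0 hs.
- exact: HD (IH1 _ Hf) (IH2 _ Hf).
- exact/IH1/IH2.
- exact/HZ/IH.
Qed.

Lemma cone_lin a A : cone a A -> linear_on H A.
Proof.
elim=> [c f g _ _|//|a1 a2 A1 A2 _ IH1 _ IH2 c f g Hf Hg|
  a1 a2 A1 A2 c1 IH1 c2 IH2 c f g Hf Hg|t a1 A1 _ _ IH c f g Hf Hg].
- by rewrite scaler0 addr0.
- by rewrite IH1// IH2// scalerDr addrACA.
- by rewrite IH2// IH1//; exact: cone_H c2 _ _.
- by rewrite IH// scalerDr !scalerA mulrC.
Qed.

Lemma cone_bound a A : cone a A -> forall f, H f -> nm (A f) <= a * nm f.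
Proof.
elim=> [f Hf|f Hf|a1 a2 A1 A2 c1 IH1 c2 IH2 f Hf|a1 a2 A1 A2 c1 IH1 c2 IH2 f Hf|
  t a1 A1 t0 c1 IH f Hf].
- by rewrite mul0r nm_eq0_0.
- by rewrite mul1r X1.
- rewrite mulrDl; apply: le_trans (nm_triangle _ _) (lerD (IH1 _ Hf) (IH2 _ Hf)).
    exact/HL/(cone_H c1).
  exact/HL/(cone_H c2).
- apply: le_trans (IH1 _ (cone_H c2 Hf)) _.
  by rewrite -mulrA ler_wpM2l ?(cone_ge0 c1) ?IH2.
- rewrite nmZ; last exact/HL/(cone_H c1).
  by rewrite cabsR ger0_norm// -mulrA ler_wpM2l ?IH.
Qed.

Lemma cone_comm a A b B : cone a A -> cone b B -> forall f, H f -> A (B f) = B (A f).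
Proof.
have z b' B' : cone b' B' -> B' 0 = 0.
  move=> cB; have := cone_lin cB 1 (hs_0 hs) (hs_0 hs).
  rewrite scaler0 addr0 scale1r => /eqP.
  by rewrite -subr_eq0 opprD addNKr oppr_eq0 => /eqP.
have lD b' B' : cone b' B' -> forall f g, H f -> H g -> B' (f + g) = B' f + B' g.
  by move=> cB f g Hf Hg; have := cone_lin cB 1 Hf Hg; rewrite !scale1r.
have lZ b' B' : cone b' B' -> forall c f, H f -> B' (c *: f) = c *: B' f.
  by move=> cB c f Hf; have := cone_lin cB c Hf (hs_0 hs); rewrite !(addr0, z _ _ cB).
move=> cA cB.
have cX b' B' : cone b' B' -> forall f, H f -> X (B' f) = B' (X f).
  elim=> [f _|//|a1 a2 A1 A2 c1 IH1 c2 IH2 f Hf|a1 a2 A1 A2 c1 IH1 c2 IH2 f Hf|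
    t a1 A1 t0 c1 IH f Hf].
  - exact: z coneX.
  - rewrite (lD _ _ coneX) ?IH1 ?IH2//; [exact: cone_H c1 _ _|exact: cone_H c2 _ _].
  - by rewrite IH1 ?IH2//; exact: cone_H c2 _ _.
  - by rewrite (lZ _ _ coneX) ?IH//; exact: cone_H c1 _ _.
elim: cA => [f Hf|f Hf|a1 a2 A1 A2 c1 IH1 c2 IH2 f Hf|a1 a2 A1 A2 c1 IH1 c2 IH2 f Hf|
  t a1 A1 t0 c1 IH f Hf].
- by rewrite (z _ _ cB).
- exact: cX cB _ _.
- by rewrite (lD _ _ cB) ?IH1 ?IH2//; [exact: cone_H c1 _ _|exact: cone_H c2 _ _].
- by rewrite IH2// IH1//; exact: cone_H c2 _ _.
- by rewrite (lZ _ _ cB) ?IH//; exact: cone_H c1 _ _.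
Qed.

Lemma cone_selfadj a A : cone a A -> forall f g, H f -> H g -> ip (A f) g = ip f (A g).
Proof.
elim=> [f g Hf Hg|f g Hf Hg|a1 a2 A1 A2 c1 IH1 c2 IH2 f g Hf Hg|
  a1 a2 A1 A2 c1 IH1 c2 IH2 f g Hf Hg| t a1 A1 t0 c1 IH f g Hf Hg].
- by rewrite (hs_conj hs (HL Hf) L0) !ip0l ?conjc0//; exact: HL.
- exact: Xs.
- have h1 := cone_H c1; have h2 := cone_H c2.
  by rewrite ipDl ?ipDr ?IH1 ?IH2//; apply: HL => //; [exact: h1|exact: h2|exact: h1|exact: h2].
- rewrite IH1//; last exact: cone_H c2 _ _.
  rewrite IH2//; last exact: cone_H c1 _ _.
  by rewrite (cone_comm c1 c2).
- rewrite ipZl ?ipZr ?IH ?conjc_real//; apply: HL => //; exact: cone_H c1 _ _.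
Qed.

(* [I - Y] squares to [I - X] at a fixed point of [Y = (X + Y^2) / 2]; the
   iteration starts at 0 and has increments in the cone. *)
Fixpoint iterY n : V -> V :=
  if n is n'.+1 then fun f => (2^-1)%:C%C *: (X f + iterY n' (iterY n' f)) else fun=> 0.

Fixpoint itery n : R := if n is n'.+1 then 2^-1 * (1 + itery n' * itery n') else 0.

Lemma iterY_cone n : cone (itery n) (iterY n).
Proof.
elim: n => [|n IH]; first exact: cone0.
apply: (@coneZ _ _ (fun f => X f + iterY n (iterY n f))); first by rewrite invr_ge0.
by apply: (@coneD _ _ _ (fun f => iterY n (iterY n f))); [exact: coneX|exact: coneM].
Qed.

(** Members of the cone commute, so Y_(n+2) - Y_(n+1) factors as half of (Y_(n+1) + Y_n)(Y_(n+1) -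
    Y_n), which has nonnegative coefficients again. *)
Lemma iterY_incr n : exists2 A, cone (itery n.+1 - itery n) A &
  forall f, H f -> A f = iterY n.+1 f - iterY n f.
Proof.
have h2 : 0 <= 2^-1 :> R by rewrite invr_ge0.
elim: n => [|n [A cA AE]].
  exists (fun f => (2^-1)%:C%C *: X f) => [|f _ /=]; last by rewrite addr0 subr0.
  by rewrite /= mulr0 addr0 subr0; apply: coneZ => //; exact: coneX.
have cn := iterY_cone n; have cn1 := iterY_cone n.+1.
exists (fun f => (2^-1)%:C%C *: (iterY n.+1 (A f) + iterY n (A f))).
  have -> : itery n.+2 - itery n.+1 = 2^-1 * (itery n.+1 * (itery n.+1 - itery n) +
      itery n * (itery n.+1 - itery n)).
    have e2 : itery n.+2 = 2^-1 * (1 + itery n.+1 * itery n.+1) by [].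
    have e1 : itery n.+1 = 2^-1 * (1 + itery n * itery n) by [].
    by rewrite e2; move: (itery n.+1) e1 => a e1; lra.
  apply: (@coneZ _ _ (fun f => iterY n.+1 (A f) + iterY n (A f))) => //.
  by apply: (@coneD _ _ (fun f => iterY n.+1 (A f)) (fun f => iterY n (A f))); exact: coneM.
move=> f Hf.
have lB b' B' : cone b' B' -> forall g k, H g -> H k -> B' (g - k) = B' g - B' k.
  move=> cB g k Hg Hk; have := cone_lin cB (-1) Hk Hg.
  by rewrite !scaleN1r addrC [in RHS]addrC.
have H1 := cone_H cn1 Hf; have H2 := cone_H cn Hf.
rewrite AE// (lB _ _ cn1)// (lB _ _ cn)// (cone_comm cn cn1)//.
rewrite addrA subrK.
transitivity ((2^-1)%:C%C *: (X f + iterY n.+1 (iterY n.+1 f)) -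
  (2^-1)%:C%C *: (X f + iterY n (iterY n f))); last by [].
by rewrite -scalerBr opprD addrACA subrr add0r.
Qed.

Lemma itery_incr n : itery n <= itery n.+1.
Proof. by have [A cA _] := iterY_incr n; have := cone_ge0 cA; rewrite subr_ge0. Qed.

Lemma itery_le1 n : 0 <= itery n <= 1.
Proof. by elim: n => [|n /andP[a b]] /=; [rewrite lexx ler01|nra]. Qed.

(** As the increments lie in the cone, their norms are dominated by the scalar iteration;
    convergence of the operators follows from that of a bounded monotone real sequence. *)
Lemma iterY_tail n m f : (n <= m)%N -> H f ->
  nm (iterY m f - iterY n f) <= (itery m - itery n) * nm f.
Proof.
move=> nm Hf; rewrite -(subnKC nm); elim: (m - n)%N => [|j IH].
  by rewrite addn0 !subrr mul0r nm_eq0_0.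
rewrite addnS; have [A cA AE] := iterY_incr (n + j).
have Hi i := HL (cone_H (iterY_cone i) Hf).
have := nm_triangle (LB (Hi (n + j).+1) (Hi (n + j)%N)) (LB (Hi (n + j)%N) (Hi n)).
rewrite addrA subrK -AE//; have := cone_bound cA Hf.
move=> h1 h2; apply: le_trans h2 _; move: IH h1; move: (hnorm _ _) (hnorm _ _) => a b.
by rewrite !mulrBl; lra.
Qed.

Lemma itery_cauchy e : 0 < e -> exists N, forall n m, (N <= n)%N -> (n <= m)%N ->
  itery m - itery n <= e.
Proof.
move=> e0; have nd : nondecreasing_seq itery by apply/nondecreasing_seqP => n; exact: itery_incr.
have cv : cvgn itery.
  apply: nondecreasing_is_cvgn => //; exists 1 => _ [n _ <-].
  by have /andP[] := itery_le1 n.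
have lim_le n : itery n <= limn itery by exact: nondecreasing_cvgn_le.
have /cvgrPdist_le /(_ _ e0)[N _ hN] := cv.
exists N => n m Nn nm; have := hN n Nn; rewrite /= ger0_norm ?subr_ge0//.
by have := lim_le m; lra.
Qed.

Definition limY f : V := xget 0 [set l | H l /\ nto (iterY^~ f) l].

Lemma limYP f : H f -> H (limY f) /\ nto (iterY^~ f) (limY f).
Proof.
move=> Hf; rewrite /limY; case: xgetP => [x _ //|none].
have f1 : 0 < nm f + 1 by rewrite ltr_wpDl ?nm_ge0.
have Hi n := cone_H (iterY_cone n) Hf.
have [e e0|l Hl ul] := hs_complete hs (u := iterY^~ f) Hi; last by case: (none l).
have [N hN] := itery_cauchy (divr_gt0 e0 f1); exists N => n m.
have aux i j : (N <= i)%N -> (i <= j)%N -> nm (iterY j f - iterY i f) <= e.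
  move=> Ni ij; apply: le_trans (iterY_tail ij Hf) _.
  have := hN i j Ni ij; rewrite ler_pdivlMr//; apply: le_trans.
  rewrite ler_wpM2l ?lerDl// subr_ge0.
  by rewrite -(subnKC ij); elim: (j - i)%N => [|k IH]; rewrite ?addn0// addnS;
    apply: le_trans IH (itery_incr _).
move=> Nn Nm; have [le|/ltnW le] := leqP n m; last exact: aux.
by rewrite nmC; [exact: aux|exact: HL|exact: HL].
Qed.

Lemma limY_bound f : H f -> nm (limY f) <= nm f.
Proof.
move=> Hf; have [Hl ul] := limYP Hf; have Hi n := cone_H (iterY_cone n) Hf.
apply: (hcvg_le _ _ ul) => [n||n]; [exact/HL|exact: HL|].
apply: le_trans (cone_bound (iterY_cone n) Hf) _.
by rewrite ler_piMl ?nm_ge0//; have /andP[] := itery_le1 n.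
Qed.

Lemma limY_lin : linear_on H limY.
Proof.
move=> c f g Hf Hg; have [H1 u1] := limYP Hf; have [H2 u2] := limYP Hg.
have Hfg := hs_H hs c Hf Hg; have [H3 u3] := limYP Hfg.
have Hi n := cone_H (iterY_cone n).
apply: (@hcvg_unique (iterY^~ (c *: f + g))) => //.
- by move=> n; exact/HL/Hi.
- exact: (hs_H hs).
- have -> : iterY^~ (c *: f + g) = (fun n => c *: iterY n f + iterY n g).
    by apply/funext => n; rewrite (cone_lin (iterY_cone n)).
  by apply: hcvg_lin => // [n|n||]; apply: HL => //; exact: Hi.
Qed.

(** The limit of Y_n (Y_n f) is computed twice: by uniform boundedness of the Y_n it is Y (Y f), and
    by the recursion it is the limit of 2 Y_(n+1) f - X f. *)
Lemma limY_sq f : H f -> limY (limY f) = (2 : C) *: limY f - X f.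
Proof.
move=> Hf; have [H1 u1] := limYP Hf; have [H2 u2] := limYP H1.
have Hi n := cone_H (iterY_cone n).
have HX := XH Hf.
apply: (@hcvg_unique (fun n => iterY n (iterY n f))) => //.
- by move=> n; exact/HL/Hi/Hi.
- exact/HB/HX/HZ.
- move=> e e0.
  have [N1 h1] := u1 (e / 2) (divr_gt0 e0 (ltr0Sn R 1)).
  have [N2 h2] := u2 (e / 2) (divr_gt0 e0 (ltr0Sn R 1)).
  exists (maxn N1 N2) => n; rewrite geq_max => /andP[/h1 a1 /h2 a2].
  have -> : iterY n (iterY n f) - limY (limY f) =
      iterY n (iterY n f - limY f) + (iterY n (limY f) - limY (limY f)).
    have := cone_lin (iterY_cone n) (-1) H1 (Hi n _ Hf).
    rewrite !scaleN1r (addrC (- limY f)) => ->.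
    by rewrite addrA (addrC (- _)) subrK.
  have HA : H (iterY n f - limY f) by apply: HB => //; exact: Hi.
  apply: le_trans (nm_triangle _ _) _.
  + exact/HL/Hi.
  + by apply/HL/HB => //; exact: Hi.
  have := cone_bound (iterY_cone n) HA; have /andP[y0 y1] := itery_le1 n.
  have := nm_ge0 (iterY n f - limY f); nra.
- have -> : (fun n => iterY n (iterY n f)) = (fun n => (2 : C) *: iterY n.+1 f + - X f).
    apply/funext => n /=; rewrite scalerA -[2]/(2%:R) -(rmorph_nat (real_complex R)) -rmorphM.
    by rewrite divff ?pnatr_eq0// rmorph1 scale1r addrC addKr.
  apply: hcvg_lin.
  + by move=> n; exact/HL/Hi.
  + by move=> n; rewrite -scaleN1r; exact/LZ/HL.
  + exact: HL.
  + by rewrite -scaleN1r; exact/LZ/HL.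
  + by move=> e e0; have [N hN] := u1 e e0; exists N => n Nn; exact/hN/leqW.
  + by move=> e e0; exists 0%N => n _; rewrite subrr nm_eq0_0 ltW.
Qed.

(** With S = I - Y one has S^2 = I - 2 Y + Y^2 = I - X. Positivity needs <Y f, f> real, as a limit
    of self-adjoint forms, and at most |f|^2, since Y is a contraction. *)
Lemma sqrt_exists : exists S : V -> V,
  [/\ forall f, H f -> H (S f), linear_on H S,
      forall f, H f -> nm (S f) <= 2 * nm f,
      forall f, H f -> 0 <= ip (S f) f &
      forall f, H f -> S (S f) = f - X f].
Proof.
exists (fun f => f - limY f); split.
- by move=> f Hf; apply: HB => //; have [] := limYP Hf.
- by move=> c f g Hf Hg; rewrite limY_lin// scalerBr opprD addrACA.
- move=> f Hf; have [Hl _] := limYP Hf; have Ll := HL Hl; have Lf := HL Hf.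
  have := nm_triangle Lf (LB L0 Ll); rewrite sub0r nmN// => /le_trans; apply.
  by have := limY_bound Hf; lra.
- move=> f Hf; have [Hl ul] := limYP Hf; have Ll := HL Hl; have Lf := HL Hf.
  have Hi n := cone_H (iterY_cone n) Hf.
  have im0 : complex.Im (ip (limY f) f) = 0.
    apply: (hcvg_ip_real _ Ll Lf ul) => n; first exact: HL.
    have := cone_selfadj (iterY_cone n) Hf Hf.
    rewrite (hs_conj hs Lf (HL (Hi n))) => /(congr1 (@complex.Im R)).
    rewrite cImC; lra.
  have le := le_trans (ler_norm _) (le_trans (normRe_le_cabs (ip (limY f) f))
    (cauchy_schwarz Ll Lf)).
  rewrite ipBl// (ip_real Lf) -nm_sqr//.
  move: im0 le; case: (ip _ _) => a b /= -> le; rewrite lecE /= subrr eqxx /=.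
  by have := limY_bound Hf; have := nm_ge0 f; nra.
- move=> f Hf; have [Hl _] := limYP Hf.
  have -> : limY (f - limY f) = limY f - limY (limY f).
    have := limY_lin (-1) Hl Hf; rewrite !scaleN1r addrC => ->.
    by rewrite addrC.
  rewrite limY_sq// scaler_nat mulr2n.
  have -> : limY f - (limY f + limY f - X f) = X f - limY f.
    by rewrite opprB opprD addrCA addNKr.
  by rewrite opprB addrA subrK.
Qed.

End square_root.

Lemma projection_exists f : L f ->
  exists2 g, H g & forall k, H k -> ip (f - g) k = 0.
Proof.
move=> Lf; have lid : linear_on H id by [].
have ll c g k : H g -> H k -> ip (c *: g + k) f = c * ip g f + ip k f.
  by move=> Hg Hk; apply: (hs_lin hs) => //; exact: HL.
have bd g : H g -> cabs (ip g f) <= nm f * nm g.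
  by move=> Hg; rewrite mulrC; apply: cauchy_schwarz => //; exact: HL.
have [h [Hh _ _ hE]] := riesz (nm_ge0 f) (hs_0 hs) (hs_H hs) (fun g Hg => Hg) lid ll bd.
exists h => // k Hk; have Lh := HL Hh; have Lk := HL Hk.
rewrite (hs_conj hs _ Lk); last exact: LB.
by rewrite ipBr// hE// subrr conjc0.
Qed.

(** Positivity in [R[i]] makes the quadratic form real; polarization with the coefficients 1 and i
    gives symmetry. *)
Lemma positive_selfadj (S : V -> V) : (forall f, H f -> H (S f)) -> linear_on H S ->
  (forall f, H f -> 0 <= ip (S f) f) ->
  forall f g, H f -> H g -> ip (S f) g = ip f (S g).
Proof.
move=> SH Sl S0 f g Hf Hg.
have im0 k : H k -> complex.Im (ip (S k) k) = 0.
  by move=> /S0; exact: ger0_Im.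
have Lf := HL Hf; have Lg := HL Hg; have LSf := HL (SH _ Hf); have LSg := HL (SH _ Hg).
have pol c : complex.Im (c * ip (S f) g + c^*%C * ip (S g) f) = 0.
  have := im0 _ (hs_H hs c Hf Hg); rewrite Sl// ipDl; last first.
  - exact/HL/(hs_H hs).
  - exact: LSg.
  - exact: LZ.
  rewrite !ipDr//; [|exact: LZ|exact: LZ|exact: LZ].
  rewrite !ipZl//; last exact: LZ.
  rewrite !ipZr// mulrA conjM_cabs !cImD !cImM !Re_real.
  by rewrite (im0 f Hf) (im0 g Hg) /= mul0r mulr0 !addr0 add0r.
rewrite (hs_conj hs Lf LSg).
have := pol 1; have := pol 'i%C.
case: (ip (S f) g) (ip (S g) f) => a b [a' b'] /=; rewrite !mul0r !mul1r => h1 h2.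
by congr (_ +i* _)%C; lra.
Qed.

(** The functional f -> <f, S1 g> = <S1 f, g> is bounded by K |g| |S2 f|, so it is <S2 f, h> for
    some [h] of norm at most K |g|; symmetry of S2 turns this into S2 h = S1 g. *)
Lemma douglas (S1 S2 : V -> V) K : 0 <= K ->
  (forall f, H f -> H (S1 f)) -> (forall f, H f -> H (S2 f)) -> linear_on H S2 ->
  (forall f g, H f -> H g -> ip (S1 f) g = ip f (S1 g)) ->
  (forall f g, H f -> H g -> ip (S2 f) g = ip f (S2 g)) ->
  (forall f, H f -> nm (S1 f) <= K * nm (S2 f)) ->
  forall g, H g -> exists h, [/\ H h, S2 h = S1 g & nm h <= K * nm g].
Proof.
move=> K0 S1H S2H S2l S1s S2s le g Hg; have LSg := HL (S1H _ Hg).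
have ll c f k : H f -> H k -> ip (c *: f + k) (S1 g) = c * ip f (S1 g) + ip k (S1 g).
  by move=> Hf Hk; apply: (hs_lin hs) => //; exact: HL.
have bd f : H f -> cabs (ip f (S1 g)) <= K * nm g * nm (S2 f).
  move=> Hf; rewrite -S1s//; apply: le_trans (cauchy_schwarz (HL (S1H _ Hf)) (HL Hg)) _.
  by rewrite mulrAC ler_wpM2r ?nm_ge0 ?le.
have Kg : 0 <= K * nm g by rewrite mulr_ge0 ?nm_ge0.
have [h [Hh hK _ hE]] := riesz Kg (hs_0 hs) (hs_H hs) S2H S2l ll bd.
exists h; split=> //; apply: ip_eq; [exact: S2H|exact: S1H|] => k Hk.
by rewrite -S2s// hE.
Qed.

Section lift.
Variables (S : V -> V) (M : R).
Hypothesis SH : forall f, H f -> H (S f).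
Hypothesis Sl : linear_on H S.
Hypothesis SM : forall f, H f -> nm (S f) <= M * nm f.

Definition in_coker f := H f /\ forall k, H k -> S k = 0 -> ip f k = 0.

Lemma linear_onB f g : H f -> H g -> S (f - g) = S f - S g.
Proof. by move=> Hf Hg; have := Sl (-1) Hg Hf; rewrite !scaleN1r addrC [in RHS]addrC. Qed.

(** Subtract from [f] its projection on the kernel. The projection is a limit of kernel elements,
    and stays in the kernel because S is bounded. *)
Lemma lift_exists f : H f -> exists2 g, in_coker g & S g = S f.
Proof.
move=> Hf; have Lf := HL Hf; pose D k := H k /\ S k = 0.
have S0 : S 0 = 0 by rewrite -{1}(subrr f) linear_onB// subrr.
have D0 : D 0 by split=> //; exact: hs_0 hs.
have Dl c g k : D g -> D k -> D (c *: g + k).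
  move=> [Hg Sg] [Hk Sk]; split; first exact: (hs_H hs).
  by rewrite Sl// Sg Sk scaler0 addr0.
have lid : linear_on D id by [].
have ll c g k : D g -> D k -> ip (c *: g + k) f = c * ip g f + ip k f.
  by move=> [Hg _] [Hk _]; apply: (hs_lin hs) => //; exact: HL.
have bd g : D g -> cabs (ip g f) <= nm f * nm g.
  by move=> [Hg _]; rewrite mulrC; apply: cauchy_schwarz => //; exact: HL.
have [h [Hh _ [u Du uh] hE]] := riesz (nm_ge0 f) D0 Dl (fun g Dg => proj1 Dg) lid ll bd.
have Hu n : H (u n) := proj1 (Du n).
have Sh : S h = 0.
  apply/nm_eq0/eqP; first exact: SH.
  rewrite eq_le nm_ge0 andbT; apply/ler_addgt0Pl => e e0; rewrite addr0.
  have M1 : 0 < `|M| + 1 by rewrite ltr_wpDl.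
  have [N hN] := uh (e / (`|M| + 1)) (divr_gt0 e0 M1); have := hN N (leqnn N).
  rewrite ler_pdivlMr//; apply: le_trans.
  have := SM (HB (Hu N) Hh); rewrite linear_onB// (proj2 (Du N)) sub0r nmN; last exact/HL/SH.
  move=> /le_trans; apply; rewrite mulrC ler_wpM2l ?nm_ge0//.
  by have := ler_norm M; lra.
exists (f - h); last by rewrite linear_onB// Sh subr0.
split=> [|k Hk Sk]; first exact: HB.
have Lh := HL Hh; have Lk := HL Hk.
rewrite (hs_conj hs _ Lk); last exact: LB.
by rewrite ipBr// hE ?subrr ?conjc0.
Qed.

(** Pythagoras: g - f is in the kernel, hence orthogonal to [f]. *)
Lemma lift_min f g : in_coker f -> H g -> S f = S g -> nm f <= nm g.
Proof.
move=> [Hf fk] Hg e; have Lf := HL Hf; have Lg := HL Hg.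
have Hgf : H (g - f) by exact: HB.
have : ip f (g - f) = 0 by apply: fk => //; rewrite linear_onB// e subrr.
move=> o; rewrite -(ler_pXn2r (_ : 0 < 2)%N) ?nnegrE ?nm_ge0//.
have := nm_sqrD 1 Lf (HL Hgf); rewrite o scale1r addrC subrK => ->.
by rewrite cabs1 mulr0 /= mulr0 addr0 expr1n mul1r lerDl sqr_ge0.
Qed.

End lift.

End hilbert.

(** * Square-integrable functions on the disk *)

Section square_integrable_functions.
Variable R : realType.
Local Notation C := R[i].
Implicit Types (s t M e B : R) (f g h u : C -> C) (c z w : C).

Definition sq_int f := (dA R).-integrable (ball2 1) (EFin \o (fun p => cabs (f (cplx p)) ^+ 2)).

Lemma measurable_sq s f : cmeasurable s f ->
  measurable_fun (ball2 s) (fun p => cabs (f (cplx p)) ^+ 2).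
Proof. by move=> mf; apply: measurable_funX; exact: measurable_cabs. Qed.

Lemma square_integrableE f : square_integrable f <-> cmeasurable 1 f /\ sq_int f.
Proof.
rewrite /square_integrable disk2E; split=> [[m1 m2 fin]|[[m1 m2] /integrableP[_ fin]]].
  split=> //; apply/integrableP; split.
    by apply/measurable_EFinP; exact: (@measurable_sq 1 f).
  apply: le_lt_trans fin; apply: ge0_le_integral => //.
  - exact: measurable_ball2.
  - by apply: measurableT_comp => //; apply/measurable_EFinP; exact: (@measurable_sq 1 f).
  - by apply/measurable_EFinP; exact: (@measurable_sq 1 f).
  - by move=> p _ /=; rewrite lee_fin ger0_norm ?sqr_ge0.
split=> //; apply: le_lt_trans fin; apply: ge0_le_integral => //.
- exact: measurable_ball2.
- by move=> p _; rewrite lee_fin sqr_ge0.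
- by apply/measurable_EFinP; exact: (@measurable_sq 1 f).
- by apply: measurableT_comp => //; apply/measurable_EFinP; exact: (@measurable_sq 1 f).
- by move=> p _ /=; rewrite lee_fin ger0_norm ?sqr_ge0.
Qed.

Lemma integrable_le s (F G : plane R -> R) : measurable_fun (ball2 s) F ->
  (forall p, ball2 s p -> `|F p| <= G p) ->
  (dA R).-integrable (ball2 s) (EFin \o G) -> (dA R).-integrable (ball2 s) (EFin \o F).
Proof.
move=> mF FG; apply: le_integrable; [exact: measurable_ball2|exact/measurable_EFinP|].
move=> p ps /=; rewrite lee_fin; apply: le_trans (FG p ps) _; exact: ler_norm.
Qed.

Lemma cmeasurableZ s c f : cmeasurable s f -> cmeasurable s (fun z => c * f z).
Proof. by move=> mf; apply: cmeasurableM => //; exact: cmeasurable_cst. Qed.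

Lemma sq_intZ M f : sq_int f ->
  (dA R).-integrable (ball2 1) (EFin \o (fun p => M * cabs (f (cplx p)) ^+ 2)).
Proof. by move=> i; have := integrableZl (measurable_ball2 1) M i. Qed.

Lemma sq_intD (F G : plane R -> R) : (dA R).-integrable (ball2 1) (EFin \o F) ->
  (dA R).-integrable (ball2 1) (EFin \o G) ->
  (dA R).-integrable (ball2 1) (EFin \o (fun p => F p + G p)).
Proof. by move=> i j; have := integrableD (measurable_ball2 1) i j. Qed.

Lemma square_integrable_lin c f g : square_integrable f -> square_integrable g ->
  square_integrable (fun z => c * f z + g z).
Proof.
move=> /square_integrableE[mf f2] /square_integrableE[mg g2]; apply/square_integrableE.
have mh := cmeasurableD (cmeasurableZ c mf) mg; split=> //.
apply: integrable_le (sq_intD (sq_intZ (2 * cabs c ^+ 2) f2) (sq_intZ 2 g2)).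
  exact: (measurable_sq mh).
move=> p _; rewrite ger0_norm ?sqr_ge0//.
have := cabsD (c * f (cplx p)) (g (cplx p)); rewrite cabsM.
have := cabs_ge0 (c * f (cplx p) + g (cplx p)).
have := sqr_ge0 (cabs c * cabs (f (cplx p)) - cabs (g (cplx p))).
have := cabs_ge0 c; have := cabs_ge0 (f (cplx p)); have := cabs_ge0 (g (cplx p)).
move: (cabs _) (cabs (f _)) (cabs (g _)) (cabs c) => x y z w z0 y0 w0 s0 x0 le.
apply: (@le_trans _ _ ((w * y + z) ^+ 2)); first by rewrite lerXn2r ?nnegrE ?addr_ge0 ?mulr_ge0.
by nra.
Qed.

Lemma square_integrable_mul M u f : cmeasurable 1 u ->
  (forall z, cabs z < 1 -> cabs (u z) <= M) -> square_integrable f ->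
  square_integrable (fun z => u z * f z).
Proof.
move=> mu uM /square_integrableE[mf f2]; apply/square_integrableE.
have mh := cmeasurableM mu mf; split=> //.
apply: integrable_le (sq_intZ (M ^+ 2) f2); first exact: (measurable_sq mh).
move=> p p1; rewrite ger0_norm ?sqr_ge0// cabsM exprMn.
have M0 := le_trans (cabs_ge0 _) (uM _ p1).
by rewrite ler_wpM2r ?sqr_ge0// lerXn2r ?nnegrE ?cabs_ge0 ?uM.
Qed.

Lemma square_integrable_bounded M u : cmeasurable 1 u ->
  (forall z, cabs z < 1 -> cabs (u z) <= M) -> square_integrable u.
Proof.
move=> mu uM; apply/square_integrableE; split=> //.
apply: (@bounded_integrable _ _ _ (M ^+ 2)); first exact: (measurable_sq mu).
move=> p p1; rewrite ger0_norm ?sqr_ge0//; have M0 := le_trans (cabs_ge0 _) (uM _ p1).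
by rewrite lerXn2r ?nnegrE ?cabs_ge0 ?uM.
Qed.

Lemma square_integrable_prod f g : square_integrable f -> square_integrable g ->
  cintegrable 1 (fun z => f z * (g z)^*%C).
Proof.
move=> /square_integrableE[mf f2] /square_integrableE[mg g2].
have [m1 m2] := cmeasurableM mf (cmeasurable_conj mg).
have bd p : cabs (f (cplx p) * (g (cplx p))^*%C) <=
    1 * cabs (f (cplx p)) ^+ 2 + 1 * cabs (g (cplx p)) ^+ 2.
  rewrite cabsM cabs_conj; have := sqr_ge0 (cabs (f (cplx p)) - cabs (g (cplx p))).
  have := mulr_ge0 (cabs_ge0 (f (cplx p))) (cabs_ge0 (g (cplx p))); nra.
have i := sq_intD (sq_intZ 1 f2) (sq_intZ 1 g2).
split; apply: integrable_le i => // p _; apply: le_trans (bd p).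
- exact: normRe_le_cabs.
- exact: normIm_le_cabs.
Qed.

Lemma innerE f g : inner f g = cint 1 (fun z => f z * (g z)^*%C).
Proof. exact: cintegralE. Qed.

Lemma inner_lin c f g h : square_integrable f -> square_integrable g ->
  square_integrable h ->
  inner (fun z => c * f z + g z) h = c * inner f h + inner g h.
Proof.
move=> f2 g2 h2; rewrite !innerE.
have i := square_integrable_prod f2 h2; have j := square_integrable_prod g2 h2.
rewrite -cintZ// -cintD//; last exact: cintegrableZ.
by apply: eq_cint => z _; ring.
Qed.

Lemma inner_conj f g : square_integrable f -> square_integrable g ->
  inner f g = (inner g f)^*%C.
Proof.
move=> f2 g2; rewrite !innerE -cint_conj; last exact: square_integrable_prod.
by apply: eq_cint => z _; rewrite conjcM conjcK mulrC.
Qed.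

Lemma nrm2E s f : nrm2 s f = \int[dA R]_(p in ball2 s) cabs (f (cplx p)) ^+ 2.
Proof. by apply: eq_Rintegral => p _; rewrite conjM_cabs Re_real. Qed.

Lemma inner_nrm2 f : complex.Re (inner f f) = nrm2 1 f.
Proof. by rewrite innerE. Qed.

Lemma nrm2_ge0 s f : 0 <= nrm2 s f.
Proof. by rewrite nrm2E; apply: Rintegral_ge0 => p _; exact: sqr_ge0. Qed.

Lemma nrm2_EFin f : square_integrable f ->
  (\int[dA R]_(p in ball2 1) (cabs (f (cplx p)) ^+ 2)%:E = (nrm2 1 f)%:E)%E.
Proof.
move=> /square_integrableE[_ i]; rewrite nrm2E /Rintegral fineK//.
by apply: integrable_fin_num => //; exact: measurable_ball2.
Qed.

Lemma fatou_sq (g : nat -> C -> C) h B N : (forall n, square_integrable (g n)) ->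
  (forall z, cabs z < 1 -> ccvg (g ^~ z) (h z)) ->
  (forall n, (N <= n)%N -> nrm2 1 (g n) <= B) ->
  square_integrable h /\ nrm2 1 h <= B.
Proof.
move=> g2 gh gB.
have mg n : cmeasurable 1 (g n) by have /square_integrableE[] := g2 n.
have mh : cmeasurable 1 h by exact: cmeasurable_lim mg gh.
have mb := measurable_ball2 (1 : R).
have le : (\int[dA R]_(p in ball2 1) (cabs (h (cplx p)) ^+ 2)%:E <= B%:E)%E.
  (* The sequence is shifted by [N], as the norm bound holds only from there on. *)
  pose F n (p : plane R) : \bar R := (cabs (g (n + N)%N (cplx p)) ^+ 2)%:E.
  have mF n : measurable_fun (ball2 1) (F n).
    by apply/measurable_EFinP; exact: (measurable_sq (mg _)).
  have F0 n p : ball2 1 p -> (0 <= F n p)%E by rewrite lee_fin sqr_ge0.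
  have lF p : ball2 1 p -> limn_einf (F ^~ p) = (cabs (h (cplx p)) ^+ 2)%:E.
    move=> p1; apply: (cvg_limn_einf_sup _).1; apply: cvg_EFin; first exact: nearW.
    have hc : (fun n => cabs (g (n + N)%N (cplx p))) @ \oo --> cabs (h (cplx p)).
      apply/cvgrPdist_lt => e /(gh _ p1)[K hK]; exists K => // n /= Kn.
      have := hK (n + N)%N (leq_trans Kn (leq_addr _ _)); apply: le_lt_trans.
      have := cabsD (h (cplx p) - g (n + N)%N (cplx p)) (g (n + N)%N (cplx p)).
      have := cabsB (h (cplx p) - g (n + N)%N (cplx p)) (h (cplx p)).
      rewrite subrK addrAC subrr sub0r cabsN ler_norml; lra.
    exact: (cvgM hc hc).
  rewrite (eq_integral (fun p => limn_einf (F ^~ p))); last first.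
    by move=> p; rewrite inE => /lF ->.
  apply: le_trans (fatou _ mb mF F0) _.
  rewrite limn_einf_lim; apply: lime_le; first exact: is_cvg_einfs.
  apply: nearW => n; apply: (@le_trans _ _ (\int[dA R]_(p in ball2 1) F n p)%E).
    by apply: ereal_inf_lbound; exists n => /=.
  by rewrite /F nrm2_EFin// lee_fin gB// leq_addl.
have h2 : square_integrable h.
  split; [by have [] := mh; rewrite disk2E|by have [] := mh; rewrite disk2E|].
  by rewrite disk2E; apply: le_lt_trans le _; rewrite ltry.
by split=> //; rewrite -lee_fin -nrm2_EFin.
Qed.

End square_integrable_functions.

(** * Bessel's inequality and point evaluations on the Bergman space *)

Section bergman_space.
Variable R : realType.
Local Notation C := R[i].
Implicit Types (s t M e B : R) (f g h : C -> C) (c z w : C) (a : nat -> C) (p q : {poly C}).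

Lemma disk_series f : analytic_on (@disk R) f -> exists2 a,
  forall s, 0 < s -> s < 1 -> taylor f s a &
  forall z, cabs z < 1 -> ccvg (fun n => (psum a n).[z]) (f z).
Proof.
move=> fa; have [a ta] := disk_taylor fa; exists a => // z z1 e e0.
have s0 : 0 < (1 + cabs z) / 2 by have := cabs_ge0 z; lra.
have s1 : (1 + cabs z) / 2 < 1 by lra.
have zs : cabs z < (1 + cabs z) / 2 by lra.
have e2 : 0 < e / 2 by lra.
have [N hN] := taylor_cvg s0 (cabs_ge0 z) zs (analytic_disk_papprox fa s1) (ta _ s0 s1) e2.
by exists N => n /hN /(_ z (lexx _)) /le_lt_trans; apply; lra.
Qed.

Lemma analytic_measurable f : analytic_on (@disk R) f -> cmeasurable 1 f.
Proof.
move=> /disk_series[a _ cv]; apply: (@cmeasurable_lim _ 1 (fun n => horner (psum a n))) => //.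
by move=> n; exact: cmeasurable_horner.
Qed.

Lemma nrm2_le s f : s <= 1 -> square_integrable f -> nrm2 s f <= nrm2 1 f.
Proof.
move=> s1 f2; have /square_integrableE[mf i] := f2.
have sub : ball2 s `<=` @ball2 R 1 by move=> p /lt_le_trans; apply.
have le : (\int[dA R]_(p in ball2 s) (cabs (f (cplx p)) ^+ 2)%:E <= (nrm2 1 f)%:E)%E.
  rewrite -nrm2_EFin//; apply: ge0_subset_integral => //.
  - exact: measurable_ball2.
  - exact: measurable_ball2.
  - by apply/measurable_EFinP; exact: (measurable_sq mf).
  - by move=> p _; rewrite lee_fin sqr_ge0.
rewrite nrm2E /Rintegral -lee_fin fineK// ge0_fin_numE.
  by apply: le_lt_trans le _; rewrite ltry.
by apply: integral_ge0 => p _; rewrite lee_fin sqr_ge0.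
Qed.

Lemma Re_cint_cst s t : complex.Re (cint s (fun=> t%:C%C)) = t * m0 s.
Proof.
rewrite (@eq_cint _ s _ (fun=> t%:C%C * 1)); last by move=> z _; rewrite mulr1.
rewrite (@cintZ _ s t%:C%C (fun=> 1)); last exact: const_integrable.
by rewrite cReM Re_real [complex.Im _]/= mul0r subr0.
Qed.

(** Parseval's formula applies to a long partial sum, which is uniformly close to [f] on the disk of
    radius [s]. *)
Lemma bessel_radius f a s N : 0 < s -> s < 1 -> analytic_on (@disk R) f ->
  square_integrable f -> (forall s, 0 < s -> s < 1 -> taylor f s a) ->
  \sum_(k < N) cabs (a k) ^+ 2 * weight s k <= nrm2 1 f.
Proof.
move=> s0 s1 fa f2 ta; apply: le_trans (nrm2_le (ltW s1) f2).
have fs := analytic_disk_papprox fa s1.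
have [B B0 fB'] := papprox_bounded fs.
have fB z : cabs z < s -> cabs (f z) <= B by move=> zs; apply: fB'; rewrite subr0.
have ms := m0_gt0 s0; apply/ler_addgt0Pl => e e0.
have K0 : 0 < (2 * B + 1) * m0 s by rewrite mulr_gt0//; lra.
(* If |f| <= B and |f - P| <= d <= 1, then |P|^2 <= |f|^2 + d (2B + 1); the choice of [d] makes the
   integral of this excess at most [e]. *)
pose d := Num.min 1 (e / ((2 * B + 1) * m0 s)).
have d0 : 0 < d by rewrite /d lt_min ltr01 divr_gt0.
have d1 : d <= 1 by rewrite /d ge_min lexx.
have de : d * ((2 * B + 1) * m0 s) <= e by rewrite -ler_pdivlMr// /d ge_min lexx orbT.
have t1 : (1 + s) / 2 < 1 by lra.
have t0 : 0 < (1 + s) / 2 by lra.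
have st : s < (1 + s) / 2 by lra.
have [M0 hM] := taylor_cvg t0 (ltW s0) st (analytic_disk_papprox fa t1) (ta _ t0 t1) d0.
pose M := maxn M0 N; pose P := psum a M.
have fP z : cabs z < s -> cabs (f z - P.[z]) <= d.
  by move=> zs; apply: hM; [exact: leq_maxl|exact: ltW].
have w0 k : 0 <= weight s k :> R.
  by rewrite /weight divr_ge0// mulr_ge0 ?exprn_ge0// ltW.
have Pk k : (k < N)%N -> P`_k = a k.
  by move=> kN; rewrite coef_poly (leq_trans kN (leq_maxr _ _)).
have step1 : \sum_(k < N) cabs (a k) ^+ 2 * weight s k <=
    complex.Re (cint s (fun z => P.[z] * (P.[z])^*%C)).
  rewrite parseval_poly// Re_real.
  rewrite (eq_bigr (fun k : 'I_N => cabs P`_k ^+ 2 * weight s k)); last first.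
    by move=> k _; rewrite Pk.
  apply: (@sum_le_support _ (fun k => cabs P`_k ^+ 2 * weight s k)) => k.
    by rewrite mulr_ge0 ?sqr_ge0.
  by move=> Pk0; rewrite nth_default// cabs0 expr0n mul0r.
have mf : cmeasurable s f.
  have [m1 m2] := analytic_measurable fa.
  by split; apply: measurable_funS (measurable_ball2 1) _ _ => // p /lt_trans; apply.
have iff : cintegrable s (fun z => f z * (f z)^*%C).
  apply: (@bounded_cintegrable _ s _ (B * B)).
    by apply: cmeasurableM => //; exact: cmeasurable_conj.
  by move=> z zs; rewrite cabsM cabs_conj ler_pM ?cabs_ge0 ?fB.
have := Re_cint_le (horner_integrable s P P)
  (cintegrableD iff (const_integrable s (d * (2 * B + 1))%:C%C)).
rewrite cintD//; last exact: const_integrable.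
rewrite cReD Re_cint_cst -/(nrm2 s f) => step2; apply: le_trans step1 _.
apply: le_trans (step2 _) _.
  move=> z zs; rewrite !cReD !conjM_cabs !Re_real.
  have := fP z zs; have := fB z zs; have := cabs_ge0 (f z); have := cabs_ge0 P.[z].
  have := cabsB (f z) (f z - P.[z]); rewrite subKr; nra.
by rewrite addrC lerD2r -mulrA.
Qed.

(** Let s tend to 1 in [bessel_radius]. The factor [m0 s] is first bounded below by its value at
    1/2, and all powers of s by the lowest, so that the limit is taken in a monomial in s. *)
Lemma bessel f a N : analytic_on (@disk R) f ->
  square_integrable f -> (forall s, 0 < s -> s < 1 -> taylor f s a) ->
  \sum_(k < N) cabs (a k) ^+ 2 / k.+1%:R <= nrm2 1 f / m0 (2^-1 : R).
Proof.
move=> fa f2 ta; have h0 : (0 : R) < 2^-1 by rewrite invr_gt0.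
have c0 := m0_gt0 h0; rewrite ler_pdivlMr//.
set A := \sum_(k < N) _; have A0 : 0 <= A.
  by apply: sumr_ge0 => k _; rewrite divr_ge0 ?sqr_ge0.
have main s : 2^-1 <= s -> s < 1 -> A * m0 (2^-1 : R) * s ^+ N.*2 <= nrm2 1 f.
  move=> s2 s1; have s0 : 0 < s by exact: lt_le_trans s2.
  apply: le_trans (bessel_radius N s0 s1 fa f2 ta).
  rewrite /A !mulr_suml; apply: ler_sum => k _.
  have cs := m0_le s2.
  have sk : s ^+ N.*2 <= s ^+ k.*2.
    by rewrite ler_wiXn2l ?ltW// leq_double ltnW.
  have k0 : 0 <= k.+1%:R^-1 :> R by rewrite invr_ge0.
  rewrite /weight; move: (k.+1%:R^-1) k0 (m0 s) cs => u u0 ms cs.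
  have -> : cabs (a k) ^+ 2 * u * m0 2^-1 * s ^+ N.*2 =
    cabs (a k) ^+ 2 * u * (s ^+ N.*2 * m0 2^-1) by ring.
  have -> : cabs (a k) ^+ 2 * (s ^+ k.*2 * ms * u) = cabs (a k) ^+ 2 * u * (s ^+ k.*2 * ms).
    by ring.
  apply: ler_wpM2l; first by rewrite mulr_ge0 ?sqr_ge0.
  by apply: ler_pM => //; [rewrite exprn_ge0// ltW|exact: ltW].
have := @continuous_le_left R (fun s => A * m0 (2^-1 : R) * s ^+ N.*2) 1 (nrm2 1 f).
rewrite expr1n mulr1; apply => //.
  apply: continuousM; first exact: cst_continuous.
  exact: exprn_continuous.
move=> s s0 s1; have [s2|s2] := leP 2^-1 s; first exact: main.
apply: le_trans (main 2^-1 (lexx _) _); last lra.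
rewrite ler_wpM2l ?mulr_ge0 ?(ltW c0)// lerXn2r ?nnegrE ?(ltW h0)//; exact: ltW.
Qed.

Lemma sum_arith_geom_le (q : R) n : 0 <= q -> q < 1 ->
  \sum_(k < n) k.+1%:R * q ^+ k <= ((1 - q) ^+ 2)^-1.
Proof.
move=> q0 q1; have d0 : 0 < (1 - q) ^+ 2 by rewrite exprn_gt0// subr_gt0.
rewrite -(ler_pM2l d0) divff ?gt_eqF//.
have -> : (1 - q) ^+ 2 * (\sum_(k < n) k.+1%:R * q ^+ k) = 1 - q ^+ n * (1 + n%:R * (1 - q)).
  elim: n => [|n IH]; first by rewrite big_ord0 expr0; ring.
  have n1 : n.+1%:R = n%:R + 1 :> R by rewrite natr1.
  by rewrite big_ord_recr/= mulrDr IH n1 (exprS q n); ring.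
rewrite gerBl mulr_ge0 ?exprn_ge0// addr_ge0// mulr_ge0//; lra.
Qed.

(** Bessel's inequality bounds |a_k| by sqrt(k+1), here relaxed to k+1, times the norm; the series
    of (k+1) s^k sums to (1 - s)^(-2). *)
Lemma eval_bound s : 0 <= s -> s < 1 -> exists2 K, 0 < K & forall f z,
  analytic_on (@disk R) f -> square_integrable f -> cabs z <= s ->
  cabs (f z) <= K * Num.sqrt (nrm2 1 f).
Proof.
move=> s0 s1; have h0 : (0 : R) < 2^-1 by rewrite invr_gt0.
have c0 := m0_gt0 h0; set c := m0 _ in c0.
have r0 : 0 < Num.sqrt c by rewrite sqrtr_gt0.
have d0 : 0 < ((1 - s) ^+ 2)^-1 by rewrite invr_gt0 exprn_gt0// subr_gt0.
exists (((1 - s) ^+ 2)^-1 / Num.sqrt c) => [|f z fa f2 zs]; first by rewrite divr_gt0.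
have [a ta cv] := disk_series fa; have z1 := le_lt_trans zs s1.
apply: (cabs_limit_le (N := 0) (cv z z1)) => n _.
have ak k : cabs (a k) <= k.+1%:R * (Num.sqrt (nrm2 1 f) / Num.sqrt c).
  have := bessel k.+1 fa f2 ta; rewrite -/c big_ord_recr/=.
  have : 0 <= \sum_(i < k) cabs (a i) ^+ 2 / i.+1%:R.
    by apply: sumr_ge0 => i _; rewrite divr_ge0 ?sqr_ge0.
  move=> S0 le; have {}le : cabs (a k) ^+ 2 / k.+1%:R <= nrm2 1 f / c.
    by apply: le_trans le; rewrite lerDr.
  rewrite -(ler_pXn2r (_ : 0 < 2)%N) ?nnegrE ?cabs_ge0 ?mulr_ge0 ?divr_ge0 ?sqrtr_ge0//.
  rewrite exprMn expr_div_n !sqr_sqrtr ?nrm2_ge0 ?(ltW c0)//.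
  move: le; rewrite ler_pdivrMr ?ltr0n// => /le_trans; apply.
  rewrite mulrC ler_wpM2r ?divr_ge0 ?nrm2_ge0 ?(ltW c0)//.
  by rewrite expr2 ler_peMr ?ler0n// ler1n.
rewrite psumE; apply: le_trans (cabs_sum _ _ _) _.
have q := sum_arith_geom_le n s0 s1.
have P0 : 0 <= Num.sqrt (nrm2 1 f) / Num.sqrt c by rewrite divr_ge0 ?sqrtr_ge0.
rewrite mulrAC -mulrA; apply: le_trans (ler_wpM2r P0 q).
rewrite mulr_suml; apply: ler_sum => k _; rewrite cabsM cabsX mulrAC.
apply: ler_pM; rewrite ?cabs_ge0 ?exprn_ge0 ?cabs_ge0 ?ak//.
by rewrite lerXn2r ?nnegrE ?cabs_ge0.
Qed.

End bergman_space.

(** * Completeness of the Bergman space and density of polynomials *)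

Section bergman_hilbert.
Variable R : realType.
Local Notation C := R[i].
Local Notation V := (R[i] -> R[i]^o).
Implicit Types (s t M e B : R) (f g h : C -> C) (c z w : C) (a : nat -> C) (p q : {poly C}).

Lemma not_diskE z : ~ disk z <-> 1 <= cabs z.
Proof. by rewrite diskE leNgt; split=> /negP. Qed.

(** The normal form demanded by [bergman]: polynomials and products enter the space only after
    it. *)
Definition restr f : C -> C := fun z => if cabs z < 1 then f z else 0.

Lemma restrE f z : cabs z < 1 -> restr f z = f z.
Proof. by rewrite /restr => ->. Qed.

Lemma analytic_ext f g : (forall z, cabs z < 1 -> f z = g z) ->
  analytic_on (@disk R) f -> analytic_on (@disk R) g.
Proof.
move=> fg /analytic_diskP fa; apply/analytic_diskP => s s1.
apply: papprox_ext (fa s s1) => z; rewrite subr0 => zs; apply: fg; exact: lt_trans s1.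
Qed.

Lemma square_integrable_ext f g : (forall z, cabs z < 1 -> f z = g z) ->
  square_integrable f -> square_integrable g.
Proof.
move=> fg; rewrite /square_integrable disk2E => -[m1 m2 i]; split.
- by apply: eq_measurable_fun m1 => p; rewrite inE => /fg ->.
- by apply: eq_measurable_fun m2 => p; rewrite inE => /fg ->.
- rewrite (eq_integral (fun x => ((complex.Re `|f (cplx x)|) ^+ 2)%:E))//.
  by move=> p; rewrite inE => /fg ->.
Qed.

Lemma inner_ext f g h k : (forall z, cabs z < 1 -> f z = g z) ->
  (forall z, cabs z < 1 -> h z = k z) -> inner f h = inner g k.
Proof. by move=> fg hk; rewrite !innerE; apply: eq_cint => z z1; rewrite fg// hk. Qed.

Lemma restr_bergman f : analytic_on (@disk R) f -> square_integrable f -> bergman (restr f).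
Proof.
move=> fa f2; split.
- by apply: analytic_ext fa => z z1; rewrite restrE.
- by apply: square_integrable_ext f2 => z z1; rewrite restrE.
- by move=> z /not_diskE z1; rewrite /restr ltNge z1.
Qed.

Lemma hnormE f : hnorm (@inner R : V -> V -> C) f = Num.sqrt (nrm2 1 f).
Proof. by rewrite /hnorm inner_nrm2. Qed.

Lemma analytic_lin c f g : analytic_on (@disk R) f -> analytic_on (@disk R) g ->
  analytic_on (@disk R) (fun z => c * f z + g z).
Proof.
move=> /analytic_diskP fa /analytic_diskP ga; apply/analytic_diskP => s s1.
by apply: papproxD; [apply: papproxZ; exact: fa|exact: ga].
Qed.

Lemma analytic_mul f g : analytic_on (@disk R) f -> analytic_on (@disk R) g ->
  analytic_on (@disk R) (fun z => f z * g z).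
Proof.
move=> /analytic_diskP fa /analytic_diskP ga; apply/analytic_diskP => s s1.
by apply: papproxM; [exact: fa|exact: ga].
Qed.

Lemma analytic_horner p : analytic_on (@disk R) (horner p).
Proof. by apply/analytic_diskP => s _; exact: papprox_poly. Qed.

Lemma square_integrable_horner p : square_integrable (horner p).
Proof.
have [M _ hM] := horner_bounded p 1.
by apply: (@square_integrable_bounded R M); [exact: cmeasurable_horner|move=> z /ltW /hM].
Qed.

Lemma bergman_lin c f g : bergman f -> bergman g -> bergman (fun z => c * f z + g z).
Proof.
move=> [fa f2 f0] [ga g2 g0]; split.
- exact: analytic_lin.
- exact: square_integrable_lin.
- by move=> z zd; rewrite f0// g0// mulr0 addr0.
Qed.

Lemma bergman0 : bergman (fun=> 0 : C).
Proof.
have e z : horner (0 : {poly C}) z = 0 by rewrite horner0.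
split=> //.
- by apply: analytic_ext (analytic_horner 0) => z _.
- by apply: square_integrable_ext (square_integrable_horner 0) => z _.
Qed.

(** Bounded point evaluations turn norm-Cauchy into uniformly Cauchy on smaller disks, so the
    pointwise limit is analytic; Fatou's lemma applied to u m - u n as m grows gives convergence in
    norm. *)
Lemma bergman_complete (u : nat -> V) : (forall n, bergman (u n)) ->
  (forall e, 0 < e -> exists N, forall n m, (N <= n)%N -> (N <= m)%N ->
     hnorm (@inner R : V -> V -> C) (u n - u m) <= e) ->
  exists2 l : V, bergman l & hcvg (@inner R : V -> V -> C) u l.
Proof.
move=> bu cau.
have bB n m : bergman (fun z => u n z - u m z).
  have := bergman_lin (-1) (bu m) (bu n); congr bergman; apply/funext => z.
  by rewrite mulN1r addrC.
have unif s e : 0 <= s -> s < 1 -> 0 < e -> exists N, forall n m, (N <= n)%N -> (N <= m)%N ->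
    forall z, cabs z <= s -> cabs (u n z - u m z) <= e.
  move=> s0 s1 e0; have [K K0 hK] := eval_bound s0 s1.
  have [N hN] := cau (e / K) (divr_gt0 e0 K0); exists N => n m Nn Nm z zs.
  have [ba b2 _] := bB n m; apply: le_trans (hK _ _ ba b2 zs) _.
  by have := hN n m Nn Nm; rewrite hnormE ler_pdivlMr// mulrC.
have /choice[l0 hl0] : forall z, exists l, cabs z < 1 -> ccvg (u ^~ z) l.
  move=> z; have [z1|z1] := ltP (cabs z) 1; last by exists 0.
  have [e e0|l hl] := @ccauchy_cvg R (u ^~ z); last by exists l.
  have [N hN] := unif _ e (cabs_ge0 z) z1 e0; exists N => n m Nn Nm; exact: hN.
pose l := restr l0.
have hl z : cabs z < 1 -> ccvg (u ^~ z) (l z).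
  by move=> z1; rewrite /l restrE//; exact: hl0.
have ul s e : 0 <= s -> s < 1 -> 0 < e -> exists N, forall n, (N <= n)%N ->
    forall z, cabs z <= s -> cabs (l z - u n z) <= e.
  move=> s0 s1 e0; have [N hN] := unif s e s0 s1 e0; exists N => n Nn z zs.
  apply: (@cabs_limit_le _ (fun m => u m z - u n z) _ _ N) => [d d0|m Nm]; last exact: hN.
  have [N' hN'] := hl z (le_lt_trans zs s1) d d0; exists N' => m /hN'.
  by congr (cabs _ < _); ring.
have la : analytic_on (@disk R) l.
  apply/analytic_diskP => s s1; apply: papprox_lim => e e0.
  have t0 : 0 <= Num.max s 0 by rewrite le_max lexx orbT.
  have t1 : Num.max s 0 < 1 by rewrite gt_max s1 ltr01.
  have [N hN] := ul _ _ t0 t1 e0; exists (u N).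
    by apply: analytic_disk_papprox => //; have [] := bu N.
  by move=> z; rewrite subr0 => zs; apply: hN => //; rewrite le_max ltW.
have close e : 0 < e -> exists N, forall n, (N <= n)%N ->
    square_integrable (fun z => l z - u n z) /\ nrm2 1 (fun z => l z - u n z) <= e ^+ 2.
  move=> e0; have [N hN] := cau e e0; exists N => n Nn.
  apply: (@fatou_sq R (fun m z => u m z - u n z) _ _ N).
  - by move=> m; have [] := bB m n.
  - move=> z z1 d d0; have [N' hN'] := hl z z1 d d0; exists N' => m /hN'.
    by congr (cabs _ < _); ring.
  - move=> m Nm; have := hN m n Nm Nn; rewrite hnormE.
    by rewrite -(ler_pXn2r (_ : 0 < 2)%N) ?nnegrE ?sqrtr_ge0 ?(ltW e0)// sqr_sqrtr ?nrm2_ge0.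
have l2 : square_integrable l.
  have [N hN] := close 1 ltr01; have [d2 _] := hN N (leqnn N).
  have [_ u2 _] := bu N; apply: square_integrable_ext (square_integrable_lin 1 d2 u2).
  by move=> z _; rewrite mul1r subrK.
exists l.
  by split=> // z /not_diskE z1; rewrite /l /restr ltNge z1.
move=> e e0; have [N hN] := close e e0; exists N => n Nn.
have [_ le] := hN n Nn; rewrite hnormE.
have -> : nrm2 1 (u n - l) = nrm2 1 (fun z => l z - u n z).
  rewrite !nrm2E; apply: eq_Rintegral => p _; congr (_ ^+ 2); exact: cabsC.
by rewrite -(ler_pXn2r (_ : 0 < 2)%N) ?nnegrE ?sqrtr_ge0 ?(ltW e0)// sqr_sqrtr ?nrm2_ge0.
Qed.

Lemma bergman_hspace : @hspace R V (@square_integrable R) (@bergman R) (@inner R).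
Proof.
split.
- exact: square_integrable_lin.
- exact: bergman_lin.
- exact: bergman0.
- by move=> f [].
- exact: inner_lin.
- exact: inner_conj.
- by move=> f _; rewrite inner_nrm2 nrm2_ge0.
- move=> f [fa f2 f0] n0; apply/funext => z; have [z1|z1] := ltP (cabs z) 1; last first.
    by rewrite f0//; apply/not_diskE.
  have [K K0 hK] := eval_bound (cabs_ge0 z) z1.
  have := hK f z fa f2 (lexx _); rewrite -inner_nrm2 n0 sqrtr0 mulr0 => h.
  by apply/cabs0_eq0/eqP; rewrite eq_le h cabs_ge0.
- exact: bergman_complete.
Qed.

(** Taylor polynomials suffice: by Parseval the norms of their differences are tails of the series
    that Bessel's inequality makes convergent, and Fatou passes to [f]. *)
Lemma bergman_dense f e : bergman f -> 0 < e -> exists p,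
  nrm2 1 (fun z => f z - p.[z]) <= e.
Proof.
move=> [fa f2 _] e0; have [a ta cv] := disk_series fa.
have h1 : (0 : R) < 1 by [].
have m1 := m0_gt0 h1.
pose b k := cabs (a k) ^+ 2 / k.+1%:R.
have b0 k : 0 <= b k by rewrite divr_ge0 ?sqr_ge0.
pose S n := \sum_(k < n) b k.
have Sinc : nondecreasing_seq S.
  by apply/nondecreasing_seqP => n; rewrite /S big_ord_recr/= lerDl.
have Scv : cvgn S.
  apply: nondecreasing_is_cvgn => //; exists (nrm2 1 f / m0 (2^-1 : R)) => _ [n _ <-].
  exact: bessel.
have eM : 0 < e / m0 (1 : R) by rewrite divr_gt0.
have /cvgrPdist_le /(_ _ eM)[N _ hN] := Scv.
exists (psum a N).
have tail m : (N <= m)%N -> S m - S N <= e / m0 (1 : R).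
  move=> Nm; have := hN N (leqnn N).
  have := nondecreasing_cvgn_le Sinc Scv m; have := nondecreasing_cvgn_le Sinc Scv N.
  by move=> h2 h3; rewrite /= ger0_norm ?subr_ge0//; lra.
pose g m z := (psum a m).[z] - (psum a N).[z].
have gE m z : g m z = (psum a m - psum a N).[z] by rewrite hornerD hornerN.
have [||m Nm|//] := @fatou_sq R g (fun z => f z - (psum a N).[z]) e N.
- move=> m; apply: square_integrable_ext (square_integrable_horner (psum a m - psum a N)).
  by move=> z _; rewrite gE.
- move=> z z1 d d0; have [K hK] := cv z z1 d d0; exists K => m /hK.
  by rewrite /g; congr (cabs _ < _); ring.
- have -> : g m = horner (psum a m - psum a N) by apply/funext => z; rewrite gE.
  rewrite /nrm2 parseval_poly// Re_real.
  have cf k : (psum a m - psum a N)`_k = if (N <= k < m)%N then a k else 0.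
    rewrite coefB !coef_poly; case: (ltnP k m) => km; case: (ltnP k N) => kN //=.
    - by rewrite subrr.
    - by rewrite subr0.
    - by have := leq_ltn_trans km kN; rewrite ltnNge Nm.
    - by rewrite subr0.
  apply: (@le_trans _ _ (\sum_(k < m) cabs (psum a m - psum a N)`_k ^+ 2 * weight (1 : R) k)).
    apply: (@sum_le_support R (fun k => cabs (psum a m - psum a N)`_k ^+ 2 * weight (1 : R) k)).
      by move=> k; rewrite mulr_ge0 ?sqr_ge0// /weight expr1n mul1r divr_ge0// ltW.
    move=> k mk; rewrite cf [(k < m)%N]ltnNge mk andbF cabs0 expr0n mul0r//.
  have := tail m Nm; rewrite ler_pdivlMr//; apply: le_trans.
  rewrite (eq_bigr (fun k : 'I_m => (if (N <= k)%N then b k else 0) * m0 (1 : R))); last first.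
    move=> k _; rewrite cf ltn_ord andbT /weight expr1n mul1r /b.
    case: ifP => _; first by rewrite mulrA mulrAC.
    by rewrite cabs0 expr0n !mul0r.
  rewrite /S -mulr_suml ler_wpM2r ?(ltW m1)//.
  rewrite -(subnKC Nm) !big_split_ord/= addrAC subrr add0r.
  rewrite big1 ?add0r; last by move=> k _; rewrite leqNgt ltn_ord.
  by apply: ler_sum => k _; rewrite leq_addr.
Qed.

End bergman_hilbert.

(** * Approximation of bounded analytic multipliers by polynomials *)

Section bounded_multipliers.
Variable R : realType.
Local Notation C := R[i].
Local Notation V := (R[i] -> R[i]^o).
Local Notation N := (hnorm (@inner R : V -> V -> C)).
Local Notation L2 := (@square_integrable R).
Implicit Types (s t M e B : R) (b f g h k u : C -> C) (c z w : C) (p q : {poly C}).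
Let hs := @bergman_hspace R.

Lemma horner_close p z e : 0 < e -> exists2 d, 0 < d &
  forall w, cabs (w - z) < d -> cabs (p.[w] - p.[z]) <= e.
Proof.
move=> e0; have /factor_theorem[q qE] : root (p - p.[z]%:P) z.
  by rewrite /root !hornerE subrr.
have [M M0 hM] := horner_bounded_ball q z 1.
exists (Num.min 1 (e / M)) => [|w]; first by rewrite lt_min ltr01 divr_gt0.
rewrite lt_min => /andP[w1 we].
have -> : p.[w] - p.[z] = q.[w] * (w - z).
  by have := congr1 (horner^~ w) qE; rewrite !hornerE.
rewrite cabsM; have := hM w w1; move: we; rewrite ltr_pdivlMr//.
have := cabs_ge0 (w - z); have := cabs_ge0 q.[w]; nra.
Qed.

Lemma analytic_close b z e : analytic_on (@disk R) b -> cabs z < 1 -> 0 < e ->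
  exists2 d, 0 < d & forall w, cabs (w - z) < d -> cabs (b w - b z) <= e.
Proof.
move=> ba z1 e0; have s1 : (1 + cabs z) / 2 < 1 by lra.
have e3 : 0 < e / 3 by lra.
have [p hp] := analytic_disk_papprox ba s1 e3.
have [d d0 hd] := horner_close p z e3.
exists (Num.min d ((1 - cabs z) / 2)) => [|w]; first by rewrite lt_min d0/=; lra.
rewrite lt_min => /andP[wd wz].
have ws : cabs w < (1 + cabs z) / 2 by have := cabsD (w - z) z; rewrite subrK; lra.
have := hp w; rewrite subr0 => /(_ ws) h1.
have := hp z; rewrite subr0 => /(_ ltac:(lra)) h2; have h3 := hd w wd.
have -> : b w - b z = (b w - p.[w]) + (p.[w] - p.[z]) - (b z - p.[z]) by ring.
have := cabsB (b w - p.[w] + (p.[w] - p.[z])) (b z - p.[z]).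
have := cabsD (b w - p.[w]) (p.[w] - p.[z]); lra.
Qed.

(* Dilate to make the approximation uniform on the disk, then normalize. *)
Lemma contraction_approx b : analytic_on (@disk R) b ->
  (forall z, cabs z < 1 -> cabs (b z) <= 1) ->
  exists2 p : nat -> {poly C}, forall n z, cabs z < 1 -> cabs (p n).[z] <= 1 &
    forall z, cabs z < 1 -> ccvg (fun n => (p n).[z]) (b z).
Proof.
move=> ba b1; have [v v0 vs] := null_sequence R.
have v1 n : 0 < 1 + v n by have := v0 n; lra.
(* One number in two roles: the dilation factor, and the normalizer of [q n], whose modulus is at
   most 1 + v n. *)
pose s n := (1 + v n)^-1.
have s0 n : 0 < s n by rewrite invr_gt0.
have s1 n : s n < 1 by rewrite invf_lt1//; have := v0 n; lra.
have sz n z : cabs z < 1 -> cabs ((s n)%:C%C * z) < s n.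
  by move=> z1; rewrite cabsM cabsR ger0_norm ?(ltW (s0 n))// gtr_pMr.
have /choice[q hq] : forall n, exists q : {poly C}, forall z, cabs z < 1 ->
    cabs (b ((s n)%:C%C * z) - q.[z]) <= v n.
  move=> n; have bs : papprox (fun z => b ((s n)%:C%C * z + 0)) 0 1.
    apply: papprox_affine (analytic_disk_papprox ba (s1 n)) => z.
    by rewrite subr0 addr0; exact: sz.
  by have [q hq] := bs _ (v0 n); exists q => z z1; have := hq z; rewrite subr0 addr0; apply.
have q1 n z : cabs z < 1 -> cabs (q n).[z] <= 1 + v n.
  move=> z1; have bz := b1 _ (lt_trans (sz n z z1) (s1 n)).
  have := cabsB (b ((s n)%:C%C * z)) (b ((s n)%:C%C * z) - (q n).[z]).
  by rewrite subKr; have := hq n z z1; lra.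
exists (fun n => (s n)%:C%C *: q n) => [n z z1|z z1 e e0].
  rewrite hornerZ cabsM cabsR ger0_norm ?(ltW (s0 n))// /s mulrC ler_pdivrMr// mul1r.
  exact: q1.
have e3 : 0 < e / 4 by lra.
have [d d0 hd] := analytic_close ba z1 e3.
have m0 : 0 < Num.min (d / 2) (e / 4) by rewrite lt_min e3 andbT; lra.
have [K hK] := vs _ m0; exists K => n /hK; rewrite le_min => /andP[vd ve].
have sv : 1 - s n <= v n.
  have : (1 - s n) * (1 + v n) = v n by rewrite mulrBl mulVf ?gt_eqF//; ring.
  have := s1 n; have := v0 n; nra.
have szd : cabs ((s n)%:C%C * z - z) < d.
  have -> : (s n)%:C%C * z - z = - ((1 - s n)%:C%C * z) by rewrite rmorphB rmorph1; ring.
  rewrite cabsN cabsM cabsR ger0_norm; last by rewrite subr_ge0 ltW.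
  have := cabs_ge0 z; have := s1 n; nra.
have h1 := hd _ szd; have h2 := hq n z z1; have h3 := q1 n z z1.
rewrite hornerZ; set B := b _ in h1 h2 *; set Q := (q n).[z] in h2 h3 *.
have h4 : cabs (Q - (s n)%:C%C * Q) <= v n.
  have -> : Q - (s n)%:C%C * Q = (1 - s n)%:C%C * Q by rewrite rmorphB rmorph1; ring.
  rewrite cabsM cabsR ger0_norm; last by rewrite subr_ge0 ltW.
  have <- : (1 - s n) * (1 + v n) = v n by rewrite mulrBl mulVf ?gt_eqF//; ring.
  by rewrite ler_wpM2l// subr_ge0 ltW.
have -> : b z - (s n)%:C%C * Q = (B - Q) + (Q - (s n)%:C%C * Q) - (B - b z) by ring.
have := cabsB (B - Q + (Q - (s n)%:C%C * Q)) (B - b z).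
have := cabsD (B - Q) (Q - (s n)%:C%C * Q); lra.
Qed.

Lemma dct (F : nat -> plane R -> R) (G H : plane R -> R) :
  (forall n, measurable_fun (ball2 1) (F n)) ->
  (forall x, ball2 1 x -> (fun n => F n x) @ \oo --> G x) ->
  (dA R).-integrable (ball2 1) (EFin \o H) ->
  (forall n x, ball2 1 x -> `|F n x| <= H x) ->
  (fun n => \int[dA R]_(x in ball2 1) F n x) @ \oo --> \int[dA R]_(x in ball2 1) G x.
Proof.
move=> mF FG iH FH; have mb := measurable_ball2 (1 : R).
have iG : (dA R).-integrable (ball2 1) (EFin \o G).
  apply: (integrable_le _ _ iH); first exact: measurable_fun_cvg mF FG.
  move=> x x1; have := FG x x1 => /cvg_norm /cvg_lim <-//; apply: limr_le.
    by apply/cvg_ex; exists `|G x|; apply: cvg_norm; exact: FG.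
  by apply: nearW => n; exact: FH.
apply: fine_cvg; rewrite fineK; last exact: integrable_fin_num.
apply: (@dominated_cvg _ _ _ _ _ mb _ _ (EFin \o H)) => //.
- by move=> n; apply/measurable_EFinP.
- by move=> x x1; apply: cvg_EFin; [exact: nearW|exact: FG].
Qed.

Lemma nrm2_mono f g : L2 f -> L2 g ->
  (forall z, cabs z < 1 -> cabs (f z) <= cabs (g z)) -> nrm2 1 f <= nrm2 1 g.
Proof.
move=> /square_integrableE[_ f2] /square_integrableE[_ g2] fg; rewrite !nrm2E.
apply: le_Rintegral => //; first exact: measurable_ball2.
by move=> x x1; rewrite lerXn2r ?nnegrE ?cabs_ge0 ?fg.
Qed.

(** Pointwise convergence of contractive polynomials, with 4 |f|^2 as dominating function. *)
Lemma contraction_approx_L2 b f e : analytic_on (@disk R) b ->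
  (forall z, cabs z < 1 -> cabs (b z) <= 1) -> L2 f -> 0 < e ->
  exists2 p, forall z, cabs z < 1 -> cabs p.[z] <= 1 &
    nrm2 1 (fun z => (b z - p.[z]) * f z) <= e.
Proof.
move=> ba b1 f2 e0; have [p p1 pb] := contraction_approx ba b1.
have /square_integrableE[mf i] := f2.
have mbp n : cmeasurable 1 (fun z => (b z - (p n).[z]) * f z).
  apply: cmeasurableM => //; apply: cmeasurableD; first exact: analytic_measurable.
  have -> : (fun z => - (p n).[z]) = horner (- p n) by apply/funext => z; rewrite hornerN.
  exact: cmeasurable_horner.
have : (fun n => \int[dA R]_(x in ball2 1)
    cabs ((b (cplx x) - (p n).[cplx x]) * f (cplx x)) ^+ 2) @ \oo -->
    \int[dA R]_(x in ball2 1) (0 : R).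
  apply: (dct (fun n => measurable_sq (mbp n)) _ (sq_intZ 4 i)).
- move=> x x1; apply/cvgrPdist_le => d d0.
  have K0 : 0 < cabs (f (cplx x)) ^+ 2 + d + 1 by have := sqr_ge0 (cabs (f (cplx x))); lra.
  have d1 : 0 < Num.min 1 (d / (cabs (f (cplx x)) ^+ 2 + d + 1)).
    by rewrite lt_min ltr01 divr_gt0.
  have [M hM] := pb _ x1 _ d1; exists M => // n /= /hM; rewrite lt_min => /andP[h1 h2].
  rewrite sub0r normrN ger0_norm ?sqr_ge0// cabsM exprMn.
  move: h2; rewrite ltr_pdivlMr//.
  have := cabs_ge0 (b (cplx x) - (p n).[cplx x]); have := sqr_ge0 (cabs (f (cplx x))).
  move: (cabs (f _) ^+ 2) (cabs _) h1 => y t h1 y0 t0 h2.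
  have : t ^+ 2 <= t by rewrite expr2 ler_piMl// ltW.
  nra.
- move=> n x x1 /=; rewrite ger0_norm ?sqr_ge0// cabsM exprMn ler_wpM2r ?sqr_ge0//.
  have := cabsB (b (cplx x)) (p n).[cplx x]; have := b1 _ x1; have := p1 n _ x1.
  have := cabs_ge0 (b (cplx x) - (p n).[cplx x]); nra.
rewrite {2}/Rintegral integral0 => /cvgrPdist_le /(_ _ e0)[M _ hM].
exists (p M); first exact: p1.
rewrite nrm2E; have := hM M (leqnn M).
rewrite /= sub0r normrN ger0_norm//.
by apply: Rintegral_ge0 => x _; exact: sqr_ge0.
Qed.

End bounded_multipliers.

(** * The Hankel estimate for general symbols *)

Section toeplitz_operators.
Variable R : realType.
Local Notation C := R[i].
Local Notation V := (R[i] -> R[i]^o).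
Local Notation N := (hnorm (@inner R : V -> V -> C)).
Local Notation L2 := (@square_integrable R).
Implicit Types (s t M e B : R) (b f g h k u w : C -> C) (c z : C) (p q : {poly C}).
Let hs := @bergman_hspace R.

Lemma L2B f g : L2 f -> L2 g -> L2 (fun z => f z - g z).
Proof.
move=> f2 g2; apply: square_integrable_ext (square_integrable_lin (-1) g2 f2) => z _.
by rewrite mulN1r addrC.
Qed.

Lemma N_sqr f : N f ^+ 2 = nrm2 1 f.
Proof. by rewrite hnormE sqr_sqrtr// nrm2_ge0. Qed.

Lemma N_mono f g : L2 f -> L2 g ->
  (forall z, cabs z < 1 -> cabs (f z) <= cabs (g z)) -> N f <= N g.
Proof. by move=> f2 g2 fg; rewrite !hnormE ler_wsqrtr// nrm2_mono. Qed.

Lemma N_triangle f g : L2 f -> L2 g -> N (fun z => f z + g z) <= N f + N g.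
Proof. by move=> f2 g2; exact: (nm_triangle hs). Qed.

Lemma N_ext f g : (forall z, cabs z < 1 -> f z = g z) -> N f = N g.
Proof. by move=> fg; rewrite /hnorm (@inner_ext _ f g f g). Qed.

Lemma N_dist f g : L2 f -> L2 g -> N f <= N (fun z => f z - g z) + N g.
Proof.
move=> f2 g2; rewrite [leLHS](@N_ext f (fun z => (f z - g z) + g z)).
  exact: N_triangle (L2B f2 g2) g2.
by move=> z _; rewrite subrK.
Qed.

Lemma proj_min f g h : L2 f -> bergman g ->
  (forall k, bergman k -> inner (fun z => f z - g z) k = 0) -> bergman h ->
  nrm2 1 (fun z => f z - g z) <= nrm2 1 (fun z => f z - h z).
Proof.
move=> f2 bg o bh; have [_ g2 _] := bg; have [_ h2 _] := bh.
have bk : bergman (fun z => g z - h z).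
  have := bergman_lin (-1) bh bg; congr bergman; apply/funext => z.
  by rewrite mulN1r addrC.
have [_ k2 _] := bk.
rewrite -!N_sqr [X in _ <= X ^+ 2](@N_ext _ (fun z => 1 * (f z - g z) + (g z - h z))); last first.
  by move=> z _; rewrite mul1r addrA subrK.
have := nm_sqrD hs 1 (L2B f2 g2) k2; rewrite (o _ bk) cabs1 expr1n mul1r mulr0 mulr0 addr0.
by move=> e; rewrite -[X in _ <= X]/(N (1 *: (fun z => f z - g z : R[i]^o) +
  (fun z => g z - h z : R[i]^o)) ^+ 2) e lerDl sqr_ge0.
Qed.

(** Splits u f - w g as (u - w) f + w (f - g). *)
Lemma multiplier_dist u w f g e : cmeasurable 1 u -> cmeasurable 1 w -> L2 f -> L2 g ->
  (forall z, cabs z < 1 -> cabs (u z) <= 1) ->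
  (forall z, cabs z < 1 -> cabs (w z) <= 1) ->
  N (fun z => (u z - w z) * f z) <= e -> N (fun z => f z - g z) <= e ->
  N (fun z => u z * f z - w z * g z) <= e + e.
Proof.
move=> mu mw f2 g2 u1 w1 h1 h2.
have muw : cmeasurable 1 (fun z => u z - w z).
  have := cmeasurableD mu (cmeasurableZ (-1) mw).
  by congr cmeasurable; apply/funext => z; rewrite mulN1r.
have a2 : L2 (fun z => (u z - w z) * f z).
  apply: (@square_integrable_mul R 2) => // z z1.
  by have := cabsB (u z) (w z); have := u1 z z1; have := w1 z z1; lra.
have d2 := L2B f2 g2.
have b2 : L2 (fun z => w z * (f z - g z)) by exact: (square_integrable_mul mw w1).
rewrite [leLHS](@N_ext _ (fun z => (u z - w z) * f z + w z * (f z - g z))); last first.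
  by move=> z _; ring.
apply: le_trans (N_triangle a2 b2) _; apply: lerD => //; apply: le_trans h2.
by apply: N_mono => // z z1; rewrite cabsM ler_piMl ?cabs_ge0 ?w1.
Qed.

Lemma contraction_defect p q :
  complex.Re (cint 1 (fun z => (1 - cabs p.[z] ^+ 2)%:C%C * (q.[z] * (q.[z])^*%C))) =
  nrm2 1 (horner q) - nrm2 1 (horner (p * q)).
Proof.
have i1 := horner_integrable 1 q q; have i2 := horner_integrable 1 (p * q) (p * q).
have -> : cint 1 (fun z => (1 - cabs p.[z] ^+ 2)%:C%C * (q.[z] * (q.[z])^*%C)) =
    cint 1 (fun z => q.[z] * (q.[z])^*%C + (-1) * ((p * q).[z] * ((p * q).[z])^*%C)).
  apply: eq_cint => z _; rewrite hornerM conjcM rmorphB rmorph1.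
  have -> : p.[z] * q.[z] * ((p.[z])^*%C * (q.[z])^*%C) =
    p.[z] * (p.[z])^*%C * (q.[z] * (q.[z])^*%C) by ring.
  by rewrite [p.[z] * _]conjM_cabs mulN1r mulrBl mul1r.
rewrite cintD ?cintZ//; last exact: cintegrableZ.
by rewrite cReD mulN1r /nrm2; congr (_ + _); case: (cint _ _).
Qed.

Lemma hankel_bound b f g : analytic_on (@disk R) b ->
  (forall z, cabs z < 1 -> cabs (b z) <= 1) -> bergman f -> bergman g ->
  (forall k, bergman k -> inner (fun z => (b z)^*%C * f z - g z) k = 0) ->
  nrm2 1 (fun z => (b z)^*%C * f z - g z) <= 32 * (nrm2 1 f - nrm2 1 (fun z => b z * f z)).
Proof.
move=> ba b1 bf bg o; have [fa f2 _] := bf; have [_ g2 _] := bg.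
have mb := analytic_measurable ba; have mbc := cmeasurable_conj mb.
have bc1 z : cabs z < 1 -> cabs (b z)^*%C <= 1 by move=> z1; rewrite cabs_conj b1.
have bf2 : L2 (fun z => b z * f z) by exact: (square_integrable_mul mb b1).
have bcf2 : L2 (fun z => (b z)^*%C * f z) by exact: (square_integrable_mul mbc bc1).
rewrite -!N_sqr; set d := N _; set x := N f; set y := N (fun z => b z * f z).
(* X, Y, D stand for the norms of q, p q and conj p q - h with polynomials p, q near b, f. The
   distance d compares with D because the projection is the nearest Bergman function, so [h] may
   replace it. *)
have main e : 0 < e -> e <= 1 -> exists X Y D, [/\ X <= x + e, y - e <= Y, d <= e + D,
    D ^+ 2 <= 32 * (X ^+ 2 - Y ^+ 2) & [/\ 0 <= X, 0 <= Y & 0 <= D]].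
  move=> e0 e1; have e2 : 0 < (e / 2) ^+ 2 by rewrite exprn_gt0// divr_gt0.
  have e2' : 0 <= e / 2 by lra.
  have toN h : nrm2 1 h <= (e / 2) ^+ 2 -> N h <= e / 2.
    by move=> hh; rewrite -(ler_pXn2r (_ : 0 < 2)%N) ?nnegrE ?sqrtr_ge0// N_sqr.
  have [p p1 /toN hp] := contraction_approx_L2 ba b1 f2 e2.
  have [q /toN hq] := bergman_dense bf e2.
  have mp := cmeasurable_horner 1 p; have mpc := cmeasurable_conj mp.
  have q2 := square_integrable_horner q.
  have pc1 z : cabs z < 1 -> cabs (p.[z])^*%C <= 1 by move=> z1; rewrite cabs_conj p1.
  have pq2 : L2 (fun z => p.[z] * q.[z]) by exact: (square_integrable_mul mp p1).
  have pcq2 : L2 (fun z => (p.[z])^*%C * q.[z]) by exact: (square_integrable_mul mpc pc1).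
  have hpc : N (fun z => ((b z)^*%C - (p.[z])^*%C) * f z) <= e / 2.
    rewrite [leLHS](_ : _ = N (fun z => (b z - p.[z]) * f z))//.
    rewrite !hnormE !nrm2E; congr Num.sqrt; apply: eq_Rintegral => x1 _.
    by rewrite !cabsM -conjcN -conjcD cabs_conj.
  have A1 := multiplier_dist mb mp f2 q2 b1 p1 hp hq.
  have A2 := multiplier_dist mbc mpc f2 q2 bc1 pc1 hpc hq.
  have [h hh] := hankel_poly_contraction q p1; rewrite contraction_defect -!N_sqr in hh.
  have h2 := square_integrable_horner h.
  exists (N (horner q)), (N (horner (p * q))), (N (fun z => (p.[z])^*%C * q.[z] - h.[z])).
  have -> : N (horner (p * q)) = N (fun z => p.[z] * q.[z]).
    by apply: N_ext => z _; rewrite hornerM.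
  split=> //; last by rewrite !hnormE !sqrtr_ge0.
  - have := N_dist q2 f2; rewrite -/x.
    have -> : N (fun z => q.[z] - f z) = N (fun z => f z - q.[z]).
      by rewrite !hnormE !nrm2E; congr Num.sqrt; apply: eq_Rintegral => x1 _; rewrite cabsC.
    by lra.
  - by have := N_dist bf2 pq2; rewrite -/y; lra.
  - have bh : bergman (restr (horner h)) := restr_bergman (analytic_horner h) h2.
    have [_ rh2 _] := bh.
    have : d <= N (fun z => (b z)^*%C * f z - restr (horner h) z).
      by rewrite -(ler_pXn2r (_ : 0 < 2)%N) ?nnegrE ?sqrtr_ge0// !N_sqr; exact: proj_min.
    move=> /le_trans; apply.
    rewrite [leLHS](@N_ext _ (fun z => ((b z)^*%C * f z - (p.[z])^*%C * q.[z]) +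
       ((p.[z])^*%C * q.[z] - h.[z]))); last first.
      by move=> z z1; rewrite restrE// addrA subrK.
    apply: le_trans (N_triangle (L2B bcf2 pcq2) (L2B pcq2 h2)) _.
    by rewrite lerD2r; lra.
  - by move: hh; rewrite (_ : N (horner (p * q)) = N (fun z => p.[z] * q.[z]))//;
      apply: N_ext => z _; rewrite hornerM.
have x0 : 0 <= x by rewrite sqrtr_ge0.
have y0 : 0 <= y by rewrite sqrtr_ge0.
have d0 : 0 <= d by rewrite sqrtr_ge0.
apply/ler_addgt0Pl => e e0.
(* The sum of all first-order error coefficients that arise when X, Y, D are replaced by x, y, d in
   the squared inequality. *)
pose K := 32 * (2 * x + 1 + 2 * y) + 12 * (x + 1) + 1.
have K0 : 0 < K by rewrite /K; lra.
have m0 : 0 < Num.min 1 (e / K) by rewrite lt_min ltr01 divr_gt0.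
have m1 : Num.min 1 (e / K) <= 1 by rewrite ge_min lexx.
have mK : Num.min 1 (e / K) * K <= e by rewrite -ler_pdivlMr// ge_min lexx orbT.
have [X [Y [D [hX hY hD DXY [X0 Y0 D0]]]]] := main _ m0 m1.
move: (Num.min _ _) m0 m1 mK hX hY hD => r r0 r1 rK hX hY hD.
(* An a priori bound, from D^2 <= 32 X^2 <= (6 X)^2, to control the cross term 2 r D. *)
have D6 : D <= 6 * (x + 1).
  apply: (@le_trans _ _ (6 * X)); last lra.
  rewrite -(ler_pXn2r (_ : 0 < 2)%N) ?nnegrE ?mulr_ge0//.
  by have := sqr_ge0 Y; have := sqr_ge0 X; rewrite exprMn; lra.
have XX : X ^+ 2 <= x ^+ 2 + (2 * x + 1) * r.
  apply: (@le_trans _ _ ((x + r) ^+ 2)); first by rewrite lerXn2r ?nnegrE//; lra.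
  nra.
have YY : y ^+ 2 - 2 * y * r <= Y ^+ 2.
  have [yr|yr] := leP r y; last by have := sqr_ge0 Y; nra.
  apply: (@le_trans _ _ ((y - r) ^+ 2)); first by have := sqr_ge0 r; lra.
  by rewrite lerXn2r ?nnegrE//; lra.
have DD : d ^+ 2 <= D ^+ 2 + 2 * r * D + r ^+ 2.
  apply: (@le_trans _ _ ((r + D) ^+ 2)); first by rewrite lerXn2r ?nnegrE//; lra.
  by rewrite sqrrD; lra.
have rD : r * D <= r * (6 * (x + 1)) by rewrite ler_wpM2l// ltW.
have rr : r ^+ 2 <= r by rewrite expr2 ler_piMl// ltW.
have e1 : K * r = 32 * ((2 * x + 1) * r + 2 * y * r) + 2 * (r * (6 * (x + 1))) + r.
  by rewrite /K; ring.
rewrite mulrC e1 in rK; lra.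
Qed.

End toeplitz_operators.

(** * Toeplitz operators, defect operators and comparison of their ranges *)

Section defect_operators.
Variable R : realType.
Local Notation C := R[i].
Local Notation V := (R[i] -> R[i]^o).
Local Notation N := (hnorm (@inner R : V -> V -> C)).
Local Notation L2 := (@square_integrable R).
Local Notation H := (@bergman R).
Implicit Types (b f g h k u : C -> C).
Let hs := @bergman_hspace R.

Lemma bergman_projP h : L2 h -> H (bergman_proj h) /\
  forall k, H k -> inner (fun z => h z - bergman_proj h z) k = 0.
Proof.
move=> h2; rewrite /bergman_proj; case: xgetP => [x _ [Hx o]|none]; first by split.
have [g Hg o] := projection_exists hs h2; by case: (none g).
Qed.

Lemma inner_proj h k : L2 h -> H k -> inner (bergman_proj h) k = inner h k.
Proof.
move=> h2 Hk; have [[_ p2 _] o] := bergman_projP h2; have [_ k2 _] := Hk.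
have := ipBl hs h2 p2 k2; rewrite (o k Hk) => /esym/eqP.
by rewrite subr_eq0 => /eqP.
Qed.

Lemma nrm2_proj h : L2 h ->
  nrm2 1 h = nrm2 1 (bergman_proj h) + nrm2 1 (fun z => h z - bergman_proj h z).
Proof.
move=> h2; have [Hp o] := bergman_projP h2; have [_ p2 _] := Hp.
rewrite -!N_sqr [N h](@N_ext _ _ (fun z => 1 * (h z - bergman_proj h z) + bergman_proj h z)).
  have := nm_sqrD hs 1 (L2B h2 p2) p2; rewrite (o _ Hp) cabs1 expr1n mul1r mulr0 mulr0 addr0.
  by move=> e; rewrite addrC; exact: e.
by move=> z _; rewrite mul1r subrK.
Qed.

Definition contractive u := cmeasurable 1 u /\ forall z, cabs z < 1 -> cabs (u z) <= 1.

Lemma contractive_conj u : contractive u -> contractive (conjfun u).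
Proof.
move=> [mu u1]; split; first exact: cmeasurable_conj.
by move=> z z1; rewrite /conjfun cabs_conj u1.
Qed.

Lemma conjfunK u : conjfun (conjfun u) = u.
Proof. by apply/funext => z; rewrite /conjfun conjcK. Qed.

Section contraction.
Variable u : C -> C.
Hypothesis cu : contractive u.

Lemma mul_L2 f : L2 f -> L2 (fun z => u z * f z).
Proof. by case: cu => mu u1 f2; exact: (square_integrable_mul mu u1 f2). Qed.

Lemma toeplitz_bergman f : H f -> H (toeplitz u f).
Proof. by move=> [_ f2 _]; have [] := bergman_projP (mul_L2 f2). Qed.

Lemma nrm2_toeplitz f : H f -> nrm2 1 (fun z => u z * f z) =
  nrm2 1 (toeplitz u f) + nrm2 1 (fun z => u z * f z - toeplitz u f z).
Proof. by move=> [_ f2 _]; exact: nrm2_proj (mul_L2 f2). Qed.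

Lemma N_toeplitz f : H f -> N (toeplitz u f) <= N f.
Proof.
move=> Hf; have [_ f2 _] := Hf; rewrite !hnormE ler_wsqrtr//.
apply: (@le_trans _ _ (nrm2 1 (fun z => u z * f z))).
  by rewrite nrm2_toeplitz// lerDl nrm2_ge0.
apply: nrm2_mono (mul_L2 f2) f2 _ => z z1.
by rewrite cabsM ler_piMl ?cabs_ge0//; case: cu => _; apply.
Qed.

Lemma toeplitz_lin : @linear_on R V H (toeplitz u).
Proof.
move=> c f g Hf Hg; have [_ f2 _] := Hf; have [_ g2 _] := Hg.
have Hfg := bergman_lin c Hf Hg; have [_ fg2 _] := Hfg.
have Tf := toeplitz_bergman Hf; have Tg := toeplitz_bergman Hg.
have Tfg := toeplitz_bergman Hfg.
apply: (ip_eq hs) => //; first exact: bergman_lin.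
move=> k Hk; have [_ k2 _] := Hk; have [_ Tf2 _] := Tf; have [_ Tg2 _] := Tg.
have [_ Tfg2 _] := Tfg.
rewrite (inner_conj k2 Tfg2) (inner_conj k2 (square_integrable_lin c Tf2 Tg2)).
have uf2 := mul_L2 f2; have ug2 := mul_L2 g2; have ufg2 := mul_L2 fg2.
congr (_^*)%C; rewrite (inner_lin c Tf2 Tg2 k2) (inner_proj uf2 Hk) (inner_proj ug2 Hk).
rewrite (inner_proj ufg2 Hk) -(inner_lin c uf2 ug2 k2).
by apply: inner_ext => // z _; rewrite /GRing.scale/=; ring.
Qed.

End contraction.

Lemma toeplitz_adj u f g : contractive u -> H f -> H g ->
  inner (toeplitz u f) g = inner f (toeplitz (conjfun u) g).
Proof.
move=> cu Hf Hg; have cu' := contractive_conj cu.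
have [_ f2 _] := Hf; have [_ g2 _] := Hg.
have [_ T2 _] := toeplitz_bergman cu' Hg.
rewrite inner_proj//; last exact: mul_L2.
rewrite (inner_conj f2 T2) inner_proj//; last exact: mul_L2.
rewrite -inner_conj//; last exact: mul_L2.
rewrite !innerE; apply: eq_cint => z _.
by rewrite /conjfun conjcM conjcK; ring.
Qed.

(** The product b f is analytic, so it is its own nearest Bergman function and projecting loses no
    norm. *)
Lemma toeplitz_holomorphic b f : contractive b -> analytic_on (@disk R) b -> H f ->
  nrm2 1 (toeplitz b f) = nrm2 1 (fun z => b z * f z).
Proof.
move=> cb ba Hf; have [fa f2 _] := Hf; have bf2 := mul_L2 cb f2.
have Hr := restr_bergman (analytic_mul ba fa) bf2.
have [HT o] := bergman_projP bf2.
have le := proj_min bf2 HT o Hr.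
have r0 : nrm2 1 (fun z => b z * f z - restr (fun w => b w * f w) z) = 0.
  rewrite nrm2E (@eq_Rintegral _ _ _ _ _ (fun=> 0)); first by rewrite /Rintegral integral0.
  by move=> x; rewrite inE => x1; rewrite restrE// subrr cabs0 expr0n.
rewrite (nrm2_toeplitz cb Hf) [X in _ + X](_ : _ = 0) ?addr0//.
by apply/eqP; rewrite eq_le nrm2_ge0 andbT -[X in _ <= X]r0.
Qed.

(** The chosen root has its defining properties as soon as some root exists, and T_u T_(conj u) is a
    self-adjoint contraction, to which [sqrt_exists] applies. *)
Lemma defect_spec u : contractive u -> positive_operator (defect u) /\
  forall f, H f -> defect u (defect u f) = f - toeplitz u (toeplitz (conjfun u) f).
Proof.
move=> cu; have cu' := contractive_conj cu.
rewrite /defect /sqrt_operator; case: xgetP => [S _ //|none].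
pose X : operator R := fun f => toeplitz u (toeplitz (conjfun u) f).
have XH f : H f -> H (X f) := fun Hf => toeplitz_bergman cu (toeplitz_bergman cu' Hf).
have Xl : linear_on H X.
  move=> c f g Hf Hg; rewrite /X (toeplitz_lin cu')// (toeplitz_lin cu)//;
    exact: toeplitz_bergman.
have Xs f g : H f -> H g -> inner (X f) g = inner f (X g).
  move=> Hf Hg; have Hf' := toeplitz_bergman cu' Hf; have Hg' := toeplitz_bergman cu' Hg.
  have e := toeplitz_adj cu' Hf Hg'; rewrite (conjfunK u) in e.
  by rewrite -e; exact (toeplitz_adj cu Hf' Hg).
have X1 f : H f -> N (X f) <= N f.
  move=> Hf; apply: le_trans (N_toeplitz cu (toeplitz_bergman cu' Hf)) _.
  exact: N_toeplitz.
have [S [SH Sl SM S0 SS]] := sqrt_exists hs XH Xl Xs X1.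
case: (none S); split; last by [].
by split=> //; split=> //; exists 2.
Qed.

Section range.
Variable u : C -> C.
Hypothesis cu : contractive u.
Let S := defect u.

Lemma defect_bergman f : H f -> H (S f).
Proof. by have [[[h _ _] _] _] := defect_spec cu; exact: h. Qed.

Lemma defect_lin : @linear_on R V H S.
Proof. by have [[[_ h _] _] _] := defect_spec cu; exact: h. Qed.

Lemma defect_bounded : exists M, forall f, H f -> N (S f) <= M * N f.
Proof. by have [[[_ _ h] _] _] := defect_spec cu. Qed.

Lemma defect_selfadj f g : H f -> H g -> inner (S f) g = inner f (S g).
Proof.
have [[_ S0] _] := defect_spec cu.
exact: (positive_selfadj hs defect_bergman defect_lin).
Qed.

(** From |S f|^2 = <S^2 f, f> and the adjunction between T_u and T_(conj u). *)
Lemma nrm2_defect f : H f ->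
  nrm2 1 (S f) = nrm2 1 f - nrm2 1 (toeplitz (conjfun u) f).
Proof.
move=> Hf; have cu' := contractive_conj cu; have HT := toeplitz_bergman cu' Hf.
have HTT := toeplitz_bergman cu HT; have [_ f2 _] := Hf; have [_ TT2 _] := HTT.
rewrite -!inner_nrm2 defect_selfadj//; last exact: defect_bergman.
have [_ SS] := defect_spec cu; rewrite /S SS// -/S.
rewrite (inner_conj f2 (L2B f2 TT2)) [inner (f - _) f](ipBl hs f2 TT2 f2) toeplitz_adj//.
Qed.

Lemma range_liftP x : range_space S x -> coker S (range_lift S x) /\ S (range_lift S x) = x.
Proof.
move=> [f Hf <-]; rewrite /range_lift; case: xgetP => [y _ //|none].
have [M SM] := defect_bounded.
have [g [Hg go] Sg] := lift_exists hs defect_bergman defect_lin SM Hf.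
by case: (none g); split=> //; split.
Qed.

Lemma range_lift_min x g : H g -> S g = x -> range_norm S x <= N g.
Proof.
move=> Hg Sg; have xr : range_space S x by exists g.
have [[Hl lo] Sl] := range_liftP xr.
exact: (lift_min hs defect_lin (conj Hl lo) Hg (etrans Sl (esym Sg))).
Qed.

End range.

(** A smaller defect has the smaller range: Douglas' lemma, applied to the lift of [x] for [u1],
    gives a preimage for [u2], whose norm dominates the range norm by minimality of lifts. The
    inequality between norms thus reverses. *)
Lemma range_compare u1 u2 M : contractive u1 -> contractive u2 -> 0 <= M ->
  (forall f, H f -> N (defect u1 f) <= M * N (defect u2 f)) ->
  forall x, sub_bergman u1 x ->
  sub_bergman u2 x /\ sub_bergman_norm u2 x <= M * sub_bergman_norm u1 x.
Proof.
move=> c1 c2 M0 le x xr; have [[Hl _] Sl] := range_liftP c1 xr.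
have [h [Hh Sh hM]] := douglas hs M0 (defect_bergman c1) (defect_bergman c2)
  (defect_lin c2) (defect_selfadj c1) (defect_selfadj c2) le Hl.
have Shx : defect u2 h = x by rewrite Sh.
split; first by exists h.
exact: le_trans (range_lift_min c2 Hh Shx) hM.
Qed.

Lemma supnorm_le b z : Hinfty b -> supnorm b <= 1 -> disk z -> cabs (b z) <= 1.
Proof.
move=> [_ [M bM]] b1 zd; apply: le_trans b1; apply: ub_le_sup; last by exists z.
by exists M => _ [w wd <-]; rewrite -lecR -/(cabs _) -normE bM.
Qed.

Lemma Hinfty_contractive b : Hinfty b -> supnorm b <= 1 -> contractive b.
Proof.
move=> bH b1; have [ba _] := bH; split; first exact: analytic_measurable.
by move=> z /diskE; exact: supnorm_le.
Qed.

(** Here x = |f|^2, y = |b f|^2, and t, d are the squared Toeplitz and Hankel parts of conj b f.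
    Then S1^2 = S2^2 + d <= 33 S2^2, and 33 <= 6^2. *)
Lemma defect_arith (S1 S2 x y t d : R) : 0 <= S1 -> 0 <= S2 ->
  S1 ^+ 2 = x - t -> S2 ^+ 2 = x - y -> y = t + d -> 0 <= d -> d <= 32 * (x - y) ->
  S2 <= 1 * S1 /\ S1 <= 6 * S2.
Proof.
move=> S10 S20 e1 e2 e3 d0 key.
by split; rewrite -(ler_pXn2r (_ : 0 < 2)%N) ?nnegrE ?mulr_ge0// exprMn e1 e2; lra.
Qed.

Lemma defect_compare b : Hinfty b -> supnorm b <= 1 -> forall f, H f ->
  N (defect (conjfun b) f) <= 1 * N (defect b f) /\
  N (defect b f) <= 6 * N (defect (conjfun b) f).
Proof.
move=> bH b1 f Hf; have [ba _] := bH.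
have cb := Hinfty_contractive bH b1; have bb := proj2 cb.
have cb' := contractive_conj cb; have [_ f2 _] := Hf.
have e1 := nrm2_defect cb Hf; have e2 := nrm2_defect cb' Hf.
rewrite conjfunK (toeplitz_holomorphic cb ba Hf) in e2.
have e3 := nrm2_toeplitz cb' Hf.
have e4 : nrm2 1 (fun z => conjfun b z * f z) = nrm2 1 (fun z => b z * f z).
  by rewrite !nrm2E; apply: eq_Rintegral => x _; rewrite !cabsM cabs_conj.
have [HT o] := bergman_projP (mul_L2 cb' f2).
have key := hankel_bound ba bb Hf HT o.
have d0 := nrm2_ge0 1 (fun z => conjfun b z * f z - toeplitz (conjfun b) f z).
rewrite e4 in e3.
exact (defect_arith (sqrtr_ge0 _) (sqrtr_ge0 _) (etrans (N_sqr _) e1) (etrans (N_sqr _) e2)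
  e3 d0 key).
Qed.

End defect_operators.

Unset Implicit Arguments.
Set Strict Implicit.

Theorem theorem1p1 (R : realType) (b : R[i] -> R[i])
    (b_Hinfty : Hinfty b) (b_le1 : supnorm b <= 1) :
  sub_bergman b = sub_bergman (conjfun b) /\
  exists c C : R, [/\ 0 < c, 0 < C &
    forall f : R[i] -> R[i], sub_bergman b f ->
      c * sub_bergman_norm (conjfun b) f <= sub_bergman_norm b f /\
      sub_bergman_norm b f <= C * sub_bergman_norm (conjfun b) f].
Proof.
have cb := Hinfty_contractive b_Hinfty b_le1; have cb' := contractive_conj cb.
have cmp := defect_compare b_Hinfty b_le1.
have six : 0 <= 6 :> R by exact: ler0n.
have to_conj := range_compare cb cb' six (fun f Hf => proj2 (cmp f Hf)).
have of_conj := range_compare cb' cb ler01 (fun f Hf => proj1 (cmp f Hf)).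
split.
  apply/seteqP; split=> x xr; first exact: (proj1 (to_conj x xr)).
  exact: (proj1 (of_conj x xr)).
exists 6^-1, 1; split; [by rewrite invr_gt0|exact: ltr01|].
move=> f fr; have [fr' le] := to_conj f fr; have [_ le'] := of_conj f fr'.
have scale (x y : R) : x <= 6 * y -> 6^-1 * x <= y by rewrite ler_pdivrMl.
exact (conj (scale _ _ le) le').
Qed.
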